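(* Let $M$ be an infinite subset of $\mathbb{N}$ and let $(y_k)_{k\in\mathbb{N}}$ be a normalized block sequence in $X_{ius}$. Then $\operatorname{dist}(S_{\langle e_n\rangle_{n\in M}},S_{\langle y_k\rangle_k})=0$.
   Context: $\langle\cdot\rangle$ denotes linear span, $S_Y$ is the unit sphere of $Y$ for the norm of $X_{ius}$, and $\operatorname{dist}(A,B)=\inf\{\|a-b\|:a\in A,b\in B\}$. A block sequence is a sequence of nonzero vectors $y_k\in c_{00}$ with $y_1<y_2<\cdots$; normalized means $\|y_k\|=1$. Scalars are real, $\mathbb{N}=\{1,2,\dots\}$. $c_{00}$ is the space of finitely supported sequences, with standard basis $(e_n)$, also written $(e_n^* )$ when its elements are viewed as functionals; $f(x)=\langle f,x\rangle=\sum_n f(n)x(n)$, $\|f\|_\infty=\max_n|f(n)|$. $\operatorname{supp}x=\{n:x(n)\ne 0\}$, $\operatorname{range}(x)$ is the smallest interval of $\mathbb{N}$ containing $\operatorname{supp}x$. For sets, $A<B$ means $\max A<\min B$; $x<y$ means $\operatorname{supp}x<\operatorname{supp}y$. For an interval $E\subset\mathbb{N}$, $Ex$ is the restriction of $x$ to $E$. Fix positive integers $m_j,n_j,s_j$ with $m_1=2$, $m_{j+1}=m_j^5$, $n_1=4$, $n_{j+1}=(4n_j)^{s_j}$, $2^{s_j}\ge m_{j+1}^3$. Let $\mathbf{Q}$ be the set of sequences with finite nonempty support, rational coordinates, all of modulus at most $1$, and $\mathbf{Q_s}$ the set of all $(x_1,f_1,\dots,x_n,f_n)$ with $x_i,f_i\in\mathbf{Q}$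 and $\operatorname{range}(x_i)\cup\operatorname{range}(f_i)<\operatorname{range}(x_{i+1})\cup\operatorname{range}(f_{i+1})$ for $i<n$. Fix an injection $\sigma:\mathbf{Q_s}\to\{2j:j\in\mathbb{N}\}$ such that for every $\phi=(x_1,f_1,\dots,x_n,f_n)\in\mathbf{Q_s}$: $\sigma(x_1,f_1,\dots,x_{n-1},f_{n-1})<\sigma(\phi)$ and $\max\{\operatorname{range}(x_n)\cup\operatorname{range}(f_n)\}\le m_{\sigma(\phi)}^{1/2}$. Special sequences: $\phi=(x_1,f_1,\dots,x_{2k},f_{2k})\in\mathbf{Q_s}$, with $\phi_i=(x_1,f_1,\dots,x_i,f_i)$, is a special sequence of length $2k$ if: (1) for some $j\in\mathbb{N}$ with $m_{2j}^{1/2}>2k$, $x_1=\frac1{n_{2j}}\sum_{l=1}^{n_{2j}}e_{1,l}$ and $f_1=\frac1{m_{2j}}\sum_{l=1}^{n_{2j}}e^*_{1,l}$, where $(e_{1,l})_l$ are $n_{2j}$ distinct standard basis vectors; (2) for $1\le i\le k$, $\|f_{2i}\|_\infty\le\frac1{m_{\sigma(\phi_{2i-1})}}$ and $|f_{2i}(x_{2i})|\le\frac1{m_{\sigma(\phi_{2i-1})}}$; (3) for $1\le i<k$, with $p=\sigma(\phi_{2i})$, $x_{2i+1}=\frac1{n_p}\sum_{l=1}^{n_p}e_{2i+1,l}$ and $f_{2i+1}=\frac1{m_p}\sum_{l=1}^{n_p}e^*_{2i+1,l}$, where $(e_{2i+1,l})_l$ are $n_p$ distinct standard basis vectors. Norming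 set: $K_0=K_0^0=\{\pm e_n^*:n\in\mathbb{N}\}$, $K_0^j=\emptyset$ for $j\ge1$, and $K_n^0=K_0$ for all $n$. For $n\ge1$, $j\in\mathbb{N}$: $K_n^{2j}=K_{n-1}^{2j}\cup\{\frac1{m_{2j}}\sum_{i=1}^d f_i:d\le n_{2j},\ f_1<\dots<f_d,\ f_i\in K_{n-1}\}$. For a special sequence $\phi=(x_1,f_1,\dots,x_{n_{2j+1}},f_{n_{2j+1}})$ of length $n_{2j+1}$ with $f_{2i}\in K_{n-1}^{\sigma(\phi_{2i-1})}$ for $i\le n_{2j+1}/2$, $K_{n,\phi}^{2j+1}$ is the set of all $\frac{\pm1}{m_{2j+1}}E\bigl(\sum_{i=1}^{n_{2j+1}/2}(\lambda_{f'_{2i}}f_{2i-1}+f'_{2i})\bigr)$, where $E$ is an interval, $f'_{2i}\in K_{n-1}^{\sigma(\phi_{2i-1})}$, $\operatorname{supp}f'_{2i}=\operatorname{supp}f_{2i}$, $|g(x_{2i})|\le\frac1{m_{\sigma(\phi_{2i-1})}}$ for all $g\in K_{n-1}^{\sigma(\phi_{2i-1})}$, and $\lambda_{f'_{2i}}=f'_{2i}(m_{\sigma(\phi_{2i-1})}x_{2i})$ if $f'_{2i}(x_{2i})\ne0$, $\lambda_{f'_{2i}}=\pm\frac1{n_{2j+1}^2}$ otherwise. $K_n^{2j+1}$ is the union of $K_{n-1}^{2j+1}$ and all $K_{n,\phi}^{2j+1}$, $\phi$ a special sequence of length $n_{2j+1}$. $K_n=\bigcup_jK_n^j$, $K=\bigcup_nK_n$.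 $X_{ius}$ is the completion of $c_{00}$ under $\|x\|=\|x\|_K=\sup\{f(x):f\in K\}$. *)

(* Defs.v *)
From HB Require Import structures.
From mathcomp Require Import all_boot all_order all_algebra.
From mathcomp Require Import all_classical all_reals all_analysis.

Set Implicit Arguments.
Unset Strict Implicit.
Unset Printing Implicit Defensive.

Import Order.TTheory GRing.Theory Num.Theory.
Import numFieldNormedType.Exports.

Local Open Scope classical_set_scope.
Local Open Scope ring_scope.

(* N = {1, 2, ...} is encoded as the positive elements of nat: the coordinate
   of index 0 of an element of c00 is required to vanish, so that all supports
   are sets of positive integers. *)
Definition c00_pred (R : realType) : {pred (nat -> R)} :=
  [pred x : nat -> R | `[< x 0%N = 0 /\ finite_set [set n | x n != 0] >]].

Record c00 (R : realType) := C00 {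
  coord :> nat -> R ;
  coordP : coord \in @c00_pred R }.

HB.instance Definition _ (R : realType) := [isSub for @coord R].
HB.instance Definition _ (R : realType) := [Choice of c00 R by <:].

Lemma c00_submod (R : realType) : GRing.submod_closed (@c00_pred R).
Proof.
split.
  by apply/asboolP; split=> //; apply: sub_finite_set (finite_set0 nat) => n /=;
     rewrite eqxx.
move=> a x y /asboolP[x0 fx] /asboolP[y0 fy]; apply/asboolP; split.
  by change (a * x 0%N + y 0%N = 0); rewrite x0 y0 mulr0 addr0.
have fU : finite_set ([set n | x n != 0] `|` [set n | y n != 0]).
  by rewrite finite_setU.
apply: sub_finite_set fU => n; change (a * x n + y n != 0 ->
  ([set n | x n != 0] `|` [set n | y n != 0]) n) => h.
have [xn|xn] := eqVneq (x n) 0; last by left.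
by right; move: h; rewrite xn mulr0 add0r.
Qed.

HB.instance Definition _ (R : realType) :=
  GRing.isSubmodClosed.Build R (nat -> R) (@c00_pred R) (@c00_submod R).
HB.instance Definition _ (R : realType) := [SubChoice_isSubLmodule of c00 R by <:].

Lemma e_subproof (R : realType) (n : nat) :
  (fun i : nat => ((i == n) && (0 < n)%N)%:R : R) \in @c00_pred R.
Proof.
apply/asboolP; split; first by case: n.
apply: sub_finite_set (finite_set1 n) => i /=.
by have [//|_] := eqVneq i n; rewrite /= eqxx.
Qed.

(* Basis vector e_n, also used as the functional e_n^*; the junk value at
   n = 0 is the zero vector. *)
Definition e (R : realType) (n : nat) : c00 R := C00 (e_subproof R n).

Lemma restr_subproof (R : realType) (E : set nat) (x : c00 R) :
  (fun n => if n \in E then x n else 0) \in @c00_pred R.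
Proof.
have /asboolP[x0 fx] := coordP x.
apply/asboolP; split; first by rewrite x0; case: ifP.
by apply: sub_finite_set fx => n /=; case: ifP => // _; rewrite eqxx.
Qed.

Definition restr (R : realType) (E : set nat) (x : c00 R) : c00 R :=
  C00 (restr_subproof E x).

(* The sum has at most finitely many nonzero terms. *)
Definition pairing (R : realType) (f x : c00 R) : R :=
  \sum_(n \in [set: nat]) (f n * x n).

Definition norm_inf (R : realType) (f : c00 R) : R :=
  sup [set `|f n| | n in [set: nat]].

Definition supp (R : realType) (x : c00 R) : set nat := [set n | x n != 0].

Definition range_of (R : realType) (x : c00 R) : set nat :=
  [set n | exists i j, [/\ supp x i, supp x j & (i <= n <= j)%N]].

Definition set_before (A B : set nat) : Prop :=
  forall a b, A a -> B b -> (a < b)%N.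

Definition before (R : realType) (x y : c00 R) : Prop :=
  set_before (supp x) (supp y).

Definition nat_interval (E : set nat) : Prop :=
  forall a b c, E a -> E b -> (a <= c <= b)%N -> E c.

(* All sequences of parameters are indexed by j >= 1; the value at 0 is
   irrelevant. *)
Definition ius_params (m n s : nat -> nat) : Prop :=
  [/\ m 1%N = 2%N,
      forall j, (0 < j)%N -> m j.+1 = (m j ^ 5)%N,
      n 1%N = 4%N,
      forall j, (0 < j)%N -> n j.+1 = ((4 * n j) ^ s j)%N &
      forall j, (0 < j)%N -> (0 < s j)%N /\ (m j.+1 ^ 3 <= 2 ^ s j)%N].

Definition in_Q (R : realType) (x : c00 R) : Prop :=
  supp x !=set0 /\
  forall n, (exists q : rat, x n = ratr q) /\ `|x n| <= 1.

(* The tuple (x_1, f_1, ..., x_n, f_n) is the list of the pairs (x_i, f_i);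
   x_ and f_ are 1-based, and (x_1, f_1, ..., x_i, f_i) is [take i phi]. *)
Definition x_ (R : realType) (phi : seq (c00 R * c00 R)) (i : nat) : c00 R :=
  (nth (0, 0) phi i.-1).1.
Definition f_ (R : realType) (phi : seq (c00 R * c00 R)) (i : nat) : c00 R :=
  (nth (0, 0) phi i.-1).2.

Definition ranges (R : realType) (phi : seq (c00 R * c00 R)) (i : nat) :
    set nat :=
  range_of (x_ phi i) `|` range_of (f_ phi i).

Definition in_Qs (R : realType) (phi : seq (c00 R * c00 R)) : Prop :=
  [/\ (0 < size phi)%N,
      forall i, (1 <= i <= size phi)%N -> in_Q (x_ phi i) /\ in_Q (f_ phi i) &
      forall i, (1 <= i < size phi)%N ->
        set_before (ranges phi i) (ranges phi i.+1)].

(* sigma is given on all lists, but only its values on Q_s are constrained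
   (and used). *)
Definition coding (R : realType) (m : nat -> nat)
    (sigma : seq (c00 R * c00 R) -> nat) : Prop :=
  [/\ forall phi, in_Qs phi -> exists2 j, (0 < j)%N & sigma phi = (2 * j)%N,
      forall phi psi, in_Qs phi -> in_Qs psi -> sigma phi = sigma psi ->
        phi = psi,
      forall phi, in_Qs phi -> (1 < size phi)%N ->
        (sigma (take (size phi).-1 phi) < sigma phi)%N &
      forall phi, in_Qs phi -> forall r, ranges phi (size phi) r ->
        r%:R <= Num.sqrt (m (sigma phi))%:R :> R].

Definition average_pair (R : realType) (m n : nat -> nat) (p : nat)
    (x f : c00 R) : Prop :=
  exists ls : seq nat,
    [/\ uniq ls, all (fun l => 0 < l)%N ls, size ls = n p,
        x = (n p)%:R^-1 *: \sum_(l <- ls) e R l &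
        f = (m p)%:R^-1 *: \sum_(l <- ls) e R l].

(* Special sequences of length 2k. *)
Definition special (R : realType) (m n : nat -> nat)
    (sigma : seq (c00 R * c00 R) -> nat) (k : nat)
    (phi : seq (c00 R * c00 R)) : Prop :=
  [/\ in_Qs phi /\ size phi = (2 * k)%N,
      exists j, [/\ (0 < j)%N,
        (2 * k)%:R < Num.sqrt (m (2 * j)%N)%:R :> R &
        average_pair m n (2 * j) (x_ phi 1) (f_ phi 1)],
      forall i, (1 <= i <= k)%N ->
        let w := m (sigma (take (2 * i).-1 phi)) in
        norm_inf (f_ phi (2 * i)) <= w%:R^-1 /\
        `|pairing (f_ phi (2 * i)) (x_ phi (2 * i))| <= w%:R^-1 &
      forall i, (1 <= i < k)%N ->
        average_pair m n (sigma (take (2 * i) phi))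
          (x_ phi (2 * i).+1) (f_ phi (2 * i).+1)].

Definition K_zero (R : realType) : set (c00 R) :=
  [set f | exists2 n, (0 < n)%N & f = e R n \/ f = - e R n].

(* In the next three definitions P j stands for K_{n-1}^j. In f_1 < ... < f_d
   the relation is required for all pairs, because functionals with empty
   support (which occur in K) make it non-transitive. *)
Definition K_even (R : realType) (m n : nat -> nat) (P : nat -> set (c00 R))
    (q : nat) : set (c00 R) :=
  [set f | exists d (g : 'I_d -> c00 R),
    [/\ (0 < d <= n q)%N,
        forall a b : 'I_d, (a < b)%N -> before (g a) (g b),
        forall a, exists j, P j (g a) &
        f = (m q)%:R^-1 *: \sum_(a < d) g a]].

(* n_q is a multiple of 4, so that a special sequence of length n_q is one of
   length 2k with k = n_q / 2. *)
Definition K_odd (R : realType) (m n : nat -> nat)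
    (sigma : seq (c00 R * c00 R) -> nat) (P : nat -> set (c00 R)) (q : nat)
    (phi : seq (c00 R * c00 R)) : set (c00 R) :=
  let k := (n q)./2 in
  let tau i := sigma (take (2 * i).-1 phi) in
  [set f | [/\ special m n sigma k phi,
    forall i, (1 <= i <= k)%N -> P (tau i) (f_ phi (2 * i)) &
    exists (eps : R) (E : set nat) (f' : nat -> c00 R) (lambda : nat -> R),
      [/\ eps = 1 \/ eps = -1,
          nat_interval E,
          forall i, (1 <= i <= k)%N ->
            [/\ P (tau i) (f' i),
                supp (f' i) = supp (f_ phi (2 * i)) &
                forall g, P (tau i) g ->
                  `|pairing g (x_ phi (2 * i))| <= (m (tau i))%:R^-1],
          forall i, (1 <= i <= k)%N ->
            if pairing (f' i) (x_ phi (2 * i)) != 0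
            then lambda i = pairing (f' i) ((m (tau i))%:R *: x_ phi (2 * i))
            else lambda i = ((n q)%:R ^+ 2)^-1 \/
                 lambda i = - ((n q)%:R ^+ 2)^-1 &
          f = (eps / (m q)%:R) *:
                restr E (\sum_(1 <= i < k.+1)
                           (lambda i *: f_ phi (2 * i).-1 + f' i))]]].

(* The superscript 1 = 2 * 0 + 1 is not used by the construction: the sets
   with that superscript are empty. *)
Definition K_step (R : realType) (m n : nat -> nat)
    (sigma : seq (c00 R * c00 R) -> nat) (P : nat -> set (c00 R)) :
    nat -> set (c00 R) :=
  fun q =>
    if q == 0%N then @K_zero R
    else if q == 1%N then set0
    else if odd q then
      P q `|` \bigcup_(phi in [set: seq (c00 R * c00 R)])
                K_odd m n sigma P q phi
    else P q `|` K_even m n P q.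

(* K_n^j is [K_level m n sigma n j]. *)
Definition K_level (R : realType) (m n : nat -> nat)
    (sigma : seq (c00 R * c00 R) -> nat) (l : nat) : nat -> set (c00 R) :=
  iter l (K_step m n sigma) (fun j => if j == 0%N then @K_zero R else set0).

Definition K_ius (R : realType) (m n : nat -> nat)
    (sigma : seq (c00 R * c00 R) -> nat) : set (c00 R) :=
  \bigcup_l \bigcup_j K_level m n sigma l j.

Definition norm_ius (R : realType) (m n : nat -> nat)
    (sigma : seq (c00 R * c00 R) -> nat) (x : c00 R) : R :=
  sup [set pairing f x | f in K_ius m n sigma].

(* (X, J) is a completion of (c00, N); it is unique up to isometry. *)
Definition is_completion (R : realType) (N : c00 R -> R)
    (X : completeNormedModType R) (J : {linear c00 R -> X}) : Prop :=
  (forall x, `|J x| = N x) /\ dense (range J).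

Definition lin_span (R : realType) (V : lmodType R) (A : set V) : set V :=
  [set x | exists d (c : 'I_d -> R) (v : 'I_d -> V),
    (forall i, A (v i)) /\ x = \sum_(i < d) c i *: v i].

Definition unit_sphere (R : realType) (X : normedModType R) (Y : set X) :
    set X :=
  Y `&` [set x | `|x| = 1].

(* As an extended real, so that the distance to the empty set is +oo. *)
Definition dist (R : realType) (X : normedModType R) (A B : set X) : \bar R :=
  ereal_inf [set `|a - b|%:E | a in A & b in B].

Definition block_sequence (R : realType) (y : nat -> c00 R) : Prop :=
  forall k, y k <> 0 /\ before (y k) (y k.+1).

(* Main.v *)
Require Import Defs.
From HB Require Import structures.
From mathcomp Require Import all_boot all_order all_algebra.
From mathcomp Require Import all_classical all_reals all_analysis.
From mathcomp Require Import zify ring lra.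

Set Implicit Arguments.
Unset Strict Implicit.
Unset Printing Implicit Defensive.

Import Order.TTheory GRing.Theory Num.Theory.
Import numFieldNormedType.Exports.

(** Two unit vectors, one in the span of the basis vectors e_n with n in M and
    one in the span of the blocks y_k, are made arbitrarily close as follows.
    Choose a special sequence (x_1, f_1, ..., x_N, f_N) of length N = n_q, q
    odd, whose odd members x_(2i-1) are averages of basis vectors with indices
    in M and whose even members x_(2i) lie, up to small errors, in the block
    subspace. Let z_j be x_j multiplied by the weight m_(p_j) of its functional.
    The functional of weight m_q carried by the special sequence shows that the
    sum of the even z_j has norm at least a constant times N / m_q
    ([block_part_large]), whereas the alternating sum of all z_j has norm at
    most a constant times N / m_q^3 ([alternating_small]). Hence the sum of the
    odd z_j, a combination of the e_n, and the sum of the even z_j, which is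
    almost a combination of the y_k, are close relative to their norms
    ([near_pair]), and m_q is as large as desired.

    Upper bounds. Let X be a sum of successive blocks, and let a functional f
    live on an interval [u, v). The estimates have the form
    C (A + (number of blocks beginning in [u, v)) kappa), called [controlled].
    The number of blocks is additive over adjacent intervals, so the estimate
    passes from the terms of a functional of weight m_r to the functional
    itself: A is multiplied by n_r / m_r, and kappa is divided by m_r, thus at
    least halved. Repeating this s_(p-1) times with weights r < p
    ([controlled_iter]) is cheap, because n_p is (4 n_(p-1))^(s_(p-1)), and
    gains the factor 2^(s_(p-1)) >= m_p^3. Only functionals of weight at least
    m_p remain: those of larger weight are small on all blocks but one, when
    the blocks form a rapidly increasing sequence, and those of weight exactly
    m_p are estimated by hand. This is used twice.

    First, for p even and rapidly increasing sequences of l_1-averages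
    ([l1_average], [ris_sequence]) or of basis vectors: the averages of n_p
    blocks times m_p are again [tame], that is, they are small on functionals
    of a weight different from m_p ([tame_average]). This yields the members of
    special sequences ([odd_member], [even_member]).

    Second, for p = q and the alternating vectors z_j. Here a functional of
    weight m_q is bounded by a constant on the whole sum
    ([odd_weight_alternating]), by the definition of the odd functionals: it
    comes from a special sequence psi. Where psi agrees with the chosen
    sequence, the coefficient lambda makes f(z_(2i-1)) and f(z_(2i)) equal up to
    1 / n_q^2, so the terms cancel in pairs; after the first disagreement the
    injectivity of the coding makes the weights of psi different from the
    weights of the z_j, with at most three exceptions, and tameness applies. *)

Local Open Scope classical_set_scope.
Local Open Scope ring_scope.

(** * The space of finitely supported sequences *)

Section FinitelySupported.
Variable R : realType.
Implicit Types (x y f g h : c00 R) (E : set nat).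

Lemma c00_eqP x y : (forall i, x i = y i) -> x = y.
Proof. by move=> xy; apply: val_inj; apply/funext. Qed.

Lemma coord_0 x : x 0%N = 0.
Proof. by have /asboolP[] := coordP x. Qed.

Lemma coord_zero i : (0 : c00 R) i = 0.
Proof. by []. Qed.

Lemma coordD x y i : (x + y) i = x i + y i.
Proof. by []. Qed.

Lemma coordN x i : (- x) i = - x i.
Proof. by []. Qed.

Lemma coordZ a x i : (a *: x) i = a * x i.
Proof. by []. Qed.

Lemma coord_sum I (s : seq I) (P : pred I) (F : I -> c00 R) i :
  (\sum_(k <- s | P k) F k) i = \sum_(k <- s | P k) F k i.
Proof. by elim/big_rec2 : _ => // k a b _ <-. Qed.

Lemma coord_e n i : e R n i = ((i == n) && (0 < n)%N)%:R.
Proof. by []. Qed.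

Lemma coord_restr E x i : restr E x i = if i \in E then x i else 0.
Proof. by []. Qed.

Lemma suppE x i : supp x i = (x i != 0).
Proof. by []. Qed.

Lemma suppN x i : ~ supp x i -> x i = 0.
Proof. by rewrite /supp /= => /negP/negPn/eqP. Qed.

Lemma supp_pos x i : supp x i -> (0 < i)%N.
Proof. by rewrite /supp /=; case: i => //; rewrite coord_0 eqxx. Qed.

Lemma supp_e n i : supp (e R n) i -> i = n.
Proof. by rewrite suppE coord_e; have [//|] := eqVneq i n; rewrite eqxx. Qed.

Lemma suppZ a x : supp (a *: x) `<=` supp x.
Proof.
by move=> i; rewrite suppE coordZ => h; apply: contra h => /eqP->; rewrite mulr0.
Qed.

Lemma supp_restr E x : supp (restr E x) `<=` supp x.
Proof. by move=> i; rewrite suppE coord_restr; case: ifP => //; rewrite eqxx. Qed.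

Lemma supp_sum I (s : seq I) (P : pred I) (F : I -> c00 R) i :
  supp (\sum_(k <- s | P k) F k) i -> exists2 k, P k & supp (F k) i.
Proof.
elim/big_rec: _ => [|k x Pk IH]; first by rewrite suppE eqxx.
rewrite suppE coordD => h; have [F0|Fn] := eqVneq (F k i) 0; last by exists k.
by apply: IH; move: h; rewrite F0 add0r.
Qed.

Lemma restrD E x y : restr E (x + y) = restr E x + restr E y.
Proof.
by apply: c00_eqP => i; rewrite coordD !coord_restr; case: ifP; rewrite ?addr0.
Qed.

Lemma restrZ E a x : restr E (a *: x) = a *: restr E x.
Proof.
by apply: c00_eqP => i; rewrite coordZ !coord_restr; case: ifP; rewrite ?mulr0.
Qed.

Lemma restr0 E : restr E (0 : c00 R) = 0.
Proof. by apply: c00_eqP => i; rewrite coord_restr; case: ifP. Qed.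

Lemma restr_sum E I (s : seq I) (P : pred I) (F : I -> c00 R) :
  restr E (\sum_(k <- s | P k) F k) = \sum_(k <- s | P k) restr E (F k).
Proof.
elim: s => [|k s IH]; first by rewrite !big_nil restr0.
by rewrite !big_cons; case: ifP; rewrite ?restrD IH.
Qed.

Lemma restr_id E x : supp x `<=` E -> restr E x = x.
Proof.
move=> xE; apply: c00_eqP => i; rewrite coord_restr; case: ifPn => //.
by rewrite notin_setE => iE; rewrite suppN// => /xE.
Qed.

Lemma restr_disjoint E x : (forall i, supp x i -> ~ E i) -> restr E x = 0.
Proof.
move=> xE; apply: c00_eqP => i; rewrite coord_restr coord_zero; case: ifPn => //.
by rewrite inE => Ei; apply: suppN => /xE.
Qed.

Lemma restr_restr E (E' : set nat) x : restr E (restr E' x) = restr (E `&` E') x.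
Proof.
by apply: c00_eqP => i; rewrite !coord_restr in_setI; do 2 case: (i \in _).
Qed.

Lemma supp_bound x : exists N, forall i, supp x i -> (i < N)%N.
Proof.
have /asboolP[_ fx] := coordP x.
have /finite_seqP[s sP] := fx.
exists (\max_(i <- s) i).+1 => i xi; rewrite ltnS; apply: leq_bigmax_seq => //.
by have : [set` s] i by rewrite -sP.
Qed.

Lemma supp_max x : x <> 0 ->
  exists2 i, supp x i & forall j, supp x j -> (j <= i)%N.
Proof.
move=> x0; have [N xN] := supp_bound x.
have ex : exists i, x i != 0.
  apply: contrapT => /forallNP h; apply: x0; apply: c00_eqP => i.
  by rewrite suppN// => /h.
have ub i : x i != 0 -> (i <= N)%N by move=> xi; apply/ltnW/xN.
by case: (ex_maxnP ex ub) => i xi ix; exists i => // j; apply: ix.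
Qed.

Lemma pairingC f x : pairing f x = pairing x f.
Proof. by apply: eq_fsbigr => i _; rewrite mulrC. Qed.

Lemma fsum_bound (F : nat -> R) N : (forall i, (N <= i)%N -> F i = 0) ->
  \sum_(i \in [set: nat]) F i = \sum_(i < N) F i.
Proof.
move=> FN; rewrite [RHS]fsbig_ord; apply/esym/fsbig_widen => // i [_] /= /negP.
by rewrite -leqNgt => /FN.
Qed.

Lemma pairingE f x N : (forall i, supp x i -> (i < N)%N) ->
  pairing f x = \sum_(i < N) f i * x i.
Proof.
by move=> xN; apply: fsum_bound => i iN; rewrite (@suppN x) ?mulr0// => /xN; rewrite ltnNge iN.
Qed.

Lemma pairingDr f x y : pairing f (x + y) = pairing f x + pairing f y.
Proof.
have [N1 h1] := supp_bound x; have [N2 h2] := supp_bound y.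
have h3 (z : c00 R) : (forall i, supp z i -> supp x i \/ supp y i) ->
    forall i, supp z i -> (i < maxn N1 N2)%N.
  by move=> zxy i /zxy[/h1|/h2] h; rewrite leq_max h ?orbT.
rewrite !(@pairingE _ _ (maxn N1 N2)); last 3 first.
- by apply: h3; right.
- by apply: h3; left.
- apply: h3 => i; rewrite suppE coordD => h.
  have [x0|] := eqVneq (x i) 0; last by left.
  by right; move: h; rewrite x0 add0r.
by rewrite -big_split; apply: eq_bigr => i _; rewrite coordD mulrDr.
Qed.

Lemma pairingZr f a x : pairing f (a *: x) = a * pairing f x.
Proof.
have [N h] := supp_bound x.
rewrite !(@pairingE _ _ N)//; last by move=> i /suppZ/h.
by rewrite mulr_sumr; apply: eq_bigr => i _; rewrite coordZ mulrCA.
Qed.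

Lemma pairing0r f : pairing f 0 = 0.
Proof. by rewrite -(scale0r 0) pairingZr mul0r. Qed.

Lemma pairingNr f x : pairing f (- x) = - pairing f x.
Proof. by rewrite -scaleN1r pairingZr mulN1r. Qed.

Lemma pairingBr f x y : pairing f (x - y) = pairing f x - pairing f y.
Proof. by rewrite pairingDr pairingNr. Qed.

Lemma pairing_sumr f I (s : seq I) (P : pred I) (F : I -> c00 R) :
  pairing f (\sum_(k <- s | P k) F k) = \sum_(k <- s | P k) pairing f (F k).
Proof.
elim: s => [|k s IH]; first by rewrite !big_nil pairing0r.
by rewrite !big_cons; case: ifP; rewrite ?pairingDr IH.
Qed.

Lemma pairingDl f g x : pairing (f + g) x = pairing f x + pairing g x.
Proof. by rewrite !(pairingC _ x) pairingDr. Qed.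

Lemma pairingZl f a x : pairing (a *: f) x = a * pairing f x.
Proof. by rewrite !(pairingC _ x) pairingZr. Qed.

Lemma pairing0l x : pairing 0 x = 0.
Proof. by rewrite pairingC pairing0r. Qed.

Lemma pairingNl f x : pairing (- f) x = - pairing f x.
Proof. by rewrite !(pairingC _ x) pairingNr. Qed.

Lemma pairing_suml x I (s : seq I) (P : pred I) (F : I -> c00 R) :
  pairing (\sum_(k <- s | P k) F k) x = \sum_(k <- s | P k) pairing (F k) x.
Proof. by rewrite pairingC pairing_sumr; apply: eq_bigr => k _; rewrite pairingC. Qed.

Lemma pairing_restr E f x : pairing (restr E f) x = pairing f (restr E x).
Proof.
have [N h] := supp_bound x.
rewrite !(@pairingE _ _ N)//; last by move=> i /supp_restr/h.
by apply: eq_bigr => i _; rewrite !coord_restr; case: ifP; rewrite ?mulr0 ?mul0r.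
Qed.

Lemma pairing_disjoint f x : (forall i, supp f i -> supp x i -> False) ->
  pairing f x = 0.
Proof.
move=> fx; apply: fsbig1 => i _.
have [->|fi] := eqVneq (f i) 0; first by rewrite mul0r.
by rewrite (@suppN x) ?mulr0// => /fx; apply.
Qed.

Lemma pairing_e f l : pairing f (e R l) = f l.
Proof.
rewrite (@pairingE _ _ l.+1); last by move=> i /supp_e->.
rewrite big_ord_recr big1 ?add0r => [|i _]; rewrite coord_e.
  rewrite /= add0r eqxx; case: l => [|l]; first by rewrite coord_0 mul0r.
  by rewrite mulr1.
by rewrite /= (ltn_eqF (ltn_ord i)) mulr0.
Qed.

(** The l_1 norm: it dominates the norm of the space, and functionals of weight
    [m q] are bounded by norm1 / m q, which is how a vector becomes negligible
    for functionals of very large weight. *)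
Definition norm1 x : R := \sum_(i \in [set: nat]) `|x i|.

Lemma norm1E x N : (forall i, supp x i -> (i < N)%N) ->
  norm1 x = \sum_(i < N) `|x i|.
Proof.
by move=> xN; apply: fsum_bound => i iN; rewrite suppN ?normr0// => /xN; rewrite ltnNge iN.
Qed.

Lemma pairing_norm1 f x B : (forall i, `|f i| <= B) -> `|pairing f x| <= B * norm1 x.
Proof.
move=> fB; have [N h] := supp_bound x.
rewrite (pairingE _ h) (norm1E h) mulr_sumr; apply: le_trans (ler_norm_sum _ _ _) _.
by apply: ler_sum => i _; rewrite normrM ler_wpM2r.
Qed.
End FinitelySupported.

Opaque e restr.

(** * Growth of the two sequences *)

Section GrowthRates.
Variables (m n s : nat -> nat).
Hypothesis Hp : ius_params m n s.

Lemma m_gt1 j : (0 < j)%N -> (1 < m j)%N.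
Proof.
have [m1 mS _ _ _] := Hp; elim: j => // -[|j] IH _; first by rewrite m1.
by rewrite mS// (leq_trans (IH _))// -{1}[m j.+1]expn1 leq_exp2l ?IH.
Qed.

Lemma m_gt0 j : (0 < j)%N -> (0 < m j)%N.
Proof. by move=> /m_gt1/ltnW. Qed.

Lemma m_exp5 i j : (0 < i)%N -> (i < j)%N -> (m i ^ 5 <= m j)%N.
Proof.
have [m1 mS _ _ _] := Hp => i0; elim: j => // j IH.
rewrite ltnS leq_eqVlt => /predU1P[<-|ij]; first by rewrite mS.
have j0 : (0 < j)%N by exact: leq_trans ij.
rewrite mS// (leq_trans (IH ij))// -{1}[m j]expn1 leq_exp2l// ?m_gt1//.
Qed.

Lemma m_lt i j : (0 < i)%N -> (i < j)%N -> (m i < m j)%N.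
Proof.
move=> i0 ij; apply: leq_trans (m_exp5 i0 ij).
by rewrite -{1}[m i]expn1 ltn_exp2l ?m_gt1.
Qed.

Lemma m_le i j : (0 < i)%N -> (i <= j)%N -> (m i <= m j)%N.
Proof. by move=> i0; rewrite leq_eqVlt => /predU1P[->//|/(m_lt i0)/ltnW]. Qed.

Lemma m_lt_inv i j : (0 < i)%N -> (0 < j)%N -> (m i < m j)%N -> (i < j)%N.
Proof. by move=> i0 j0; apply: contraTT; rewrite -!leqNgt => /(m_le j0). Qed.

Lemma m_gt_id j : (0 < j)%N -> (j < m j)%N.
Proof.
elim: j => // -[|j] IH _; first exact: m_gt1.
by apply: leq_ltn_trans (m_lt _ (ltnSn _)) => //; apply: IH.
Qed.

Lemma m_ge32 j : (1 < j)%N -> (32 <= m j)%N.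
Proof. by have [m1 _ _ _ _] := Hp; move=> /(m_exp5 (ltnSn 0)); rewrite m1. Qed.

Lemma n_gt0 j : (0 < j)%N -> (0 < n j)%N.
Proof.
have [_ _ n1 nS _] := Hp; elim: j => // -[|j] IH _; first by rewrite n1.
by rewrite nS// expn_gt0 muln_gt0/= IH.
Qed.

Lemma n_dvd4 j : (0 < j)%N -> (4 %| n j)%N.
Proof.
have [_ _ n1 nS sP] := Hp; case: j => // -[|j] _; first by rewrite n1.
by have [s0 _] := sP j.+1 isT; rewrite nS// -(prednK s0) expnS -mulnA dvdn_mulr.
Qed.

Lemma n_le i j : (0 < i)%N -> (i <= j)%N -> (n i <= n j)%N.
Proof.
have [_ _ n1 nS sP] := Hp => i0; elim: j => [|j IH]; first by rewrite leqn0 => /eqP->.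
rewrite leq_eqVlt ltnS => /predU1P[->//|ij].
have j0 : (0 < j)%N by exact: leq_trans ij.
have [s0 _] := sP _ j0.
rewrite nS// (leq_trans (IH ij))// -(prednK s0) expnS -mulnA.
rewrite (@leq_trans (n j * (4 * n j) ^ (s j).-1)%N)//.
  by rewrite leq_pmulr// expn_gt0 muln_gt0 n_gt0.
exact: leq_pmull.
Qed.

Lemma s_large j : (0 < j)%N -> (m j.+1 ^ 3 <= 2 ^ s j)%N.
Proof. by have [_ _ _ _ sP] := Hp => /sP[]. Qed.

Lemma n_split j : (0 < j)%N -> n j.+1 = (n j ^ s j * 4 ^ s j)%N.
Proof. by have [_ _ _ nS _] := Hp => j0; rewrite nS// expnMn mulnC. Qed.

Lemma m_exp6_le_exp4 j : (0 < j)%N -> (m j.+1 ^ 6 <= 4 ^ s j)%N.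
Proof.
by move=> j0; rewrite -[4%N]/(2 ^ 2)%N -expnM mulnC expnM -[6%N]/(3 * 2)%N expnM leq_exp2r ?s_large.
Qed.

Lemma m_exp6_le_n j : (1 < j)%N -> (m j ^ 6 <= n j)%N.
Proof.
case: j => // j; rewrite ltnS => j0; rewrite n_split//.
by rewrite (leq_trans (m_exp6_le_exp4 j0))// leq_pmull// expn_gt0 n_gt0.
Qed.

End GrowthRates.

(** * The norming set *)

Section NormingSet.
Variables (R : realType) (m n s : nat -> nat) (sigma : seq (c00 R * c00 R) -> nat).
Hypothesis Hp : ius_params m n s.
Hypothesis Hs : coding m sigma.
Implicit Types (x y f g h : c00 R) (t : seq (c00 R)) (phi psi : seq (c00 R * c00 R)).

Definition successive t := pairwise (fun g h => `[< before g h >]) t.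

Lemma before_sub x y x' y' : supp x' `<=` supp x -> supp y' `<=` supp y ->
  before x y -> before x' y'.
Proof. by move=> xx yy xy i j /xx xi /yy yj; apply: xy. Qed.

(** Successive functionals have disjoint supports, so at each coordinate at
    most one term of the sum survives. *)
Lemma successive_coord t i B : 0 <= B -> successive t ->
  (forall g, g \in t -> `|g i| <= B) -> `|(\sum_(g <- t) g) i| <= B.
Proof.
move=> B0; elim: t => [|g t IH]; first by rewrite big_nil normr0.
rewrite /successive /= => /andP[/allP gt st] tB; rewrite big_cons coordD.
have [g0|gi] := eqVneq (g i) 0.
  by rewrite g0 add0r IH// => h ht; apply: tB; rewrite in_cons ht orbT.
rewrite coord_sum big_seq big1 ?addr0 => [|h ht]; first by rewrite tB// mem_head.
apply: suppN => hi; have /asboolP/(_ i i gi hi) := gt _ ht.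
by rewrite ltnn.
Qed.

Local Notation Kl := (K_level m n sigma).

(** The functionals of the form of the odd members of a special sequence,
    with possibly fewer coordinates, so that the class is stable under
    restrictions. *)
Definition flat (p : nat) f := exists ls : seq nat,
  [/\ uniq ls, all (fun l => 0 < l)%N ls, (size ls <= n p)%N &
      f = (m p)%:R^-1 *: \sum_(l <- ls) e R l].

Lemma average_flat p x f : average_pair m n p x f -> flat p f.
Proof. by case=> ls [u ps sz _ ->]; exists ls; rewrite sz leqnn. Qed.

Lemma restr_e E l : restr E (e R l) = if l \in E then e R l else 0.
Proof.
apply: c00_eqP => i; rewrite coord_restr; case: ifPn => iE; case: ifPn => lE //.
  by rewrite coord_e; case: eqVneq iE lE => [->->|].
by rewrite coord_e; case: eqVneq iE lE => [-> /negP|].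
Qed.

Lemma flat_restr p f E : flat p f -> flat p (restr E f).
Proof.
case=> ls [u ps sz ->]; exists [seq l <- ls | l \in E]; split.
- exact: filter_uniq.
- by apply/allP => l; rewrite mem_filter => /andP[_ /(allP ps)].
- by rewrite size_filter (leq_trans (count_size _ _)).
- rewrite restrZ restr_sum big_filter [in RHS]big_mkcond /=; congr (_ *: _).
  by apply: eq_bigr => l _; rewrite restr_e.
Qed.

(** The terms as a list instead of a family over 'I_d, so that the terms that a
    restriction annihilates can be filtered out. *)
Lemma K_even_seqP (P : nat -> set (c00 R)) q f : K_even m n P q f <->
  exists t, [/\ (0 < size t <= n q)%N, successive t,
    forall g, g \in t -> exists j, P j g & f = (m q)%:R^-1 *: \sum_(g <- t) g].
Proof.
split=> [[d [g [dn gb gP ->]]]|[t [tn ts tP ->]]].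
  exists [seq g a | a : 'I_d]; split.
  - by rewrite size_map size_enum_ord.
  - apply/(pairwiseP 0) => i j; rewrite !inE size_map size_enum_ord => id jd ij.
    have nE k (kd : (k < d)%N) : [seq g a | a : 'I_d]`_k = g (Ordinal kd).
      rewrite (nth_map (Ordinal kd)) ?size_enum_ord//; congr g.
      by apply: val_inj; rewrite /= nth_enum_ord.
    by rewrite (nE _ id) (nE _ jd); apply: (gb (Ordinal id) (Ordinal jd)).
  - by move=> h /mapP[a _ ->]; apply: gP.
  - by rewrite big_image.
exists (size t), (fun a => tnth (in_tuple t) a); split=> //.
- move=> a b ab; apply/asboolP; rewrite !(tnth_nth 0).
  by move/(pairwiseP 0): ts => -> //; rewrite ?inE.
- by move=> a; apply: tP; apply: mem_tnth.
- by rewrite -(big_tnth _ _ t xpredT id).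
Qed.

Lemma KlS l : Kl l.+1 = K_step m n sigma (Kl l).
Proof. by []. Qed.

Lemma Kl_cases l q f : Kl l.+1 q f ->
  [\/ q = 0%N /\ K_zero f, Kl l q f,
     [/\ (1 < q)%N, ~~ odd q & K_even m n (Kl l) q f] |
     [/\ (2 < q)%N, odd q & exists phi, K_odd m n sigma (Kl l) q phi f]].
Proof.
rewrite KlS /K_step.
case: q => [|[|q]] /=; [by move=> ?; constructor 1|by []|].
rewrite negbK; case: ifP => oq [h|h]; try by constructor 2.
- by constructor 4; split=> //; [by case: q oq {h}|case: h => phi _ h; exists phi].
- by constructor 3; split=> //; rewrite /= negbK oq.
Qed.

Lemma Kl_zero l : Kl l 0 = @K_zero R.
Proof. by case: l. Qed.

Lemma Kl_one l : Kl l 1 = set0.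
Proof. by case: l. Qed.

Lemma Kl_base q f : Kl 0 q f -> q = 0%N /\ K_zero f.
Proof. by rewrite /K_level /=; case: eqP. Qed.

Lemma Kl_even l q f : (1 < q)%N -> ~~ odd q -> K_even m n (Kl l) q f -> Kl l.+1 q f.
Proof.
move=> q1 oq h; rewrite KlS /K_step.
by case: q q1 oq h => [|[|q]] // _ oq h; rewrite (negPf oq); right.
Qed.

Lemma Kl_odd l q phi f : (1 < q)%N -> odd q -> K_odd m n sigma (Kl l) q phi f ->
  Kl l.+1 q f.
Proof.
move=> q1 oq h; rewrite KlS /K_step.
by case: q q1 oq h => [|[|q]] // _ oq h; rewrite oq; right; exists phi.
Qed.

Lemma Kl_S l q f : Kl l q f -> Kl l.+1 q f.
Proof.
rewrite KlS /K_step.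
case: q => [|[|q]]; rewrite ?Kl_zero ?Kl_one //=.
by case: ifP; left.
Qed.

Lemma Kl_le l l' q f : (l <= l')%N -> Kl l q f -> Kl l' q f.
Proof.
move=> ll'; rewrite -(subnKC ll'); elim: (l' - l)%N => [|d IH]; first by rewrite addn0.
by rewrite addnS => /IH/Kl_S.
Qed.

Lemma successive_filter t p : successive t -> successive [seq g <- t | p g].
Proof. exact: pairwise_filter. Qed.

Lemma successive_map t (F : c00 R -> c00 R) :
  (forall x, supp (F x) `<=` supp x) -> successive t -> successive (map F t).
Proof.
move=> Fs; rewrite /successive pairwise_map; apply: sub_pairwise => x y /= /asboolP xy.
by apply/asboolP; apply: before_sub xy.
Qed.

(** The zero functional has to be listed apart: when E kills every term of an
    even functional, no admissible sum remains, since the number of terms of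
    such a sum is positive. *)
Lemma Kl_restr E l q f : nat_interval E -> Kl l q f ->
  Kl l q (restr E f) \/ restr E f = 0.
Proof.
move=> Ei; elim: l q f => [|l IH] q f.
  move=> /Kl_base[-> /= [a a0 fE]].
  have [c [-> cP]] : exists c : R, f = c *: e R a /\ (c = 1 \/ c = -1).
    by case: fE => ->; [exists 1|exists (-1)]; rewrite ?scale1r ?scaleN1r; split; auto.
  rewrite restrZ restr_e; case: ifP => _; last by right; rewrite scaler0.
  by left; exists a => //; case: cP => ->; [left; rewrite scale1r|right; rewrite scaleN1r].
move=> /Kl_cases[[-> f0]|/IH[/Kl_S|]|[q1 oq /K_even_seqP[t [tn ts tP ->]]]|[q2 oq [phi ph]]].
- have : Kl 0 0%N f by rewrite Kl_zero.
  have : forall g, Kl 0 0%N g -> Kl l 0%N g by move=> g; rewrite !Kl_zero.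
  by rewrite Kl_zero => lg /lg/IH[]; rewrite !Kl_zero; [left|right].
- by left.
- by right.
- pose t' := [seq g <- map (restr E) t | g != 0].
  have -> : restr E ((m q)%:R^-1 *: \sum_(g <- t) g) = (m q)%:R^-1 *: \sum_(g <- t') g.
    rewrite restrZ restr_sum big_filter big_map; congr (_ *: _).
    rewrite [RHS]big_mkcond; apply: eq_bigr => g _ /=.
    by case: eqP.
  have [t0|t0] := posnP (size t'); first by right; rewrite (size0nil t0) big_nil scaler0.
  left; apply: Kl_even => //; apply/K_even_seqP; exists t'; split=> //.
  + rewrite t0 size_filter (leq_trans (count_size _ _))// size_map.
    by case/andP: tn.
  + by apply/successive_filter/successive_map => // x; apply: supp_restr.
  + move=> g; rewrite mem_filter => /andP[/eqP g0 /mapP[h ht gE]].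
    by have [j /IH[|]] := tP _ ht; rewrite -gE; [exists j|].
- left; apply: (Kl_odd (ltnW q2) oq (phi := phi)).
  case: ph => sp fP [eps [F [f' [lam [he Fi h1 h2 ->]]]]].
  split=> //; exists eps, (E `&` F), f', lam; split=> //.
    by move=> a b c [Ea Fa] [Eb Fb] acb; split; [apply: Ei acb|apply: Fi acb].
  by rewrite restrZ restr_restr.
Qed.

Lemma Kl_opp l q f : Kl l q f -> Kl l q (- f).
Proof.
elim: l q f => [|l IH] q f.
  move=> /Kl_base[-> [a a0 fE]]; rewrite Kl_zero; exists a => //.
  by case: fE => ->; rewrite ?opprK; [right|left].
move=> /Kl_cases[[-> [a a0 fE]]|/IH/Kl_S//|[q1 oq /K_even_seqP[t [tn ts tP ->]]]|[q2 oq [phi ph]]].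
- by rewrite Kl_zero; exists a => //; case: fE => ->; rewrite ?opprK; [right|left].
- apply: Kl_even => //; apply/K_even_seqP; exists (map -%R t); split.
  + by rewrite size_map.
  + by apply: successive_map => // x; rewrite -scaleN1r; apply: suppZ.
  + by move=> g /mapP[h /tP[j /IH hj] ->]; exists j.
  + by rewrite big_map sumrN scalerN.
- apply: (Kl_odd (ltnW q2) oq (phi := phi)).
  case: ph => sp fP [eps [F [f' [lam [he Fi h1 h2 ->]]]]].
  split=> //; exists (- eps), F, f', lam; split=> //.
    by case: he => ->; rewrite ?opprK; [right|left].
  by rewrite mulNr scaleNr.
Qed.

Lemma sum_e_coord (ls : seq nat) i : uniq ls -> all (fun l => 0 < l)%N ls ->
  (\sum_(l <- ls) e R l) i = (i \in ls)%:R.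
Proof.
rewrite coord_sum; elim: ls => [|l ls IH] /=; first by rewrite big_nil.
move=> /andP[lls u] /andP[l0 ps]; rewrite big_cons IH// coord_e l0 andbT in_cons.
by have [->|_] := eqVneq i l; rewrite ?(negPf lls) ?addr0 ?add0r.
Qed.

Lemma flat_coord p f i : (0 < p)%N -> flat p f -> `|f i| <= (m p)%:R^-1.
Proof.
move=> p0 [ls [u ps _ ->]]; rewrite coordZ sum_e_coord// normrM ger0_norm ?invr_ge0//.
by rewrite ler_piMr ?invr_ge0//; case: (i \in ls); rewrite ?normr1 ?normr0.
Qed.

(** Disjoint basis functionals only have to be sorted to form an admissible
    sum of even weight. *)
Lemma flat_Kl p f : (1 < p)%N -> ~~ odd p -> flat p f -> Kl 1 p f \/ f = 0.
Proof.
move=> p1 op [ls [u ps sz ->]].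
have [l0|l0] := posnP (size ls); first by right; rewrite (size0nil l0) big_nil scaler0.
left; apply: Kl_even => //; apply/K_even_seqP; exists (map (e R) (sort leq ls)); split.
- by rewrite size_map size_sort l0.
- rewrite /successive pairwise_map.
  have : sorted ltn (sort leq ls).
    by rewrite ltn_sorted_uniq_leq sort_uniq u sort_sorted//; apply: leq_total.
  rewrite (sorted_pairwise ltn_trans); apply: sub_pairwise => a b /= ab.
  by apply/asboolP => i j /supp_e-> /supp_e->.
- move=> g /mapP[l]; rewrite mem_sort => /(allP ps) /= l1 ->.
  by exists 0%N; exists l => //; left.
- by rewrite big_map; congr (_ *: _); apply/perm_big; rewrite perm_sym perm_sort.
Qed.

(** ** Special sequences *)

Lemma supp_range x : supp x `<=` range_of x.
Proof. by move=> i xi; exists i, i; rewrite leqnn. Qed.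

Lemma ranges_nonempty phi i : in_Qs phi -> (1 <= i <= size phi)%N ->
  ranges phi i !=set0.
Proof. by case=> _ Q _ /Q[[[j xj] _] _]; exists j; left; apply: supp_range. Qed.

Lemma ranges_before phi i j : in_Qs phi -> (0 < i)%N -> (i < j)%N ->
  (j <= size phi)%N -> set_before (ranges phi i) (ranges phi j).
Proof.
move=> Q i0; elim: j => // j IH; rewrite ltnS leq_eqVlt => /predU1P[<-|ij] js.
  by case: Q => _ _; apply; rewrite i0.
move=> a b ai bj; have j0 : (0 < j)%N by exact: leq_trans ij.
have [c cj] := ranges_nonempty Q (introT andP (conj j0 (ltnW js))).
have ac := IH ij (ltnW js) a c ai cj.
case: Q => _ _ /(_ j); rewrite j0 => /(_ js) cb.
by apply: ltn_trans ac (cb _ _ cj bj).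
Qed.

(** The weight with which the functional number [j] (counted from 0) of a
    special sequence is built; the first weight is not coded. *)
Definition weight (p0 : nat) phi (j : nat) : nat :=
  if j == 0%N then p0 else sigma (take j phi).

Lemma in_Qs_take phi j : in_Qs phi -> (0 < j)%N -> in_Qs (take j phi).
Proof.
case=> sz Q B j0; have sj : size (take j phi) = minn j (size phi) by rewrite size_take_min.
have xE i : (0 < i <= size (take j phi))%N -> nth (0, 0) (take j phi) i.-1 = nth (0, 0) phi i.-1.
  by rewrite sj leq_min => /andP[i0 /andP[ij _]]; rewrite nth_take// prednK.
split.
- by rewrite sj leq_min j0.
- move=> i ij; rewrite /x_ /f_ xE//; apply: Q.
  by case/andP: ij => ->; rewrite sj leq_min => /andP[].
- move=> i /andP[i0 ij]; rewrite /ranges /x_ /f_ !xE ?i0 ?(ltnW ij)//.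
  by apply: B; rewrite i0; move: ij; rewrite sj leq_min => /andP[].
Qed.

Lemma sigma_even phi : in_Qs phi -> (1 < sigma phi)%N && ~~ odd (sigma phi).
Proof.
case: Hs => h _ _ _ /h[j j0 ->]; rewrite mul2n odd_double -addnn.
by case: j j0 => // j _; rewrite addnS.
Qed.

Lemma special_average k phi : special m n sigma k phi -> exists p0,
  [/\ (1 < p0)%N && ~~ odd p0, (2 * k)%:R < Num.sqrt (m p0)%:R :> R &
      forall i, (i < k)%N -> average_pair m n (weight p0 phi (2 * i))
        (x_ phi (2 * i).+1) (f_ phi (2 * i).+1)].
Proof.
case=> [[Q sz] [j [j0 jk av]] _ odds]; exists (2 * j)%N; split=> //.
  by rewrite mul2n odd_double -addnn; case: j j0 {jk av} => // j _; rewrite addnS.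
case=> [|i] ik; first by rewrite muln0.
rewrite /weight -[(_ == _)]/false.
by apply: odds; rewrite ik.
Qed.

Lemma weight_even p0 k phi j : special m n sigma k phi -> (1 < p0)%N && ~~ odd p0 ->
  (1 < weight p0 phi j)%N && ~~ odd (weight p0 phi j).
Proof.
move=> [[Q _] _ _ _] p0P; rewrite /weight; case: eqP => // /eqP; rewrite -lt0n => j0.
exact/sigma_even/in_Qs_take.
Qed.

Lemma sum_mkseq (V : nmodType) (F : nat -> V) N :
  \sum_(g <- mkseq F N) g = \sum_(j < N) F j.
Proof. by rewrite big_map -{1}(subn0 N) -/(index_iota 0 N) big_mkord. Qed.

Lemma sum_pairs (V : nmodType) (F : nat -> V) k :
  \sum_(j < 2 * k) F j = \sum_(i < k) (F (2 * i)%N + F (2 * i).+1).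
Proof.
elim: k => [|k IH]; first by rewrite muln0 !big_ord0.
by rewrite mulnS add2n !big_ord_recr IH /= addrA.
Qed.

(** ** The norming functionals as scaled sums of successive functionals *)

Local Notation K := (K_ius m n sigma).

(** The members of K of weight [m q], with the basis functionals for q = 0. *)
Definition Kw (q : nat) : set (c00 R) := [set f | exists l, Kl l q f].

(** The class K is closed under restrictions to intervals only up to the zero
    functional, and the odd members of special sequences enter with
    coefficients of modulus at most 1; both are covered by the balanced hull. *)
Definition Kball : set (c00 R) :=
  [set g | exists c h, [/\ `|c| <= 1, K h & g = c *: h]].

Lemma Kw_K q f : Kw q f -> K f.
Proof. by case=> l h; exists l => //; exists q. Qed.

Lemma K_Kw f : K f -> exists q, Kw q f.
Proof. by case=> l _ [q _ h]; exists q, l. Qed.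

Lemma K_e a : (0 < a)%N -> K (e R a).
Proof. by move=> a0; exists 0%N => //; exists 0%N => //; rewrite Kl_zero; exists a => //; left. Qed.

Lemma K_Kball f : K f -> Kball f.
Proof. by move=> Kf; exists 1, f; rewrite normr1 scale1r. Qed.

Lemma Kball0 : Kball 0.
Proof. by exists 0, (e R 1); split; rewrite ?normr0 ?scale0r//; apply: K_e. Qed.

Lemma KballZ c g : `|c| <= 1 -> Kball g -> Kball (c *: g).
Proof.
move=> c1 [d [h [d1 Kh ->]]]; exists (c * d), h; split; rewrite ?scalerA//.
by rewrite normrM mulr_ile1.
Qed.

Lemma K_opp f : K f -> K (- f).
Proof. by case=> l _ [q _ h]; exists l => //; exists q => //; apply: Kl_opp. Qed.

Lemma Kw_cases q f : Kw q f -> (q = 0%N /\ K_zero f) \/ (1 < q)%N.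
Proof.
case=> l; case: q => [|[|q]]; rewrite ?Kl_zero ?Kl_one//; by [left|right].
Qed.

Lemma Kw_restr E q f : nat_interval E -> Kw q f -> Kw q (restr E f) \/ restr E f = 0.
Proof. by move=> Ei [l /(Kl_restr Ei)[h|]]; [left; exists l|right]. Qed.

Lemma Kball_restr E g : nat_interval E -> Kball g -> Kball (restr E g).
Proof.
move=> Ei [c [h [c1 /K_Kw[q qh] ->]]]; rewrite restrZ; apply: KballZ => //.
have [/Kw_K/K_Kball//|->] := Kw_restr Ei qh; exact: Kball0.
Qed.

Lemma flat_Kball p f : (1 < p)%N -> ~~ odd p -> flat p f -> Kball f.
Proof.
move=> p1 op /(flat_Kl p1 op)[h|->]; last exact: Kball0.
by apply: K_Kball; exists 1%N => //; exists p.
Qed.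

(** The terms of an odd functional, numbered as the members of the special
    sequence: each is a multiple of a functional whose weight is the one
    attached to that member, and the coefficients of two consecutive terms
    are linked by the choice of lambda. *)
Lemma K_odd_terms l q psi f p0 : K_odd m n sigma (Kl l) q psi f ->
  (forall i, (i < (n q)./2)%N -> average_pair m n (weight p0 psi (2 * i))
        (x_ psi (2 * i).+1) (f_ psi (2 * i).+1)) ->
  exists (eps : R) E (h : nat -> c00 R) (lam : nat -> R),
  [/\ [/\ `|eps| <= 1, nat_interval E &
        f = (eps / (m q)%:R) *: restr E (\sum_(j < 2 * (n q)./2) h j)],
      forall j, (j < 2 * (n q)./2)%N -> supp (h j) `<=` supp (f_ psi j.+1),
      forall j, (j < 2 * (n q)./2)%N -> exists c g, [/\ `|c| <= 1, h j = c *: g &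
        Kl l (weight p0 psi j) g \/ flat (weight p0 psi j) g] &
      forall i, (i < (n q)./2)%N -> h (2 * i)%N = lam i *: f_ psi (2 * i).+1 /\
        (lam i = pairing (h (2 * i).+1)
                   ((m (weight p0 psi (2 * i).+1))%:R *: x_ psi (2 * i).+2) \/
         pairing (h (2 * i).+1) (x_ psi (2 * i).+2) = 0 /\
         `|lam i| <= ((n q)%:R ^+ 2)^-1)].
Proof.
case=> sp fP [eps [E [f' [lam [he Ei h1 h2 ->]]]]] av.
set k := (n q)./2 in sp fP h1 h2 av *.
have [[Q sz] _ _ _] := sp.
pose h j := if odd j then f' j./2.+1 else lam j./2.+1 *: f_ psi j.+1.
have kq : (2 * k <= n q)%N by rewrite mul2n -[leqRHS]odd_double_half leq_addl.
have hE i : h (2 * i)%N = lam i.+1 *: f_ psi (2 * i).+1.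
  by rewrite /h mul2n odd_double doubleK.
have hO i : h (2 * i).+1 = f' i.+1.
  by rewrite /h mul2n /= odd_double /= uphalf_double.
have dbl i : (2 * i.+1)%N = (2 * i).+2 by lia.
have h2' i : (i < k)%N -> lam i.+1 = pairing (h (2 * i).+1)
      ((m (weight p0 psi (2 * i).+1))%:R *: x_ psi (2 * i).+2) \/
    pairing (h (2 * i).+1) (x_ psi (2 * i).+2) = 0 /\ `|lam i.+1| <= ((n q)%:R ^+ 2)^-1.
  move=> ik; have := h2 i.+1 ik; rewrite hO !dbl.
  case: ifPn => [_ ->|]; [by left|rewrite negbK => /eqP-> lE; right; split=> //].
  have n2 : 0 <= ((n q)%:R ^+ 2)^-1 :> R by rewrite invr_ge0 exprn_ge0.
  by case: lE => ->; rewrite ?normrN ger0_norm.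
have lam1 i : (i < k)%N -> `|lam i.+1| <= 1.
  move=> ik; have [->|[_ l1]] := h2' i ik.
    have [h0 _ h3] := h1 i.+1 ik; rewrite hO pairingZr normrM.
    rewrite !dbl /= in h0 h3; rewrite /weight /=.
    set w := sigma _ in h0 h3 *.
    have /andP[w1 _] : (1 < w)%N && ~~ odd w by exact/sigma_even/in_Qs_take.
    have w0 : 0 < (m w)%:R :> R by rewrite ltr0n (m_gt0 Hp)// ltnW.
    by rewrite normr_nat mulrC -ler_pdivlMr// div1r; apply: h3.
  have nq0 : (0 < n q)%N by rewrite (leq_trans _ kq)// muln_gt0 /= (leq_trans _ ik).
  apply: le_trans l1 _; rewrite invf_le1 ?exprn_gt0 ?ltr0n//.
  by rewrite -natrX ler1n expn_gt0 nq0.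
exists eps, E, h, (fun i => lam i.+1); split.
- split=> //; first by case: he => ->; rewrite ?normrN normr1.
  congr (_ *: restr _ _); rewrite sum_pairs big_add1 /= big_mkord.
  by apply: eq_bigr => i _; rewrite hE hO; congr (_ *: f_ psi _ + _); lia.
- move=> j jk; rewrite (_ : j = odd j + 2 * j./2)%N; last by lia.
  have jk2 : (j./2 < k)%N by lia.
  case: (odd j); rewrite /= ?add1n ?add0n ?hO ?hE; last exact: suppZ.
  by have [_ -> _] := h1 j./2.+1 jk2; rewrite dbl.
- move=> j jk; rewrite (_ : j = odd j + 2 * j./2)%N; last by lia.
  have jk2 : (j./2 < k)%N by lia.
  case: (odd j); rewrite /= ?add1n ?add0n ?hO ?hE.
    exists 1, (f' j./2.+1); rewrite normr1 scale1r; split=> //; left.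
    by have [h0 _ _] := h1 j./2.+1 jk2; rewrite dbl in h0.
  exists (lam j./2.+1), (f_ psi (2 * j./2).+1); split=> //; first exact: lam1.
  by right; apply/average_flat/av.
- by move=> i ik; split; [exact: hE|exact: h2'].
Qed.

Lemma K_odd_shape l q psi f : K_odd m n sigma (Kl l) q psi f ->
  exists t, [/\ (size t <= n q)%N, successive t,
    forall g, g \in t -> exists c E h, [/\ `|c| <= 1, nat_interval E, g = c *: restr E h &
       (exists j, Kl l j h) \/ exists p, (1 < p)%N && ~~ odd p /\ flat p h] &
    f = (m q)%:R^-1 *: \sum_(g <- t) g].
Proof.
move=> ps; have [sp _ _] := ps.
have [p0 [p0P _ av]] := special_average sp.
have [eps [E [h [lam [[e1 Ei fE] hs hP _]]]]] := K_odd_terms ps av.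
have [[Q sz] _ _ _] := sp.
set k := (n q)./2 in sp hs hP fE av sz *.
exists (mkseq (fun j => eps *: restr E (h j)) (2 * k)); split.
- by rewrite size_mkseq mul2n -[leqRHS]odd_double_half leq_addl.
- apply/(pairwiseP 0) => i j; rewrite !inE !size_mkseq => ik jk ij.
  rewrite !nth_mkseq// => a b /suppZ/supp_restr/(hs _ ik) ia /suppZ/supp_restr/(hs _ jk) jb.
  apply: (@ranges_before psi i.+1 j.+1) => //; first by rewrite sz.
  + by right; apply: supp_range.
  + by right; apply: supp_range.
- move=> g /mapP[j]; rewrite mem_iota add0n => /andP[_ jk] ->.
  have [c [g' [c1 -> gP]]] := hP j jk.
  exists (eps * c), E, g'; split=> //; first by rewrite normrM mulr_ile1.
    by rewrite restrZ scalerA.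
  case: gP => gP; [by left; exists (weight p0 psi j)|right; exists (weight p0 psi j)].
  by split=> //; apply: weight_even sp p0P.
- by rewrite fE sum_mkseq -scaler_sumr -restr_sum scalerA (mulrC _^-1).
Qed.

Lemma Kl_coord l q f : Kl l q f -> forall i, `|f i| <= 1 /\ ((1 < q)%N -> `|f i| <= (m q)%:R^-1).
Proof.
elim: l q f => [|l IH] q f.
  move=> /Kl_base[-> [a a0 fE]] i; split=> //.
  by case: fE => ->; rewrite ?coordN ?normrN coord_e; case: (_ && _); rewrite ?normr1 ?normr0.
suff H t : (1 < q)%N -> successive t -> (forall g, g \in t -> forall i, `|g i| <= 1) ->
    f = (m q)%:R^-1 *: \sum_(g <- t) g ->
    forall i, `|f i| <= 1 /\ ((1 < q)%N -> `|f i| <= (m q)%:R^-1).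
  move=> /Kl_cases[[-> [a a0 fE]]|/IH//|[q1 oq /K_even_seqP[t [tn ts tP fE]]]|[q2 oq [phi ph]]].
  - apply: (IH 0%N); rewrite Kl_zero; by exists a.
  - by apply: (H t) => // g /tP[j /IH h] i; have [] := h i.
  - have [t [_ ts tP fE]] := K_odd_shape ph.
    apply: (H t) => //; first exact: ltnW.
    move=> g /tP[c [E [h [c1 _ -> hP]]]] i.
    rewrite coordZ normrM mulr_ile1// coord_restr; case: ifP; rewrite ?normr0// => _.
    case: hP => [[j /IH/(_ i)[]//]|[p [/andP[p1 _] /flat_coord h']]].
    apply: le_trans (h' _ (ltnW p1)) _.
    by rewrite invf_le1 ?ler1n ?ltr0n ?(m_gt0 Hp) ?(ltnW p1).
move=> q1 ts tP -> i.
have w0 : (0 < m q)%N by rewrite (m_gt0 Hp)// ltnW.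
have b : `|((m q)%:R^-1 *: \sum_(g <- t) g) i| <= (m q)%:R^-1.
  rewrite coordZ normrM ger0_norm ?invr_ge0// ler_piMr ?invr_ge0//.
  by apply: successive_coord => // g /tP; apply.
split=> // ; apply: le_trans b _.
by rewrite invf_le1 ?ler1n ?ltr0n.
Qed.

Lemma Kw_coord q f i : (1 < q)%N -> Kw q f -> `|f i| <= (m q)%:R^-1.
Proof. by move=> q1 [l /Kl_coord/(_ i)[_]]; apply. Qed.

Lemma K_coord f i : K f -> `|f i| <= 1.
Proof. by case=> l _ [q _ /Kl_coord/(_ i)[]]. Qed.

(** Even and odd functionals in one form, which is all that the upper bounds
    use, except in the one place where the cancellation inside an odd
    functional matters. *)
Lemma Kw_shape q f : (1 < q)%N -> Kw q f -> exists t, [/\ (size t <= n q)%N,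
  successive t, forall g, g \in t -> Kball g & f = (m q)%:R^-1 *: \sum_(g <- t) g].
Proof.
move=> q1 [l]; elim: l => [|l IH]; first by move=> /Kl_base[q0]; rewrite q0 in q1.
move=> /Kl_cases[[q0]|//|[_ _ /K_even_seqP[t [tn ts tP fE]]]|[_ _ [phi ph]]].
- by rewrite q0 in q1.
- exists t; split=> //; first by case/andP: tn.
  by move=> g /tP[j gj]; apply: K_Kball; exists l => //; exists j.
- have [t [tn ts tP fE]] := K_odd_shape ph.
  exists t; split=> // g /tP[c [E [h [c1 Ei -> hP]]]]; apply/KballZ/Kball_restr => //.
  case: hP => [[j hj]|[p [/andP[p1 op]]]]; last exact: flat_Kball.
  by apply: K_Kball; exists l => //; exists j.
Qed.

(** The sets K_n increase with n, whereas K_(n+1) is formed from functionals of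
    the single level n. *)
Lemma common_level (P : nat -> c00 R -> Prop) t :
  (forall l l' g, (l <= l')%N -> P l g -> P l' g) ->
  (forall g, g \in t -> exists l, P l g) -> exists l, forall g, g \in t -> P l g.
Proof.
move=> Pm; elim: t => [|g t IH] tP; first by exists 0%N.
have [l1 h1] := tP g (mem_head _ _).
have [|l2 h2] := IH; first by move=> h ht; apply: tP; rewrite in_cons ht orbT.
exists (maxn l1 l2) => h; rewrite in_cons => /predU1P[->|/h2].
  by apply: Pm h1; apply: leq_maxl.
by apply: Pm; apply: leq_maxr.
Qed.

Lemma Kw_even q t : (1 < q)%N -> ~~ odd q -> (0 < size t <= n q)%N -> successive t ->
  (forall g, g \in t -> K g) -> Kw q ((m q)%:R^-1 *: \sum_(g <- t) g).
Proof.
move=> q1 oq tn ts tP.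
have [||l lP] := @common_level (fun l g => exists j, Kl l j g) t.
- by move=> l l' g ll' [j]; exists j; apply: Kl_le ll' _.
- by move=> g /tP[l _ [j _ h]]; exists l, j.
- by exists l.+1; apply: Kl_even => //; apply/K_even_seqP; exists t.
Qed.

(** ** Rational coordinates *)

Definition ratl (a : R) := exists q : rat, a = ratr q.

Lemma ratlD a b : ratl a -> ratl b -> ratl (a + b).
Proof. by case=> p -> [q ->]; exists (p + q); rewrite rmorphD. Qed.

Lemma ratlM a b : ratl a -> ratl b -> ratl (a * b).
Proof. by case=> p -> [q ->]; exists (p * q); rewrite rmorphM. Qed.

Lemma ratlV a : ratl a -> ratl a^-1.
Proof. by case=> p ->; exists p^-1; rewrite fmorphV. Qed.

Lemma ratlN a : ratl a -> ratl (- a).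
Proof. by case=> p ->; exists (- p); rewrite rmorphN. Qed.

Lemma ratl_nat k : ratl k%:R.
Proof. by exists k%:R; rewrite ratr_nat. Qed.

Lemma ratl_sum I (t : seq I) (P : pred I) (F : I -> R) :
  (forall i, P i -> ratl (F i)) -> ratl (\sum_(i <- t | P i) F i).
Proof. by move=> h; elim/big_ind: _ => //; [exact: (ratl_nat 0)|exact: ratlD]. Qed.

Lemma ratl_pairing f x : (forall i, ratl (f i)) -> (forall i, ratl (x i)) -> ratl (pairing f x).
Proof.
move=> rf rx; have [N h] := supp_bound x; rewrite (pairingE _ h).
by apply: ratl_sum => i _; apply: ratlM.
Qed.

(** Rationality passes through the odd step because lambda is the value of a
    rational functional at a member of the special sequence, a rational
    vector. It is needed to use functionals of K in special sequences. *)
Lemma Kl_rational l q f i : Kl l q f -> ratl (f i).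
Proof.
elim: l q f i => [|l IH] q f i.
  move=> /Kl_base[_ [a a0 fE]].
  by case: fE => ->; rewrite ?coordN coord_e; [|apply: ratlN]; apply: ratl_nat.
move=> /Kl_cases[[_ [a a0 fE]]|/IH//|[q1 oq /K_even_seqP[t [tn ts tP ->]]]|[q2 oq [phi ph]]].
- by case: fE => ->; rewrite ?coordN coord_e; [|apply: ratlN]; apply: ratl_nat.
- rewrite coordZ coord_sum; apply: ratlM; first exact/ratlV/ratl_nat.
  by rewrite big_seq; apply: ratl_sum => g /tP[j /IH].
case: ph => [[[Q sz] _ _ _] fP [eps [F [f' [lam [he Fi h1 h2 ->]]]]]].
rewrite coordZ; apply: ratlM.
  apply: ratlM; last exact/ratlV/ratl_nat.
  by case: he => ->; [|apply: ratlN]; apply: (ratl_nat 1).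
rewrite coord_restr; case: ifP => _; last exact: (ratl_nat 0).
rewrite coord_sum big_nat; apply: ratl_sum => j /andP[j0]; rewrite ltnS => jk.
have jb : (1 <= j <= (n q)./2)%N by rewrite j0.
have [h _ _] := h1 _ jb.
have Qj a : (1 <= a <= size phi)%N -> in_Q (x_ phi a) /\ in_Q (f_ phi a).
  by case: Q => _ + _; apply.
have [_ [_ fr]] := Qj (2 * j).-1 ltac:(rewrite sz; lia).
have [[_ xr] _] := Qj (2 * j)%N ltac:(rewrite sz; lia).
rewrite coordD coordZ; apply: ratlD; last exact: IH h.
apply: ratlM; last by have [] := fr i.
have := h2 _ jb; case: ifP => _.
  move=> ->; rewrite pairingZr; apply: ratlM; first exact: ratl_nat.
  by apply: ratl_pairing => a; [apply: IH h|have [] := xr a].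
have r2 : ratl ((n q)%:R ^+ 2)^-1 by apply: ratlV; rewrite -natrX; apply: ratl_nat.
by case=> ->//; apply: ratlN.
Qed.

Lemma K_rational f i : K f -> ratl (f i).
Proof. by case=> l _ [q _ /Kl_rational]. Qed.

End NormingSet.

(** * The norm *)

Section Norm.
Variables (R : realType) (m n s : nat -> nat) (sigma : seq (c00 R * c00 R) -> nat).
Hypothesis Hp : ius_params m n s.
Hypothesis Hs : coding m sigma.
Local Notation K := (K_ius m n sigma).
Local Notation Kw := (Kw m n sigma).
Local Notation nu := (norm_ius m n sigma).
Implicit Types (x y f g : c00 R).

Lemma K_le_nu f x : K f -> pairing f x <= nu x.
Proof.
move=> Kf; apply: ub_le_sup; last by exists f.
exists (1 * norm1 x) => _ [g Kg <-]; apply: le_trans (ler_norm _) _.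
by apply: pairing_norm1 => i; apply: (K_coord Hp Hs).
Qed.

Lemma K_abs_le_nu f x : K f -> `|pairing f x| <= nu x.
Proof.
move=> Kf; rewrite ler_norml K_le_nu// andbT lerNl -pairingNl.
by apply: K_le_nu; apply: K_opp.
Qed.

Lemma nu_le x B : (forall f, K f -> pairing f x <= B) -> nu x <= B.
Proof.
move=> h; apply: ge_sup => [|_ [f Kf <-]]; last exact: h.
by exists (pairing (e R 1) x), (e R 1) => //; apply: K_e.
Qed.

Lemma nu_gt x c : c < nu x -> exists2 f, K f & c < pairing f x.
Proof.
move=> cx; apply: contrapT => h; move: cx; rewrite ltNge => /negP; apply.
by apply: nu_le => f Kf; rewrite leNgt; apply/negP => cf; apply: h; exists f.
Qed.

Lemma nuZ_le a x : nu (a *: x) <= `|a| * nu x.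
Proof.
apply: nu_le => f Kf; rewrite pairingZr; apply: le_trans (ler_norm _) _.
by rewrite normrM ler_wpM2l// K_abs_le_nu.
Qed.

Lemma nu_le_norm1 x : nu x <= norm1 x.
Proof.
apply: nu_le => f Kf; apply: le_trans (ler_norm _) _; rewrite -[leRHS]mul1r.
by apply: pairing_norm1 => i; apply: (K_coord Hp Hs).
Qed.

Lemma nuD x y : nu (x + y) <= nu x + nu y.
Proof. by apply: nu_le => f Kf; rewrite pairingDr lerD// K_le_nu. Qed.

Lemma nu_coord x i : `|x i| <= nu x.
Proof.
case: i => [|i].
  by rewrite coord_0 normr0 (le_trans _ (K_abs_le_nu x (K_e _ _ _ (ltn0Sn 0)))).
by rewrite -pairing_e pairingC K_abs_le_nu//; apply: K_e.
Qed.

End Norm.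

(** * Sums of blocks *)

Section BlockSums.
Variables (R : realType) (m n s : nat -> nat) (sigma : seq (c00 R * c00 R) -> nat).
Hypothesis Hp : ius_params m n s.
Hypothesis Hs : coding m sigma.
Local Notation K := (K_ius m n sigma).
Local Notation Kw := (Kw m n sigma).
Local Notation Kball := (Kball m n sigma).
Variables (N : nat) (x : nat -> c00 R) (C : R).
Hypothesis C0 : 0 <= C.
Hypothesis xblock : forall i j, (i < j < N)%N -> before (x i) (x j).
Hypothesis xC : forall k f, (k < N)%N -> K f -> `|pairing f (x k)| <= C.

Definition blocks_sum := \sum_(k < N) x k.
Local Notation X := blocks_sum.

(** The number of blocks that begin before v. It is monotone in v, so that its
    increments over the intervals of successive functionals telescope. *)
Definition touched (v : nat) : nat :=
  \sum_(k < N) `[< exists2 i, (i < v)%N & supp (x k) i >].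

Lemma touched_le u v : (u <= v)%N -> (touched u <= touched v)%N.
Proof.
move=> uv; apply: leq_sum => k _.
case: asboolP => // -[i iu xi]; case: asboolP => // -[].
by exists i => //; apply: leq_trans uv.
Qed.

Lemma touched0 : touched 0 = 0%N.
Proof. by apply: big1 => k _; case: asboolP => // -[]. Qed.

Lemma touched_leN v : (touched v <= N)%N.
Proof.
rewrite -[leqRHS]card_ord -sum1_card; apply: leq_sum => k _; exact: leq_b1.
Qed.

Definition within (u v : nat) (f : c00 R) := forall i, supp f i -> (u <= i < v)%N.

(** A functional living on [u, v) sees the blocks that begin in [u, v), and
    at most one block that begins before u. *)
Lemma block_count f u v (k0 : nat) (tau : R) : 0 <= tau -> (u <= v)%N -> within u v f -> K f ->
  (forall k, (k < N)%N -> k != k0 -> `|pairing f (x k)| <= tau) ->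
  `|pairing f X| <= C + tau + tau * ((touched v)%:R - (touched u)%:R).
Proof.
move=> tau0 uv fuv Kf fx.
pose b w (k : nat) : bool := `[< exists2 i, (i < w)%N & supp (x k) i >].
pose mid k := (k < N)%N /\ b u k /\ exists2 i, (u <= i)%N & supp (x k) i.
have midU k k' : mid k -> mid k' -> (k < k')%N -> False.
  move=> [kN [_ [i ui xi]]] [k'N [/asboolP[j ju xj] _]] kk'.
  have := xblock (introT andP (conj kk' k'N)) xi xj.
  by rewrite ltnNge (leq_trans (ltnW ju) ui).
have [k1 k1P] : exists k1, forall k, mid k -> k = k1.
  have [[k1 mk1]|h] := pselect (exists k, mid k); last first.
    by exists 0%N => k mk; case: h; exists k.
  exists k1 => k mk; apply/eqP; case: (ltngtP k k1) => // kk.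
  - by case: (midU _ _ mk mk1 kk).
  - by case: (midU _ _ mk1 mk kk).
have buv k : (b u k <= b v k)%N.
  rewrite /b; case: asboolP => // -[i iu xi]; case: asboolP => // -[].
  by exists i => //; apply: leq_trans uv.
have point (k : 'I_N) : `|pairing f (x k)| <=
    tau * ((b v k)%:R - (b u k)%:R) + (C * (k == k0 :> nat)%:R + tau * (k == k1 :> nat)%:R).
  have t1 : 0 <= tau * ((b v k)%:R - (b u k)%:R) by rewrite mulr_ge0// subr_ge0 ler_nat.
  have t2 : 0 <= C * (k == k0 :> nat)%:R by rewrite mulr_ge0.
  have t3 : 0 <= tau * (k == k1 :> nat)%:R by rewrite mulr_ge0.
  have [kk0|kk0] := eqVneq (k : nat) k0.
    by have := xC (ltn_ord k) Kf => h; rewrite -[true%:R]/(1 : R) mulr1; lra.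
  rewrite -[false%:R]/(0 : R) mulr0 add0r.
  have [->|fk] := eqVneq (pairing f (x k)) 0; first by rewrite normr0; lra.
  have [i [fi xi]] : exists i, supp f i /\ supp (x k) i.
    apply: contrapT => h; move: fk; rewrite pairing_disjoint ?eqxx// => i fi xi.
    by apply: h; exists i.
  have /andP[ui iv] := fuv _ fi.
  have bv : b v k by apply/asboolP; exists i.
  have := fx _ (ltn_ord k) kk0; rewrite bv -[true%:R]/(1 : R).
  have [bu|bu] := boolP (b u k); last first.
    by rewrite -[false%:R]/(0 : R) subr0 mulr1; lra.
  have kk1 : (k : nat) = k1 by apply: k1P; split=> //; split=> //; exists i.
  by rewrite kk1 eqxx -[true%:R]/(1 : R) subrr mulr0 add0r mulr1.
rewrite /X pairing_sumr; apply: le_trans (ler_norm_sum _ _ _) _.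
apply: le_trans (ler_sum _ (fun k _ => point k)) _.
rewrite !big_split /= -!mulr_sumr.
have one k2 : \sum_(k < N) (k == k2 :> nat)%:R <= 1 :> R.
  have [k2N|k2N] := ltnP k2 N; last first.
    rewrite big1// => k _; case: eqP => // kk2.
    by move: k2N; rewrite -kk2 leqNgt ltn_ord.
  rewrite (bigD1 (Ordinal k2N))//= eqxx big1 ?addr0// => k kk2.
  by case: eqP => // kE; case/eqP: kk2; apply: val_inj.
rewrite /touched !natr_sum -sumrB.
have := ler_wpM2l C0 (one k0); have := ler_wpM2l tau0 (one k1).
rewrite !mulr1 => h1 h2.
set S := \sum_(i < N) _ in h1 h2 *.
by lra.
Qed.

(** [controlled A kappa f] is the form of all estimates: a fixed part, plus
    [kappa] for each block that begins where [f] lives. The second part is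
    additive over successive functionals. *)
Definition controlled (A kappa : R) (f : c00 R) := forall u v, (u <= v)%N ->
  within u v f -> `|pairing f X| <= C * (A + ((touched v)%:R - (touched u)%:R) * kappa).

Lemma touched_sub_ge0 u v : (u <= v)%N -> 0 <= (touched v)%:R - (touched u)%:R :> R.
Proof. by move=> uv; rewrite subr_ge0 ler_nat touched_le. Qed.

Lemma controlled_ge (A kappa A' kappa' : R) f : A <= A' -> kappa <= kappa' ->
  controlled A kappa f -> controlled A' kappa' f.
Proof.
move=> AA kk h u v uv fuv; apply: le_trans (h u v uv fuv) _.
by rewrite ler_wpM2l// lerD// ler_wpM2l// touched_sub_ge0.
Qed.

Lemma controlled_Kball (A kappa : R) g : 0 <= A -> 0 <= kappa ->
  (forall f, K f -> controlled A kappa f) -> Kball g -> controlled A kappa g.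
Proof.
move=> A0 k0 h [c [f [c1 Kf ->]]] u v uv guv.
have [c0|c0] := eqVneq c 0.
  by rewrite c0 scale0r pairing0l normr0 mulr_ge0// addr_ge0// mulr_ge0// touched_sub_ge0.
rewrite pairingZl normrM; apply: le_trans (_ : `|pairing f X| <= _).
  by rewrite ler_piMl.
apply: h => // i fi; apply: guv.
by rewrite suppE coordZ mulf_neq0.
Qed.

(** Cut [u, v) behind the support of the first functional: the increments of
    [touched] add up to that of [u, v), while the fixed part is paid once for
    each functional. *)
Lemma controlled_sum (A kappa : R) t : 0 <= A -> 0 <= kappa -> successive t ->
  (forall g, g \in t -> controlled A kappa g) ->
  forall u v, (u <= v)%N -> (forall g, g \in t -> within u v g) ->
  `|pairing (\sum_(g <- t) g) X| <=
    C * ((size t)%:R * A + ((touched v)%:R - (touched u)%:R) * kappa).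
Proof.
move=> A0 k0; elim: t => [|g t IH] st tc u v uv tuv.
  by rewrite big_nil pairing0l normr0 mul0r add0r mulr_ge0// mulr_ge0// touched_sub_ge0.
move: st; rewrite /successive /= => /andP[/allP gt st].
have tc' h : h \in t -> controlled A kappa h by move=> ht; apply: tc; rewrite in_cons ht orbT.
have tuv' h : h \in t -> within u v h by move=> ht; apply: tuv; rewrite in_cons ht orbT.
rewrite big_cons pairingDl; apply: le_trans (ler_normD _ _) _.
have sE : ((size t).+1%:R : R) = (size t)%:R + 1 by rewrite -natr1.
have [g0|g0] := pselect (g = 0).
  rewrite g0 pairing0l normr0 add0r; apply: le_trans (IH st tc' u v uv tuv') _.
  by rewrite ler_wpM2l// sE; lra.
have [i gi gmax] := supp_max g0.
have /andP[ui iv] := tuv g (mem_head _ _) i gi.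
have h1 : within u i.+1 g.
  by move=> j gj; rewrite ltnS gmax// andbT; have /andP[] := tuv g (mem_head _ _) j gj.
have h2 h : h \in t -> within i.+1 v h.
  move=> ht j hj; have /andP[_ ->] := tuv' h ht j hj; rewrite andbT.
  by have /asboolP/(_ i j gi hj) := gt h ht.
have := tc g (mem_head _ _) u i.+1 (leq_trans ui (leqnSn _)) h1.
have := IH st tc' i.+1 v iv h2.
move=> b1 b2; apply: le_trans (lerD b2 b1) _.
by rewrite -mulrDr ler_wpM2l// sE; lra.
Qed.

Lemma successive_supp (t : seq (c00 R)) g : successive t -> g \in t ->
  supp g `<=` supp (\sum_(h <- t) h).
Proof.
elim: t => // h t IH; rewrite /successive /= => /andP[/allP ht st].
rewrite in_cons big_cons => /predU1P[->|gt] i gi; rewrite suppE coordD.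
  rewrite coord_sum big_seq big1 ?addr0 => [|g' g't]; first exact: gi.
  by apply: suppN => g'i; have /asboolP/(_ i i gi g'i) := ht _ g't; rewrite ltnn.
have -> : h i = 0.
  by apply: suppN => hi; have /asboolP/(_ i i hi gi) := ht _ gt; rewrite ltnn.
by rewrite add0r; apply: IH st gt i gi.
Qed.

Lemma weight_step (A kappa : R) q f : 0 <= A -> 0 <= kappa -> (1 < q)%N ->
  (forall f, K f -> controlled A kappa f) -> Kw q f ->
  controlled ((n q)%:R * A / (m q)%:R) (kappa / (m q)%:R) f.
Proof.
move=> A0 k0 q1 h fq u v uv fuv.
have w0 : (0 < (m q)%:R :> R) by rewrite ltr0n (m_gt0 Hp)// ltnW.
have [t [tn st tP fE]] := Kw_shape Hp Hs q1 fq.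
have tuv g : g \in t -> within u v g.
  move=> gt i gi; apply: fuv; rewrite fE suppE coordZ.
  rewrite mulf_neq0 ?(invr_neq0 (lt0r_neq0 w0))//.
  exact: (successive_supp st gt).
rewrite fE pairingZl normrM ger0_norm; last by rewrite invr_ge0 ltW.
have := controlled_sum A0 k0 st (fun g gt => controlled_Kball A0 k0 h (tP g gt)) uv tuv.
move=> b; apply: le_trans (_ : (m q)%:R^-1 *
    (C * ((n q)%:R * A + ((touched v)%:R - (touched u)%:R) * kappa)) <= _).
  apply: ler_wpM2l; first by rewrite invr_ge0 ltW.
  apply: le_trans b _.
  by rewrite ler_wpM2l// lerD2r ler_wpM2r// ler_nat.
rewrite le_eqVlt; apply/orP; left; apply/eqP.
by field; rewrite gt_eqF.
Qed.

(** A functional of weight [m q] with q < p halves the second part at the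
    price of a factor [n q] in the first one. Iterating this as long as the
    weights stay below [m p] replaces [kappa] by almost [eta]. *)
Lemma controlled_iter p (eta : R) : (1 < p)%N -> 0 <= eta <= 1 ->
  (forall q f, (p < q)%N -> Kw q f -> exists k0, forall k, (k < N)%N -> k != k0 ->
     `|pairing f (x k)| <= C * eta) ->
  (forall f, Kw p f -> controlled 2 eta f) ->
  forall r f, K f -> controlled (2 * (n p.-1)%:R ^+ r) (2 ^- r + eta) f.
Proof.
move=> p1 /andP[e0 e1] large atp.
have p0 : (0 < p.-1)%N by case: p p1 {large atp} => [|[]].
have n1 : 1 <= (n p.-1)%:R :> R by rewrite ler1n (n_gt0 Hp).
elim=> [|r IH] f Kf.
  move=> u v uv fuv; rewrite expr0 invr1 mulr1.
  apply: le_trans (block_count (k0 := N) C0 uv fuv Kf _) _.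
    by move=> k kN _; apply: xC.
  rewrite -[X in X + X]mulr1 -!mulrDr -[1 + 1]/2 ler_wpM2l//.
  rewrite lerD2l ler_peMr ?touched_sub_ge0//; lra.
have nr1 k : 1 <= (n p.-1)%:R ^+ k :> R by rewrite exprn_ege1.
have pw k : 0 < 2 ^- k :> R by rewrite invr_gt0 exprn_gt0.
have [q fq] := K_Kw Kf.
have [[q0 [a a0 fE]]|q1] := Kw_cases fq.
  move=> u v uv fuv.
  have [k0 k0P] : exists k0, forall k, (k < N)%N -> k != k0 -> `|pairing f (x k)| <= 0.
    have fx k : ~ supp (x k) a -> `|pairing f (x k)| <= 0.
      move=> h; rewrite pairing_disjoint ?normr0// => i fi xi; apply: h.
      suff <- : i = a by [].
      by case: fE fi => ->; [|rewrite suppE coordN oppr_eq0 -suppE]; move/supp_e.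
    have [[k0 [k0N xk0]]|h] := pselect (exists k0, (k0 < N)%N /\ supp (x k0) a); last first.
      by exists 0%N => k kN _; apply: fx => xk; apply: h; exists k.
    exists k0 => k kN kk0; apply: fx => xk.
    case: (ltngtP k k0) kk0 => // kk _.
    - by have := xblock (introT andP (conj kk k0N)) xk xk0; rewrite ltnn.
    - by have := xblock (introT andP (conj kk kN)) xk0 xk; rewrite ltnn.
  apply: le_trans (block_count (lexx 0) uv fuv Kf k0P) _.
  rewrite mul0r !addr0 ler_peMr//.
  have := touched_sub_ge0 uv; have := nr1 r.+1; have := pw r.+1 => h1 h2 h3.
  have : 0 <= ((touched v)%:R - (touched u)%:R) * (2 ^- r.+1 + eta) by rewrite mulr_ge0//; lra.
  by lra.
have [qp|pq|qp] := ltngtP q p.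
- have q0 : (0 < q)%N by exact: ltnW.
  have A0 : 0 <= 2 * (n p.-1)%:R ^+ r :> R by have := nr1 r; lra.
  have k0 : 0 <= 2 ^- r + eta by have := pw r; lra.
  apply: controlled_ge (weight_step A0 k0 q1 IH fq).
  + rewrite ler_pdivrMr ?ltr0n ?(m_gt0 Hp)// exprSr.
    have h1 : (n q)%:R <= (n p.-1)%:R :> R by rewrite ler_nat (n_le Hp)// -ltnS prednK// ltnW.
    have h2 : 1 <= (m q)%:R :> R by rewrite ler1n (m_gt0 Hp).
    apply: le_trans (_ : (n p.-1)%:R * (2 * (n p.-1)%:R ^+ r) <= _).
      by rewrite ler_wpM2r.
    have -> : 2 * ((n p.-1)%:R ^+ r * (n p.-1)%:R) * (m q)%:R =
      ((n p.-1)%:R * (2 * (n p.-1)%:R ^+ r)) * (m q)%:R :> R by ring.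
    by rewrite ler_peMr// mulr_ge0// ltW// (lt_le_trans ltr01).
  + have h2 : 2 <= (m q)%:R :> R by rewrite ler_nat (m_gt1 Hp).
    apply: le_trans (_ : (2 ^- r + eta) / 2 <= _).
      by rewrite ler_wpM2l// lef_pV2// posrE//; lra.
    by rewrite exprSr invfM; lra.
- have [k0 k0P] := large _ _ pq fq.
  move=> u v uv fuv.
  apply: le_trans (block_count (mulr_ge0 C0 e0) uv fuv Kf k0P) _.
  rewrite -[X in X + _ + _]mulr1 -mulrA -!mulrDr ler_wpM2l//.
  have t0 := touched_sub_ge0 uv.
  have := ler_wpM2l t0 (ltW (pw r.+1)); have := nr1 r.+1.
  rewrite mulr0 mulrDr [eta * _]mulrC; lra.
- rewrite -qp in atp; apply: controlled_ge (atp f _); last by rewrite -?qp.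
  + by have := nr1 r.+1; lra.
  + by have := pw r.+1; lra.
Qed.

Lemma controlled_total (A kappa : R) f : 0 <= kappa -> controlled A kappa f ->
  `|pairing f X| <= C * (A + N%:R * kappa).
Proof.
move=> k0 h; have [v fv] := supp_bound f.
apply: le_trans (h 0%N v (leq0n _) _) _; first by move=> i /fv ->.
rewrite ler_wpM2l// lerD2l ler_wpM2r// touched0 subr0 ler_nat.
exact: touched_leN.
Qed.

End BlockSums.

(** * Averages of rapidly increasing sequences *)

Section Averages.
Variables (R : realType) (m n s : nat -> nat) (sigma : seq (c00 R * c00 R) -> nat).
Hypothesis Hp : ius_params m n s.
Hypothesis Hs : coding m sigma.
Local Notation K := (K_ius m n sigma).
Local Notation Kw := (Kw m n sigma).
Local Notation nu := (norm_ius m n sigma).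

(** The behaviour of a normalized average of [n p] vectors of a rapidly
    increasing sequence under functionals of weight different from [m p]. *)
Definition tame (p : nat) (B : R) (z : c00 R) :=
  [/\ forall f, K f -> `|pairing f z| <= B,
      forall q f, (1 < q < p)%N -> Kw q f -> `|pairing f z| <= B / (m q)%:R &
      forall q f, (p < q)%N -> Kw q f -> `|pairing f z| <= B / (m p)%:R ^+ 2].

(** With n_p = n_(p-1)^s 4^s and s = s_(p-1), s iterations bring the fixed part
    to 2 n_(p-1)^s = 2 n_p / 4^s, at most 2 n_p / m_p^6, and kappa to 2^(-s) + eta,
    where 2^(-s) is at most 1 / m_p^3; functionals of weight m_p account for eta
    of the order of 1 / m_p. After multiplication with m_p / n_p a constant
    remains. *)
Lemma tame_average p (x : nat -> c00 R) (C : R) : (1 < p)%N -> 0 <= C ->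
  (forall i j, (i < j < n p)%N -> before (x i) (x j)) ->
  (forall k f, (k < n p)%N -> K f -> `|pairing f (x k)| <= C) ->
  (forall q f, (1 < q)%N -> Kw q f -> exists k0, forall k, (k < n p)%N -> k != k0 ->
     `|pairing f (x k)| <= C * ((m q)%:R^-1 + (m p)%:R ^- 3)) ->
  tame p (3 * C) (((m p)%:R / (n p)%:R) *: blocks_sum (n p) x).
Proof.
move=> p1 C0 xb xC ris.
have [j pE j0] : exists2 j, p = j.+1 & (0 < j)%N.
  by case: p p1 {xb xC ris} => [|[|j]] // _; exists j.+1.
have s0 : (0 < s j)%N by case: Hp => _ _ _ _ /(_ j j0)[].
set M : R := (m p)%:R; set L : R := (n p)%:R.
have M32 : 32 <= M by rewrite /M ler_nat (m_ge32 Hp).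
have L0 : 0 < L by rewrite ltr0n (n_gt0 Hp) ?(ltnW p1).
set w := M^-1.
have w0 : 0 < w by rewrite invr_gt0; lra.
have Mw : M * w = 1 by rewrite mulfV//; apply: lt0r_neq0; lra.
have w32 : w <= 1 / 32 by rewrite div1r lef_pV2 ?posrE//; lra.
have wE k : M ^- k = w ^+ k by rewrite /w exprVn.
set a : R := (n j)%:R ^+ s j.
have a0 : 0 <= a by rewrite exprn_ge0.
have b_le : 2 ^- s j <= w ^+ 3 :> R.
  rewrite -wE lef_pV2 ?posrE ?exprn_gt0//; last by lra.
  by rewrite /M -!natrX ler_nat pE (s_large Hp).
have a_le : a <= L * w ^+ 6.
  rewrite -wE ler_pdivlMr ?exprn_gt0//; last by lra.
  rewrite /a /L /M -!natrX -natrM ler_nat pE (n_split Hp)// leq_mul2l.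
  by rewrite (m_exp6_le_exp4 Hp)// orbT.
have L_ge : 1 <= L * w ^+ 6.
  rewrite -wE ler_pdivlMr ?exprn_gt0 ?mul1r//; last by lra.
  by rewrite /L /M -natrX ler_nat (m_exp6_le_n Hp).
set eta := w + w ^+ 3.
have w3 : w ^+ 3 <= w ^+ 2 / 32 by rewrite exprSr ler_wpM2l// ?exprn_ge0//; lra.
have w2 : w ^+ 2 <= w / 32 by rewrite exprSr expr1 ler_wpM2l//; lra.
have p2 : 0 < w ^+ 2 by rewrite exprn_gt0.
have p3 : 0 < w ^+ 3 by rewrite exprn_gt0.
have eta01 : 0 <= eta <= 1 by rewrite /eta; apply/andP; split; lra.
have mq q : (p < q)%N -> (m q)%:R^-1 <= w ^+ 5 :> R.
  move=> pq; have q0 : 0 < (m q)%:R :> R by rewrite ltr0n (m_gt0 Hp)// (leq_trans _ pq).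
  have M5 : 0 < M ^+ 5 by rewrite exprn_gt0//; lra.
  rewrite -wE lef_pV2 ?posrE//.
  by rewrite /M -natrX ler_nat (m_exp5 Hp) ?(ltnW p1).
have w5 : w ^+ 5 <= w ^+ 3.
  by rewrite -[5%N]/(2 + 3)%N exprD ler_piMl//; [exact: ltW|rewrite expr_le1//; lra].
have large q f : (p < q)%N -> Kw q f -> exists k0, forall k, (k < n p)%N -> k != k0 ->
     `|pairing f (x k)| <= C * (2 * w ^+ 3).
  move=> pq fq; have [k0 k0P] := ris q f (ltn_trans p1 pq) fq.
  exists k0 => k kN kk0; apply: le_trans (k0P k kN kk0) _.
  rewrite ler_wpM2l// -/M wE; have := mq _ pq; lra.
have atp f : Kw p f -> controlled (n p) x C 2 eta f.
  move=> fp u v uv fuv; have [k0 k0P] := ris p f p1 fp.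
  have t0 : 0 <= C * eta by rewrite mulr_ge0//; case/andP: eta01.
  apply: le_trans (block_count (k0 := k0) C0 xb xC t0 uv fuv (Kw_K fp) _) _.
  - by move=> k kN kk0; rewrite /eta -wE; apply: k0P.
  - rewrite -[X in X + _ + _]mulr1 -mulrA -!mulrDr ler_wpM2l//.
    by rewrite [eta * _]mulrC; case/andP: eta01 => h0 h1; lra.
have large' q f : (p < q)%N -> Kw q f -> exists k0, forall k, (k < n p)%N -> k != k0 ->
     `|pairing f (x k)| <= C * eta.
  move=> pq fq; have [k0 k0P] := large q f pq fq.
  by exists k0 => k kN kk0; apply: le_trans (k0P k kN kk0) _; rewrite ler_wpM2l// /eta; lra.
have iter r f : K f -> controlled (n p) x C (2 * (n j)%:R ^+ r) (2 ^- r + eta) f.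
  have := controlled_iter Hp Hs C0 xb xC p1 eta01 large' atp r (f := f).
  by rewrite pE.
have k0 r : 0 <= 2 ^- r + eta by rewrite addr_ge0 ?invr_ge0 ?exprn_ge0//; case/andP: eta01.
have zE f : `|pairing f ((M / L) *: blocks_sum (n p) x)| =
    M / L * `|pairing f (blocks_sum (n p) x)|.
  by rewrite pairingZr normrM ger0_norm// divr_ge0//; lra.
have ML0 : 0 <= M / L by rewrite divr_ge0//; lra.
have ML : M / L * L = M by rewrite divfK// gt_eqF.
have MLa : M / L * a <= w ^+ 5.
  apply: le_trans (ler_wpM2l ML0 a_le) _.
  by rewrite mulrA ML [w ^+ 6]exprS mulrA Mw mul1r.
have ML1 : M / L <= w ^+ 5.
  apply: le_trans (_ : M / L * (L * w ^+ 6) <= _); first by rewrite ler_peMr.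
  by rewrite mulrA ML [w ^+ 6]exprS mulrA Mw mul1r.
have Mw3 : M * w ^+ 3 = w ^+ 2 by rewrite exprS mulrA Mw mul1r.
have L_neq0 : L != 0 by rewrite gt_eqF.
have split2 (e1 e2 : R) : M / L * (C * (2 * a + L * (e1 + e2))) =
    C * (2 * (M / L * a) + M * e1 + M * e2) by field.
have split3 (e1 e2 q : R) : M / L * (C * (2 * a / q + L * ((e1 + e2) / q))) =
    C / q * (2 * (M / L * a) + M * e1 + M * e2).
  rewrite -[_ / q in RHS]/(C * q^-1); move: q^-1 => q'; by field.
have split4 (e : R) : M / L * (C + C * (2 * e) + C * (2 * e) * L) =
    C * (M / L * (1 + 2 * e) + 2 * (M * e)) by field.
have Meta : M * eta = 1 + w ^+ 2 by rewrite /eta mulrDr Mw Mw3.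
split.
- move=> f Kf; rewrite zE.
  have := controlled_total C0 (k0 (s j)) (iter (s j) f Kf).
  rewrite -/a -/L => h; apply: le_trans (ler_wpM2l ML0 h) _.
  rewrite split2 [3 * C]mulrC ler_wpM2l//.
  have : M * 2 ^- s j <= w ^+ 2 by rewrite -Mw3 ler_wpM2l//; lra.
  by rewrite Meta; lra.
- move=> q f /andP[q1 qp] fq; rewrite zE.
  have q0 : 0 < (m q)%:R :> R by rewrite ltr0n (m_gt0 Hp) ?(ltnW q1).
  (* one iteration less, so that the factor n q still fits into (n j) ^ (s j) *)
  set r := (s j).-1.
  have A0 : 0 <= 2 * (n j)%:R ^+ r :> R by rewrite mulr_ge0// exprn_ge0.
  have := weight_step Hp Hs C0 A0 (k0 r) q1 (iter r) fq.
  move=> /(controlled_total C0 (divr_ge0 (k0 r) (ltW q0))); rewrite -/L => h.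
  apply: le_trans (ler_wpM2l ML0 h) _.
  have h1 : (n q)%:R * (2 * (n j)%:R ^+ r) <= 2 * a.
    rewrite mulrCA ler_wpM2l// /a -(prednK s0) exprS -/r ler_wpM2r ?exprn_ge0//.
    by rewrite ler_nat (n_le Hp)// ?(ltnW q1)// -ltnS -pE.
  have h2 : 2 ^- r = 2 * 2 ^- s j :> R.
    by rewrite -(prednK s0) -/r exprS invfM mulrA mulfV ?mul1r// pnatr_eq0.
  apply: le_trans (_ : M / L * (C * (2 * a / (m q)%:R + L * ((2 ^- r + eta) / (m q)%:R))) <= _).
    by rewrite ler_wpM2l// ler_wpM2l// lerD2r ler_wpM2r// invr_ge0 ltW.
  have -> : 3 * C / (m q)%:R = C / (m q)%:R * 3 by rewrite -mulrA mulrC.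
  rewrite split3; apply: ler_wpM2l; first by rewrite divr_ge0// ltW.
  have : M * 2 ^- s j <= w ^+ 2 by rewrite -Mw3 ler_wpM2l//; lra.
  by rewrite h2 Meta; lra.
- move=> q f pq fq; rewrite zE.
  have [v fv] := supp_bound f.
  have fuv : within 0 v f by move=> i /fv ->.
  have [k1 k1P] := large q f pq fq.
  have t0 : 0 <= C * (2 * w ^+ 3) by rewrite mulr_ge0// mulr_ge0// ltW.
  have h := block_count C0 xb xC t0 (leq0n _) fuv (Kw_K fq) k1P.
  apply: le_trans (ler_wpM2l ML0 h) _.
  apply: le_trans (_ : M / L * (C + C * (2 * w ^+ 3) + C * (2 * w ^+ 3) * L) <= _).
    by rewrite ler_wpM2l// lerD2l ler_wpM2l// touched0 subr0 ler_nat touched_leN.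
  have -> : 3 * C / M ^+ 2 = C * (3 * w ^+ 2) by rewrite -wE; ring.
  rewrite split4 Mw3; apply: ler_wpM2l => //.
  have : M / L * (1 + 2 * w ^+ 3) <= w ^+ 5 * 2.
    by apply: ler_pM => //; lra.
  lra.
Qed.

End Averages.

(** * Vectors of the block subspace *)

(** Dependent choice, where each choice may depend on the whole history. *)
Lemma history_choice (A : Type) (I : seq A -> Prop) (Q : seq A -> A -> Prop) :
  I [::] -> (forall L, I L -> exists a, Q L a /\ I (rcons L a)) ->
  exists xi : nat -> A, forall i, I (mkseq xi i) /\ Q (mkseq xi i) (xi i).
Proof.
move=> I0 next.
have [a0 _] := next _ I0.
have /choice[F FP] : forall L, exists a, I L -> Q L a /\ I (rcons L a).
  move=> L.
  by have [/next[a h]|h] := pselect (I L); [exists a|exists a0].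
pose Ls := fix Ls i := if i is i'.+1 then rcons (Ls i') (F (Ls i')) else [::].
have LsE i : mkseq (fun i => F (Ls i)) i = Ls i.
  by elim: i => // i IH; rewrite mkseqS IH.
exists (fun i => F (Ls i)) => i; rewrite LsE.
suff H : I (Ls i) by split=> //; have [] := FP _ H.
by elim: i => // i IH; have [] := FP _ IH.
Qed.

Lemma sum_regroup (V : nmodType) (G : nat -> V) k l :
  \sum_(b < k) \sum_(a < l) G (b * l + a)%N = \sum_(a < k * l) G a.
Proof.
elim: k => [|k IH]; first by rewrite !big_ord0.
rewrite big_ord_recr IH /= mulSn addnC -!(big_mkord xpredT G).
rewrite [RHS](@big_cat_nat _ _ _ (k * l)%N 0%N) ?leq_addr//=; congr (_ + _).
rewrite -[X in \sum_(X <= _ < _) _]add0n big_addn addKn big_mkord.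
by apply: eq_bigr => a _; rewrite addnC.
Qed.

Section BlockSubspace.
Variables (R : realType) (m n s : nat -> nat) (sigma : seq (c00 R * c00 R) -> nat).
Hypothesis Hp : ius_params m n s.
Hypothesis Hs : coding m sigma.
Local Notation K := (K_ius m n sigma).
Local Notation Kw := (Kw m n sigma).
Local Notation nu := (norm_ius m n sigma).
Local Notation tame := (tame m n sigma).
Implicit Types (x z f : c00 R).

Lemma range_interval x : nat_interval (range_of x).
Proof.
move=> a b c [i [j [xi xj /andP[ia aj]]]] [i' [j' [xi' xj' /andP[ib bj]]]] /andP[ac cb].
by exists i, j'; split=> //; rewrite (leq_trans ia)//= (leq_trans cb).
Qed.

(** Norming functionals of successive vectors, cut down to the ranges of the
    vectors, add up to a functional of even weight. *)
Lemma even_functional q N (x : nat -> c00 R) (c : R) : (1 < q)%N -> ~~ odd q ->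
  (0 < N <= n q)%N -> 0 <= c -> (forall i j, (i < j < N)%N -> before (x i) (x j)) ->
  (forall k, (k < N)%N -> c < nu (x k)) ->
  exists f, [/\ Kw q f, N%:R * c / (m q)%:R <= pairing f (blocks_sum N x) &
    forall i, supp f i -> exists2 k, (k < N)%N & range_of (x k) i].
Proof.
move=> q1 oq Nn c0 xb cx.
have /choice[g gP] : forall k, exists g : c00 R, (k < N)%N ->
    [/\ K g, supp g `<=` range_of (x k) & c < pairing g (x k)].
  move=> k.
  have [kN|kN] := ltnP k N; last by exists 0.
  have [f Kf cf] := nu_gt (cx k kN).
  have rE : pairing (restr (range_of (x k)) f) (x k) = pairing f (x k).
    by rewrite pairing_restr restr_id//; apply: supp_range.
  have [j fj] := K_Kw Kf.
  exists (restr (range_of (x k)) f) => _; split; last by rewrite rE.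
  - have [/Kw_K//|r0] := Kw_restr (@range_interval (x k)) fj.
    by move: cf; rewrite -rE r0 pairing0l ltNge c0.
  - move=> i; rewrite suppE coord_restr; case: ifPn; last by rewrite eqxx.
    by rewrite inE.
have gb i j : (i < j < N)%N -> before (g i) (g j).
  move=> /andP[ij jN]; have [_ si _] := gP i (ltn_trans ij jN); have [_ sj _] := gP j jN.
  move=> a b /si[_ [a' [_ xa' /andP[_ aa]]]] /sj[b' [_ [xb' _ /andP[bb _]]]].
  apply: leq_ltn_trans aa (leq_trans _ bb).
  by apply: xb xa' xb'; rewrite ij.
exists ((m q)%:R^-1 *: \sum_(h <- mkseq g N) h); split.
- apply: (Kw_even q1 oq).
  + by rewrite size_mkseq.
  + apply/(pairwiseP 0) => i j; rewrite !inE size_mkseq => iN jN ij.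
    by rewrite !nth_mkseq//; apply: gb; rewrite ij.
  + by move=> h /mapP[k]; rewrite mem_iota /= add0n => kN ->; have [] := gP k kN.
- rewrite sum_mkseq pairingZl mulrC ler_wpM2l ?invr_ge0//.
  rewrite pairing_suml mulr_natl -[N in _ *+ N]card_ord -sumr_const.
  apply: ler_sum => k _; rewrite /blocks_sum pairing_sumr (bigD1 k)//= big1 ?addr0.
    by have [_ _ /ltW] := gP k (ltn_ord k).
  move=> l lk; apply: pairing_disjoint => i.
  have [_ sk _] := gP k (ltn_ord k) => /sk[a [b [xa xb' /andP[ai ib]]]] xi.
  case: (ltngtP k l) => kl.
  + by have := xb k l; rewrite kl ltn_ord => /(_ isT _ _ xb' xi); rewrite ltnNge ib.
  + by have := xb l k; rewrite kl ltn_ord => /(_ isT _ _ xi xa); rewrite ltnNge ai.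
  + by case/eqP: lk; apply: val_inj.
- move=> i /suppZ; rewrite sum_mkseq => /supp_sum[k _ gi].
  by exists k => //; have [_ + _] := gP k (ltn_ord k); apply.
Qed.

Variable y : nat -> c00 R.
Hypothesis yb : block_sequence y.
Hypothesis y1 : forall k, nu (y k) = 1.

Lemma block_nonempty k : exists i, supp (y k) i.
Proof.
have [yk _] := yb k; have [i yi _] := supp_max yk.
by exists i.
Qed.

Lemma block_before k l : (k < l)%N -> before (y k) (y l).
Proof.
elim: l => // l IH; rewrite ltnS leq_eqVlt => /predU1P[->|/IH kl]; first by have [] := yb l.
move=> a b ya yb'; have [c yc] := block_nonempty l.
by apply: ltn_trans (kl _ _ ya yc) _; have [_] := yb l; apply.
Qed.

Lemma block_supp k i : supp (y k) i -> (k < i)%N.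
Proof.
elim: k i => [|k IH] i; first exact: supp_pos.
move=> yi; have [c yc] := block_nonempty k.
by apply: leq_ltn_trans (IH _ yc) _; have [_] := yb k; apply.
Qed.

Definition tail (N : nat) x := exists b (c : nat -> R), x = \sum_(N <= k < b) c k *: y k.

Lemma tail_supp N x i : tail N x -> supp x i -> (N < i)%N.
Proof.
case=> b [c ->]; rewrite big_nat => /supp_sum[k /andP[Nk _] /suppZ/block_supp].
exact: leq_ltn_trans.
Qed.

Lemma tailZ N a x : tail N x -> tail N (a *: x).
Proof.
case=> b [c ->]; exists b, (fun k => a * c k).
by rewrite scaler_sumr; apply: eq_bigr => k _; rewrite scalerA.
Qed.

Lemma tail_extend N b b' c : (N <= b)%N -> (b <= b')%N -> exists c' : nat -> R,
  \sum_(N <= k < b) c k *: y k = \sum_(N <= k < b') c' k *: y k.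
Proof.
move=> Nb bb; exists (fun k => if (k < b)%N then c k else 0).
rewrite [RHS](@big_cat_nat _ _ _ b)//= [X in _ + X]big_nat [X in _ + X]big1 ?addr0; last first.
  by move=> k /andP[bk _]; rewrite ltnNge bk scale0r.
by apply: eq_big_nat => k /andP[_ ->].
Qed.

Lemma tailD N x z : tail N x -> tail N z -> tail N (x + z).
Proof.
have norm b c : exists b' c', (N <= b')%N /\
    \sum_(N <= k < b) c k *: y k = \sum_(N <= k < b') c' k *: y k.
  have [Nb|bN] := leqP N b; first by exists b, c.
  by exists N, c; rewrite leqnn !big_geq// ltnW.
case=> b1 [c1 ->] [b2 [c2 ->]].
have [b1' [c1' [h1 ->]]] := norm b1 c1; have [b2' [c2' [h2 ->]]] := norm b2 c2.
have [d1 ->] := tail_extend c1' h1 (leq_maxl b1' b2').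
have [d2 ->] := tail_extend c2' h2 (leq_maxr b1' b2').
exists (maxn b1' b2'), (fun k => d1 k + d2 k).
by rewrite -big_split; apply: eq_bigr => k _; rewrite scalerDl.
Qed.

Lemma tail0 N : tail N 0.
Proof. by exists N, (fun=> 0); rewrite big_geq. Qed.

Lemma tail_sum N I (t : seq I) (P : pred I) (F : I -> c00 R) :
  (forall i, P i -> tail N (F i)) -> tail N (\sum_(i <- t | P i) F i).
Proof. by move=> h; elim/big_ind: _ => //; [exact: tail0|exact: tailD]. Qed.

Lemma tail_block N k : (N <= k)%N -> tail N (y k).
Proof.
move=> Nk; exists k.+1, (fun l => (l == k)%:R).
rewrite big_nat_recr//= eqxx scale1r big_nat big1 ?add0r// => l /andP[_ lk].
by rewrite (ltn_eqF lk) scale0r.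
Qed.

Lemma tail_le N N' x : (N <= N')%N -> tail N' x -> tail N x.
Proof.
move=> NN [b [c ->]]; rewrite big_nat; apply: tail_sum => k /andP[k1 _].
by apply/tailZ/tail_block/(leq_trans NN).
Qed.

(** ** Averages that look like the unit vector basis of l_1 *)

(** The average of k vectors behaves as in l_1 under functionals with few terms
    compared with k: each of the at most n_q terms sees, up to one vector, its
    own share of the k vectors. *)
Lemma average_small_weight q k j (v : nat -> c00 R) f : (1 < q <= j)%N -> k = (4 * n j)%N ->
  (forall a b, (a < b < k)%N -> before (v a) (v b)) ->
  (forall b, (b < k)%N -> nu (v b) <= 1) -> Kw q f ->
  `|pairing f (k%:R^-1 *: blocks_sum k v)| <= 2 / (m q)%:R.
Proof.
move=> /andP[q1 qj] kE vb v1 fq.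
have q0 : (0 < q)%N by exact: ltnW.
have k0 : (0 < k)%N by rewrite kE muln_gt0 (n_gt0 Hp) ?(leq_trans _ qj).
have mq : 0 < (m q)%:R :> R by rewrite ltr0n (m_gt0 Hp).
have vC a g : (a < k)%N -> K g -> `|pairing g (v a)| <= 1.
  by move=> /v1 av Kg; apply: le_trans av; exact: (K_abs_le_nu Hp Hs).
have base g : K g -> controlled k v 1 2 1 g.
  move=> Kg a b ab gab.
  apply: le_trans (block_count (k0 := k) ler01 vb vC ler01 ab gab Kg _) _.
    by move=> l lk _; apply: vC.
  by rewrite !mul1r mulr1.
have h := controlled_total ler01 (divr_ge0 ler01 (ltW mq))
  (weight_step Hp Hs ler01 (ler0n _ 2) ler01 q1 base fq).
rewrite pairingZr normrM ger0_norm ?invr_ge0//.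
have kR : 0 < k%:R :> R by rewrite ltr0n.
rewrite mulrC ler_pdivrMr//; apply: le_trans h _.
rewrite !mul1r -mulrDl mulrAC ler_wpM2r ?invr_ge0 ?(ltW mq)//.
have : (n q)%:R <= (n j)%:R :> R by rewrite ler_nat (n_le Hp).
have := ler0n R (n j); rewrite kE natrM; lra.
Qed.

(** If all averages of k blocks of vectors of norm at most 1 had norm at most
    1/2, then averaging again and again would give averages of [n (2 * t)]
    terms of the block sequence that are smaller than the functionals of
    weight [m (2 * t)] permit. *)
Lemma l1_average t N : (0 < t)%N -> exists x, [/\ tail N x, nu x <= 1, 1 / 2 < nu x &
  forall q f, (1 < q < 2 * t)%N -> Kw q f -> `|pairing f x| <= 2 / (m q)%:R].
Proof.
move=> t0; pose j := (2 * t).-1; pose k := (4 * n j)%N.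
have j0 : (0 < j)%N by rewrite /j; case: t t0 {j k} => // t _; rewrite mulnS.
have jt : j.+1 = (2 * t)%N by rewrite prednK// muln_gt0.
have k0 : (0 < k)%N by rewrite muln_gt0 (n_gt0 Hp).
have kR : 0 < k%:R :> R by rewrite ltr0n.
(* the e-fold iterated averages, renormalized by 2 at each step *)
pose u e i : c00 R := (2 / k%:R) ^+ e *: \sum_(a < k ^ e) y (N + (i * k ^ e + a)).
have uS e i : u e.+1 i = (2 / k%:R) *: \sum_(b < k) u e (i * k + b)%N.
  rewrite /u exprS -scalerA -scaler_sumr; congr (_ *: (_ *: _)).
  rewrite expnS -(sum_regroup (fun a => y (N + (i * (k * k ^ e) + a)))).
  apply: eq_bigr => b _; apply: eq_bigr => a _; congr (y _).
  by rewrite mulnDl -mulnA !addnA.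
have ub e a b : (a < b)%N -> before (u e a) (u e b).
  move=> ab i i' /suppZ/supp_sum[c _ ci] /suppZ/supp_sum[d _ di].
  apply: (block_before _ ci di).
  rewrite ltn_add2l (@leq_trans (a.+1 * k ^ e)%N)//.
    by rewrite mulSn addnC ltn_add2r.
  by rewrite (leq_trans _ (leq_addr _ _))// leq_mul2r ab orbT.
have ut e i : tail N (u e i) by apply/tailZ/tail_sum => a _; apply/tail_block/leq_addr.
have u0 i : nu (u 0%N i) <= 1.
  by rewrite /u expr0 scale1r expn0 big_ord_recl big_ord0 addr0 y1.
have [[e [ue [i ui]]]|all1] := pselect (exists e, (forall i, nu (u e i) <= 1) /\
    exists i, 1 < nu (u e.+1 i)).
  pose v b := u e (i * k + b)%N.
  have vb a b : (a < b < k)%N -> before (v a) (v b).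
    by move=> /andP[ab _]; apply: ub; rewrite ltn_add2l.
  exists (k%:R^-1 *: blocks_sum k v); split.
  - by apply/tailZ/tail_sum => b _; apply: ut.
  - apply: nu_le => f Kf; rewrite pairingZr mulrC ler_pdivrMr// mul1r.
    rewrite /blocks_sum pairing_sumr -[leRHS]mulr1 mulr_natl.
    rewrite -[k in _ *+ k]card_ord -sumr_const; apply: ler_sum => b _.
    by apply: le_trans (ue (i * k + b)%N); exact: (K_le_nu Hp Hs).
  - have : nu (u e.+1 i) <= 2 * nu (k%:R^-1 *: blocks_sum k v).
      rewrite -[X in X * nu _]ger0_norm//; apply: le_trans (nuZ_le Hp Hs _ _).
      by rewrite scalerA uS.
    by move=> h; lra.
  - move=> q f /andP[q1 qt] fq.
    apply: (@average_small_weight q k j) => //; first by rewrite q1 -ltnS jt.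
    by move=> b _; apply: ue.
have {}all1 e i : nu (u e i) <= 1.
  elim: e i => // e IH i; rewrite leNgt; apply/negP => ui.
  by apply: all1; exists e; split=> //; exists i.
have nE : n (2 * t) = (k ^ s j)%N.
  by case: Hp => _ _ _ nS _; rewrite -jt nS.
have t1 : (1 < 2 * t)%N by rewrite -jt ltnS.
have nt : (0 < n (2 * t) <= n (2 * t))%N by rewrite leqnn (n_gt0 Hp)// ltnW.
have ot : ~~ odd (2 * t) by rewrite mul2n odd_double.
have [|||f [fw fy _]] :=
    @even_functional (2 * t)%N (n (2 * t)) (fun a => y (N + a)) (1 / 2) t1 ot nt.
- by lra.
- by move=> a b /andP[ab _]; apply: block_before; rewrite ltn_add2l.
- by move=> a _; rewrite y1; lra.
have := le_trans (K_le_nu Hp Hs (u (s j) 0%N) (Kw_K fw)) (all1 (s j) 0%N).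
rewrite /u pairingZr mul0n -nE => h.
exfalso; move: h; apply/negP; rewrite -ltNge.
set W : R := (m (2 * t))%:R in fy *.
have W32 : 32 <= W by rewrite ler_nat (m_ge32 Hp).
have two : W ^+ 3 <= 2 ^+ s j by rewrite /W -!natrX ler_nat -jt (s_large Hp).
apply: lt_le_trans (_ : (2 / k%:R) ^+ s j * ((n (2 * t))%:R * (1 / 2) / W) <= _); last first.
  by apply: ler_wpM2l; [rewrite exprn_ge0// divr_ge0|exact: fy].
rewrite nE natrX expr_div_n mulrA mulrA divfK ?expf_neq0 ?gt_eqF//.
rewrite ltr_pdivlMr ?mul1r; last by lra.
have W2 : 1024 <= W ^+ 2 by rewrite expr2; nra.
have : 1024 * W <= W ^+ 3 by rewrite exprSr ler_wpM2r//; lra.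
lra.
Qed.

(** ** Exact pairs *)

Lemma seq_bound (A : eqType) (F : A -> nat) (t : seq A) :
  exists N, forall a, a \in t -> (F a <= N)%N.
Proof. by exists (\max_(a <- t) F a) => a ta; apply: leq_bigmax_seq. Qed.

Lemma tail_beyond x : exists N, forall N' z, (N <= N')%N -> tail N' z -> before x z.
Proof.
have [N xN] := supp_bound x; exists N => N' z NN tz a b /xN aN /(tail_supp tz) bN.
by apply: leq_trans aN (leq_trans NN (ltnW bN)).
Qed.

Lemma m_unbounded (a : R) : exists t, (0 < t)%N /\ a <= (m (2 * t))%:R.
Proof.
exists (Num.truncn a).+1; split=> //.
apply: le_trans (ltW (truncnS_gt a)) _; rewrite ler_nat.
apply: leq_trans (ltnW (m_gt_id Hp _)); first by rewrite leq_pmull.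
by rewrite muln_gt0.
Qed.

(** The vectors are l_1-averages good for all weights below m_(j_k), where the
    j_k increase so fast that the l_1 norm of a vector is negligible compared
    with the next m_(j_k). A functional of weight m_q is then controlled by the
    averaging property on the vectors with q < j_k, and by its small
    coordinates on all others except the last one with j_k <= q. *)
Lemma ris_sequence (N : nat) (eps : R) : 0 < eps -> exists x : nat -> c00 R,
  [/\ forall k, tail N (x k), forall k, 1 / 2 < nu (x k) <= 1,
      forall k l, (k < l)%N -> before (x k) (x l) &
      forall L q f, (1 < q)%N -> Kw q f -> exists k0, forall k, (k < L)%N -> k != k0 ->
        `|pairing f (x k)| <= 2 * ((m q)%:R^-1 + eps)].
Proof.
move=> eps0.
pose Q (L : seq (c00 R * nat)) (a : c00 R * nat) := [/\ tail N a.1, 1 / 2 < nu a.1 <= 1,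
  forall q f, (1 < q < a.2)%N -> Kw q f -> `|pairing f a.1| <= 2 / (m q)%:R,
  (0 < a.2)%N &
  forall b, b \in L -> before b.1 a.1 /\ norm1 b.1 <= eps * (m a.2)%:R].
have next L : True -> exists a, Q L a /\ True.
  move=> _.
  have [N1 N1P] : exists N1, forall b, b \in L ->
      forall N' z, (N1 <= N')%N -> tail N' z -> before b.1 z.
    have /choice[F FP] : forall b : c00 R * nat, exists N,
        forall N' z, (N <= N')%N -> tail N' z -> before b.1 z.
      by move=> b; apply: tail_beyond.
    have [N1 h] := seq_bound F L; exists N1 => b bL N' z NN; apply: FP.
    exact: leq_trans (h _ bL) NN.
  have [t0 t0P] := seq_bound (fun b : c00 R * nat => (Num.truncn (norm1 b.1 / eps)).+1) L.
  have [t [t1 tP]] := m_unbounded t0%:R.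
  have [x [xt x1 x2 xw]] := l1_average (maxn N N1) t1.
  exists (x, (2 * t)%N); split=> //; split=> //=.
  - exact: tail_le (leq_maxl _ _) xt.
  - by rewrite x2.
  - by rewrite muln_gt0.
  - move=> b bL; split; first exact: N1P bL _ _ (leq_maxr _ _) xt.
    rewrite mulrC -ler_pdivrMr//; apply: le_trans tP; apply: le_trans (ltW (truncnS_gt _)) _.
    by rewrite ler_nat t0P.
have [xi xiP] := @history_choice _ (fun=> True) Q I next.
have prev k l : (k < l)%N -> xi k \in mkseq xi l.
  by move=> kl; apply/mapP; exists k; rewrite ?mem_iota.
exists (fun k => (xi k).1); split.
- by move=> k; have [_ []] := xiP k.
- by move=> k; have [_ []] := xiP k.
- by move=> k l kl; have [_ [_ _ _ _ /(_ _ (prev k l kl))[]]] := xiP l.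
- move=> L q f q1 fq.
  have xq k : (1 < q < (xi k).2)%N -> `|pairing f (xi k).1| <= 2 * ((m q)%:R^-1 + eps).
    have [_ [_ _ h _ _]] := xiP k => /h/(_ fq) {}h; apply: le_trans h _.
    by rewrite ler_wpM2l// lerDl ltW.
  have [[k1 [k1L k1q]]|h] := pselect (exists k, (k < L)%N /\ ((xi k).2 <= q)%N); last first.
    exists 0%N => k kL _; apply: xq; rewrite q1 ltnNge; apply/negP => kq.
    by apply: h; exists k.
  have ex : exists k, (k < L)%N && ((xi k).2 <= q)%N by exists k1; rewrite k1L.
  have ub k : (k < L)%N && ((xi k).2 <= q)%N -> (k <= L)%N by case/andP => /ltnW.
  case: (ex_maxnP ex ub) => k0 /andP[k0L k0q] k0max.
  exists k0 => k kL; rewrite neq_ltn => /orP[kk0|kk0].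
    have [_ [_ _ _ j0 /(_ _ (prev k k0 kk0))[_ h]]] := xiP k0.
    have q0 : 0 < (m q)%:R :> R by rewrite ltr0n (m_gt0 Hp)// ltnW.
    apply: le_trans (pairing_norm1 _ (fun i => Kw_coord Hp Hs i q1 fq)) _.
    rewrite mulrC ler_pdivrMr//; apply: le_trans h _.
    have : eps * (m (xi k0).2)%:R <= eps * (m q)%:R.
      by apply: ler_wpM2l; [exact: ltW|rewrite ler_nat (m_le Hp)].
    move=> h'; apply: le_trans h' _; apply: ler_wpM2r; first exact: ltW.
    by have : 0 < (m q)%:R^-1 :> R by [rewrite invr_gt0]; lra.
  apply: xq; rewrite q1 ltnNge; apply/negP => kq.
  by have := k0max k; rewrite kL kq => /(_ isT); rewrite leqNgt kk0.
Qed.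

(** The vector is m_p / n_p times the sum of n_p terms of a rapidly increasing
    sequence, the functional the sum of norming functionals of these terms. *)
Lemma exact_pair p N : (1 < p)%N -> ~~ odd p -> exists v f,
  [/\ tail N v, Kw p f, forall i, supp f i -> (N < i)%N, tame p 6 v & 1 / 2 <= pairing f v].
Proof.
move=> p1 op.
have mp : 0 < (m p)%:R :> R by rewrite ltr0n (m_gt0 Hp)// ltnW.
have np0 : (0 < n p)%N by rewrite (n_gt0 Hp)// ltnW.
have np : 0 < (n p)%:R :> R by rewrite ltr0n.
have e0 : 0 < (m p)%:R ^- 3 :> R by rewrite invr_gt0 exprn_gt0.
have [x [xt xn xb xr]] := ris_sequence N e0.
have xb' i j : (i < j < n p)%N -> before (x i) (x j) by move=> /andP[ij _]; apply: xb.
have np2 : (0 < n p <= n p)%N by rewrite leqnn andbT.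
have [||f [fp fx fs]] := @even_functional p (n p) x (1 / 2) p1 op np2 _ xb' _.
- by lra.
- by move=> k _; have /andP[] := xn k.
exists (((m p)%:R / (n p)%:R) *: blocks_sum (n p) x), f; split=> //.
- by apply/tailZ/tail_sum => k _; apply: xt.
- move=> i /fs[k _ [a [b [xa _ /andP[ai _]]]]].
  exact: leq_trans (tail_supp (xt k) xa) ai.
- have -> : 6 = 3 * 2 :> R by rewrite -natrM.
  apply: (tame_average Hp Hs p1) => //; last by move=> q f' q1 fq; apply: xr.
  move=> k f' _ Kf; have /andP[_ xk] := xn k.
  by have := K_abs_le_nu Hp Hs (x k) Kf; lra.
- rewrite pairingZr mulrAC ler_pdivlMr//.
  by move: fx; rewrite ler_pdivrMr// mulrC [_ * pairing _ _]mulrC.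
Qed.

Lemma rational_approx x (delta : R) : 0 < delta -> exists z,
  [/\ forall i, ratl (z i), supp z `<=` supp x & norm1 (z - x) <= delta].
Proof.
move=> d0; have [N xN] := supp_bound x.
have d1 : 0 < delta / N.+1%:R by rewrite divr_gt0.
set d := delta / N.+1%:R in d1.
have /choice[g gP] : forall i, exists q : rat, `|ratr q - x i| <= d.
  move=> i; have : x i - d < x i + d by lra.
  move=> /rat_in_itvoo[q]; rewrite in_itv /= => /andP[h1 h2]; exists q.
  by rewrite ler_distl !ltW.
pose z i := if x i == 0 then 0 else ratr (g i) : R.
have zP : z \in @c00_pred R.
  have /asboolP[x0 fx] := coordP x; apply/asboolP; split; first by rewrite /z x0 eqxx.
  by apply: sub_finite_set fx => i /=; rewrite /z; case: ifP; rewrite ?eqxx.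
have zs : supp (C00 zP) `<=` supp x.
  by move=> i; rewrite !suppE /= /z; case: ifP; rewrite ?eqxx.
exists (C00 zP); split=> //.
  by move=> i /=; rewrite /z; case: ifP => _; [exact: (ratl_nat R 0)|exists (g i)].
rewrite (@norm1E _ _ N).
  apply: le_trans (_ : \sum_(i < N) d <= _).
    apply: ler_sum => i _; rewrite coordD coordN /= /z.
    by case: eqP => [->|_]; [rewrite subr0 normr0 ltW|exact: gP].
  rewrite sumr_const card_ord -mulr_natl /d mulrCA ler_piMr ?ltW//.
  by rewrite ltr_pdivrMr// mul1r ltr_nat.
move=> i; rewrite suppE coordD coordN => h; apply: xN; apply: contrapT => xi.
by move: h; rewrite (suppN xi) (suppN (fun zi => xi (zs i zi))) subr0 eqxx.
Qed.

(** The candidate for an even member of a special sequence, multiplied by m_p.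
    The division by 8 brings its norm below 1, so that the condition on the
    values at the even members holds for all functionals of the required
    weight. Rounding to rational coordinates is harmless even for the estimates
    relative to the weight, since an error in the l_1 norm is divided by the
    weight of the functional. *)
Lemma even_member p N : (1 < p)%N -> ~~ odd p -> exists z f v,
  [/\ [/\ forall i, ratl (z i), nu z <= 1, tame p 2 z & forall i, supp z i -> (N < i)%N],
      [/\ Kw p f, forall i, supp f i -> (N < i)%N & 1 / 32 <= pairing f z] &
      tail 0 v /\ nu (z - v) <= (m p)%:R ^- 2].
Proof.
move=> p1 op.
have [v [f [vt fp fs [v1 v2 v3] fv]]] := exact_pair N p1 op.
set M : R := (m p)%:R in v3 *.
have M32 : 32 <= M by rewrite ler_nat (m_ge32 Hp).
have d0 : 0 < M ^- 2 by rewrite invr_gt0 exprn_gt0//; lra.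
have M2 : 32 <= M ^+ 2 by nra.
have d1 : M ^- 2 <= 1 / 32 by rewrite div1r lef_pV2 ?posrE; lra.
have [z [zr zs zn]] := rational_approx (8^-1 *: v) d0.
have zE (g : c00 R) : pairing g z = 8^-1 * pairing g v + pairing g (z - 8^-1 *: v).
  by rewrite pairingBr pairingZr addrCA subrr addr0.
have err (g : c00 R) (B : R) : (forall i, `|g i| <= B) ->
    `|pairing g (z - 8^-1 *: v)| <= B * M ^- 2.
  move=> gB; apply: le_trans (pairing_norm1 _ gB) _; rewrite ler_wpM2l//.
  by apply: le_trans (gB 0%N).
have errK (g : c00 R) : K g -> `|pairing g (z - 8^-1 *: v)| <= M ^- 2.
  by move=> Kg; rewrite -[leRHS]mul1r; apply: err => i; apply: (K_coord Hp Hs).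
have tri (g : c00 R) : `|pairing g z| <= 8^-1 * `|pairing g v| + `|pairing g (z - 8^-1 *: v)|.
  by rewrite zE; apply: le_trans (ler_normD _ _) _; rewrite normrM ger0_norm.
have z1 : nu z <= 1.
  apply: nu_le => g Kg; apply: le_trans (ler_norm _) _.
  by have := tri g; have := v1 g Kg; have := errK g Kg; lra.
exists z, f, (8^-1 *: v); split; split=> //.
- split.
  + by move=> g Kg; have := K_abs_le_nu Hp Hs z Kg; lra.
  + move=> q g qp gq.
    have q1 : (1 < q)%N by case/andP: qp.
    have mq : 0 < (m q)%:R^-1 :> R by rewrite invr_gt0 ltr0n (m_gt0 Hp)// ltnW.
    have := err g _ (fun i => Kw_coord Hp Hs i q1 gq) => h1.
    have h2 : (m q)%:R^-1 * M ^- 2 <= (m q)%:R^-1 by rewrite ler_piMr ?ltW//; lra.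
    have := tri g; have := v2 q g qp gq; lra.
  + move=> q g pq gq; have := tri g; have := v3 q g pq gq; have := errK g (Kw_K gq).
    lra.
- by move=> i /zs/suppZ; apply: tail_supp.
- have := errK f (Kw_K fp); rewrite ler_norml => /andP[h _].
  by rewrite zE; lra.
- by apply/tailZ; apply: tail_le vt.
- exact: le_trans (nu_le_norm1 Hp Hs _) zn.
Qed.

(** The odd members: the basis is a rapidly increasing sequence without any
    exceptional term, since the coordinates of a functional are bounded by the
    inverse of its weight. *)
Lemma odd_member (M : set nat) p N : infinite_set M -> (1 < p)%N -> exists ls : seq nat,
  [/\ uniq ls, size ls = n p, forall l, l \in ls -> M l /\ (N < l)%N &
      tame p 3 (((m p)%:R / (n p)%:R) *: \sum_(l <- ls) e R l)].
Proof.
move=> Minf p1.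
have /choice[g gP] : forall k, exists l, M l /\ (k < l)%N.
  move=> k; apply: contrapT => h; apply: Minf.
  apply: (@sub_finite_set _ _ `I_k.+1); last exact: finite_II.
  move=> l Ml /=; rewrite ltnS leqNgt; apply/negP => kl.
  by apply: h; exists l.
pose a k := iter k.+1 g N.
have aS k : (a k < a k.+1)%N by rewrite /a [iter k.+2 _ _]iterS; have [] := gP (iter k.+1 g N).
have a_lt k l : (k < l)%N -> (a k < a l)%N.
  elim: l => // l IH; rewrite ltnS leq_eqVlt => /predU1P[->//|/IH h].
  exact: ltn_trans h (aS l).
have aM k : M (a k) by rewrite /a iterS; have [] := gP (iter k g N).
have aN k : (N < a k)%N.
  elim: k => [|k IH]; first by have [] := gP N.
  exact: ltn_trans IH (aS k).
have a_pos k : (0 < a k)%N by exact: leq_ltn_trans (aN k).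
have a_inj : injective a.
  move=> k l akl; case: (ltngtP k l) => // /a_lt; by rewrite akl ltnn.
exists (mkseq a (n p)); split.
- exact: mkseq_uniq.
- by rewrite size_mkseq.
- by move=> l /mapP[k _ ->].
- have -> : \sum_(l <- mkseq a (n p)) e R l = blocks_sum (n p) (fun k => e R (a k)).
    by rewrite /blocks_sum -(sum_mkseq (fun k => e R (a k))) !big_map.
  have -> : 3 = 3 * 1 :> R by rewrite mulr1.
  apply: (tame_average Hp Hs p1) => //.
  + by move=> i j /andP[ij _] b c /supp_e-> /supp_e->; apply: a_lt.
  + by move=> k f _ Kf; rewrite pairing_e (K_coord Hp Hs).
  + move=> q f q1 fq; exists 0%N => k _ _; rewrite mul1r pairing_e.
    apply: le_trans (Kw_coord Hp Hs _ q1 fq) _.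
    by rewrite lerDl invr_ge0 exprn_ge0.
Qed.

End BlockSubspace.

(** * Alternating sums along a special sequence *)

Section Alternating.
Variables (R : realType) (m n s : nat -> nat) (sigma : seq (c00 R * c00 R) -> nat).
Hypothesis Hp : ius_params m n s.
Hypothesis Hs : coding m sigma.
Local Notation K := (K_ius m n sigma).
Local Notation Kl := (K_level m n sigma).
Local Notation Kw := (Kw m n sigma).
Local Notation tame := (tame m n sigma).
Local Notation weight := (weight sigma).
Implicit Types (x z f g : c00 R) (phi psi : seq (c00 R * c00 R)).

Lemma average_pairing p x f : (0 < p)%N -> average_pair m n p x f ->
  pairing f x = (m p)%:R^-1.
Proof.
move=> p0 [ls [u ps sz -> ->]]; rewrite pairingZl pairingZr pairing_sumr big_seq.
under eq_bigr => l lls do rewrite pairing_e sum_e_coord// lls.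
rewrite -big_seq -[true%:R]/(1 : R) big_const_seq count_predT iter_addr_0 sz.
by rewrite mulVf ?mulr1// pnatr_eq0 -lt0n (n_gt0 Hp).
Qed.

Lemma average_supp_large p x f : (0 < p)%N -> average_pair m n p x f ->
  exists2 r, supp x r & (n p <= r)%N.
Proof.
move=> p0 [ls [u ps sz -> _]].
have np : (0 < n p)%N by rewrite (n_gt0 Hp).
have [r rls nr] : exists2 r, r \in ls & (n p <= r)%N.
  apply: contrapT => h.
  have sub : {subset ls <= iota 1 (n p).-1}.
    move=> l ll; rewrite mem_iota (allP ps _ ll) /= add1n prednK//.
    by rewrite ltnNge; apply/negP => nl; apply: h; exists l.
  by have := uniq_leq_size u sub; rewrite size_iota sz -ltnS prednK// ltnn.
exists r => //; rewrite suppE coordZ sum_e_coord// rls mulr1 invr_eq0 pnatr_eq0.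
by rewrite -lt0n.
Qed.

(** The first weight is not a value of sigma. It is smaller than the second one
    because the n_(p0) coordinates of x_1 reach at least up to n_(p0), and sigma
    is bounded below by the ranges of its arguments. *)
Lemma weight_step_lt k psi p0 j : special m n sigma k psi ->
  (1 < p0)%N && ~~ odd p0 -> average_pair m n p0 (x_ psi 1) (f_ psi 1) ->
  (j.+1 < 2 * k)%N -> (weight p0 psi j < weight p0 psi j.+1)%N.
Proof.
move=> sp /andP[p1 op] av jk; have [[Q sz] _ _ _] := sp.
have pos : (0 < p0)%N by exact: ltnW.
have jsz : (j.+1 <= size psi)%N by rewrite sz ltnW.
have szj : size (take j.+1 psi) = j.+1 by rewrite size_takel.
have Qj : in_Qs (take j.+1 psi) by exact: in_Qs_take.
have [h1 _ h3 h4] := Hs.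
case: j => [|j] in jk jsz szj Qj *; last first.
  by have := h3 _ Qj; rewrite szj /= take_takel//; apply.
have [r xr nr] := average_supp_large pos av.
have r1 : ranges (take 1 psi) (size (take 1 psi)) r.
  left; apply: supp_range; rewrite szj.
  by move: xr; rewrite /x_ /= nth_take.
have := h4 _ Qj _ r1.
rewrite -[leLHS]ger0_norm// -sqrtr_sqr ler_sqrt ?ler0n// -natrX ler_nat => rm.
have /andP[w1 _] := sigma_even Hs Qj.
rewrite /weight /=; apply: (m_lt_inv Hp) => //; first exact: ltnW.
apply: leq_trans rm; apply: leq_trans (_ : n p0 < r ^ 2)%N.
  rewrite ltnS; apply: leq_trans (m_exp6_le_n Hp p1).
  by rewrite -{1}[m p0]expn1 leq_exp2l ?(m_gt1 Hp).
apply: (leq_ltn_trans nr); rewrite -{1}[r]expn1 ltn_exp2l//.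
apply: (leq_trans _ nr); apply: leq_trans (m_exp6_le_n Hp p1).
by rewrite (@leq_trans (m p0)) ?(m_gt1 Hp)// -{1}[m p0]expn1 leq_exp2l ?(m_gt1 Hp).
Qed.

Lemma weight_lt k psi p0 i j : special m n sigma k psi ->
  (1 < p0)%N && ~~ odd p0 -> average_pair m n p0 (x_ psi 1) (f_ psi 1) ->
  (i < j < 2 * k)%N -> (weight p0 psi i < weight p0 psi j)%N.
Proof.
move=> sp p0P av; elim: j => // j IH; rewrite ltnS leq_eqVlt => /andP[/predU1P[->|ij] jk].
  exact: weight_step_lt sp p0P av jk.
apply: ltn_trans (weight_step_lt sp p0P av jk).
by apply: IH; rewrite ij ltnW.
Qed.

Lemma weight_inj k psi p0 i j : special m n sigma k psi ->
  (1 < p0)%N && ~~ odd p0 -> average_pair m n p0 (x_ psi 1) (f_ psi 1) ->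
  (i < 2 * k)%N -> (j < 2 * k)%N -> weight p0 psi i = weight p0 psi j -> i = j.
Proof.
move=> sp p0P av ik jk wE; case: (ltngtP i j) => // ij.
- by have := @weight_lt k psi p0 i j sp p0P av; rewrite ij jk wE ltnn => /(_ isT).
- by have := @weight_lt k psi p0 j i sp p0P av; rewrite ij ik wE ltnn => /(_ isT).
Qed.

(** The condition on the first weight of a special sequence; it makes sums over
    all pairs of members of the two sequences negligible. *)
Lemma m_weight_ge k psi p0 j : special m n sigma k psi ->
  (1 < p0)%N && ~~ odd p0 -> average_pair m n p0 (x_ psi 1) (f_ psi 1) ->
  (2 * k)%:R < Num.sqrt (m p0)%:R :> R -> (j < 2 * k)%N ->
  (2 * k)%:R ^+ 2 <= (m (weight p0 psi j))%:R :> R.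
Proof.
move=> sp p0P av km jk; have /andP[p1 _] := p0P.
have h : (2 * k)%:R ^+ 2 <= (m p0)%:R :> R.
  rewrite -[leRHS]sqr_sqrtr ?ler0n//; apply: ler_pM => //; exact: ltW.
apply: le_trans h _; rewrite ler_nat; apply: (m_le Hp); first exact: ltnW.
case: j jk => // j jk; apply: ltnW.
by apply: (@weight_lt k psi p0 0 j.+1).
Qed.

Lemma sum_indicator_le1 (P : pred nat) N :
  (forall i j, (i < N)%N -> (j < N)%N -> P i -> P j -> i = j) ->
  \sum_(i < N) (P i)%:R <= 1 :> R.
Proof.
move=> PU; have [[i [iN Pi]]|h] := pselect (exists i, (i < N)%N /\ P i); last first.
  rewrite big1// => i _; have [Pi|//] := boolP (P i).
  by case: h; exists i.
rewrite (bigD1 (Ordinal iN))//= Pi big1 ?addr0// => j ji.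
have [Pj|//] := boolP (P j); case/eqP: ji; apply: val_inj => /=.
exact: PU.
Qed.

(** Only the first and the last set that E meets can be cut by E: any other set
    that it meets lies between points of E. *)
Lemma interval_cuts (S : nat -> set nat) E k : nat_interval E ->
  (forall i j, (i < j < k)%N -> set_before (S i) (S j)) ->
  exists i0 i1, forall i, (i < k)%N -> i != i0 -> i != i1 ->
    S i `<=` E \/ forall t, S i t -> ~ E t.
Proof.
move=> Ei Sb; pose P i : bool := `[< (i < k)%N /\ exists2 t, S i t & E t >].
have [[i Pi]|h] := pselect (exists i, P i); last first.
  exists 0%N, 0%N => i ik _ _; right => t St Et; apply: h; exists i.
  by apply/asboolP; split=> //; exists t.
have ex : exists i, P i by exists i.
have ub j : P j -> (j <= k)%N by move=> /asboolP[/ltnW].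
case: (ex_minnP ex) => i0 P0 min0; case: (ex_maxnP ex ub) => i1 P1 max1.
exists i0, i1 => j jk ji0 ji1.
have [Pj|Pj] := boolP (P j); last first.
  right => t St Et; move/negP: Pj; apply; apply/asboolP; split=> //.
  by exists t.
left => t St.
have lt0 : (i0 < j)%N by rewrite ltn_neqAle eq_sym ji0 min0.
have lt1 : (j < i1)%N by rewrite ltn_neqAle ji1 max1.
move/asboolP: P0 => [_ [a Sa Ea]]; move/asboolP: P1 => [i1k [b Sb' Eb]].
apply: Ei Ea Eb _; apply/andP; split; apply: ltnW.
  by apply: (Sb i0 j) => //; rewrite lt0 jk.
by apply: (Sb j i1) => //; rewrite lt1 i1k.
Qed.

Lemma le_add_ge0 (x y a b c : R) : x <= y -> 0 <= a -> 0 <= b -> 0 <= c ->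
  x <= y + (a + b + c).
Proof. by lra. Qed.

Lemma le_indicators (b1 b2 b3 : bool) (B x y : R) : 0 <= B -> 0 <= y -> x <= B ->
  [|| b1, b2 | b3] -> x <= y + (B * b1%:R + B * b2%:R + B * b3%:R).
Proof.
move=> B0 y0 xB b123; apply: le_trans xB _.
have bn (b : bool) : 0 <= B * b%:R by rewrite mulr_ge0.
have := bn b1; have := bn b2; have := bn b3.
by case/or3P: b123 => ->; rewrite mulr1; lra.
Qed.

Definition pair_ranges psi i : set nat := ranges psi (2 * i).+1 `|` ranges psi (2 * i).+2.

Lemma pair_ranges_before psi k i j : in_Qs psi -> size psi = (2 * k)%N ->
  (i < j < k)%N -> set_before (pair_ranges psi i) (pair_ranges psi j).
Proof.
move=> Q sz ijk t u [ti|ti] [uj|uj];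
by apply: (ranges_before Q _ _ _ ti uj); rewrite ?sz; lia.
Qed.

Lemma double_lt i k : (i < k)%N -> (2 * i < 2 * k)%N /\ ((2 * i).+1 < 2 * k)%N.
Proof. by lia. Qed.

Lemma double_neq_succ i j : (2 * i)%N != (2 * j).+1.
Proof. by lia. Qed.

Lemma succ_double_inj i j c : (2 * i).+1 = c -> (2 * j).+1 = c -> i = j.
Proof. by lia. Qed.

Lemma le_double_sqr k : (k <= (2 * k) ^ 2)%N.
Proof. by rewrite expnS expn1; nia. Qed.

Variables (q k : nat) (phi : seq (c00 R * c00 R)) (p0 : nat) (C : R).
Hypothesis q2 : (2 < q)%N.
Hypothesis oq : odd q.
Hypothesis kE : k = (n q)./2.
Hypothesis sp : special m n sigma k phi.
Hypothesis p0P : (1 < p0)%N && ~~ odd p0.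
Hypothesis p0k : (2 * k)%:R < Num.sqrt (m p0)%:R :> R.
Hypothesis av : forall i, (i < k)%N -> average_pair m n (weight p0 phi (2 * i))
        (x_ phi (2 * i).+1) (f_ phi (2 * i).+1).
Hypothesis C1 : 1 <= C.

(** The members of [phi] normalized by their weights, hence of norm of order 1. *)
Definition member j : c00 R := (m (weight p0 phi j))%:R *: x_ phi j.+1.
Definition alternating j : c00 R := (-1) ^+ j *: member j.

Hypothesis members_tame : forall j, (j < 2 * k)%N -> tame (weight p0 phi j) C (member j).

Lemma alternating_supp j : supp (alternating j) `<=` ranges phi j.+1.
Proof. by move=> i /suppZ/suppZ xi; left; apply: supp_range. Qed.

Lemma pairing_alternating f j : `|pairing f (alternating j)| = `|pairing f (member j)|.
Proof. by rewrite pairingZr normrM normrX normrN1 expr1n mul1r. Qed.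

Lemma alternating_le f j : (j < 2 * k)%N -> Kball m n sigma f -> `|pairing f (alternating j)| <= C.
Proof.
move=> jk [c [g [c1 Kg ->]]]; rewrite pairing_alternating pairingZl normrM.
have [h _ _] := members_tame jk; apply: le_trans (h g Kg).
by rewrite ler_piMl.
Qed.

(** A functional of weight [m q] comes from a special sequence
    [psi] sharing a prefix of length c with [phi]. On this prefix the
    alternating signs make the terms of the functional cancel in pairs, except
    where the interval E cuts a pair; after it, the weights occurring in [psi]
    are different from those occurring in [phi], with few exceptions. *)
Lemma odd_weight_alternating f : Kw q f ->
  `|pairing f (blocks_sum (2 * k) alternating)| <= 10 * C.
Proof.
case=> l; elim: l => [|l IH]; first by move=> /Kl_base[qE]; have := q2; rewrite qE.
move=> fl; have Kf : K f by exists l.+1 => //; exists q.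
move: fl => /Kl_cases[[qE]|//|[_ /negP]|[_ _ [psi ph]]].
- by have := q2; rewrite qE.
- by [].
have [sp' _ _] := ph; rewrite -kE in sp'.
have [p0' [p0P' p0k' av']] := special_average sp'.
have av2 := av'; rewrite kE in av2.
have [eps [E [h [lam []]]]] := K_odd_terms Hp Hs ph av2.
rewrite -kE => -[e1 Ei fE] hs hP hpair.
have [[Q sz] _ _ _] := sp; have [[Q' sz'] _ _ _] := sp'.
have C_ge1 := C1; have C0 : 0 <= C by exact: le_trans ler01 C1.
have q0 : (0 < q)%N by exact: leq_trans q2.
have n4 := n_dvd4 Hp q0.
have nE : n q = (2 * k)%N.
  rewrite kE mul2n -[LHS]odd_double_half.
  by move: n4 => /dvdnP[a ->]; rewrite oddM andbF.
have np : (0 < n q)%N by rewrite (n_gt0 Hp).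
have k0 : (0 < k)%N by move: np; rewrite nE muln_gt0.
have NR : 1 <= (2 * k)%:R :> R by rewrite ler1n -nE.
set N : R := (2 * k)%:R in NR.
have N0 : 0 < N by lra.
have mq1 : `|eps / (m q)%:R| <= 1.
  have w0 : 0 < (m q)%:R :> R by rewrite ltr0n (m_gt0 Hp).
  rewrite normrM normfV normr_nat ler_pdivrMr// mul1r (le_trans e1)//.
  by rewrite ler1n (m_gt0 Hp).
have hball j : (j < 2 * k)%N -> Kball m n sigma (restr E (h j)).
  move=> jk; have [c [g [c1 -> gP]]] := hP j jk.
  rewrite restrZ; apply/KballZ/Kball_restr => //.
  case: gP => [gl|]; first by apply: K_Kball; exists l => //; exists (weight p0' psi j).
  by have /andP[] := weight_even Hs j sp' p0P'; apply: flat_Kball.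
(* c is the length of the longest common initial segment of psi and phi *)
have ex : exists c, (c <= 2 * k)%N && (take c psi == take c phi) by exists 0%N; rewrite !take0 eqxx.
have ub c : (c <= 2 * k)%N && (take c psi == take c phi) -> (c <= 2 * k)%N by case/andP.
case: (ex_maxnP ex ub) => c /andP[ck /eqP cE] cmax.
have nthE j : (j < c)%N -> nth (0, 0) psi j = nth (0, 0) phi j.
  by move=> jc; rewrite -(nth_take _ jc) cE nth_take.
have rangesE j : (j < c)%N -> ranges psi j.+1 = ranges phi j.+1.
  by move=> jc; rewrite /ranges /x_ /f_ /= nthE.
have takeE j : (j <= c)%N -> take j psi = take j phi.
  by move=> jc; rewrite -(take_takel psi jc) cE take_takel.
have weightE j : (0 < j <= c)%N -> weight p0' psi j = weight p0 phi j.
  by case/andP; case: j => // j _ jc; rewrite /weight /= takeE.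
have h_supp j : (j < 2 * k)%N -> supp (restr E (h j)) `<=` ranges psi j.+1.
  by move=> jk i /supp_restr/(hs _ jk) fi; right; apply: supp_range.
have fpair x : pairing f x = eps / (m q)%:R * \sum_(j < 2 * k) pairing (restr E (h j)) x.
  by rewrite fE pairingZl restr_sum pairing_suml.
have disj i j : (i < 2 * k)%N -> (j < 2 * k)%N -> i != j -> (i < c)%N || (j < c)%N ->
    pairing (restr E (h i)) (alternating j) = 0.
  move=> ik jk ij ijc; apply: pairing_disjoint => t /(h_supp _ ik) ti /alternating_supp tj.
  have [jc|cj] := ltnP j c.
    rewrite -rangesE// in tj; move: ij; rewrite neq_ltn => /orP[ij|ij].
      have := @ranges_before _ psi i.+1 j.+1 Q' isT ij.
      by rewrite sz' => /(_ jk _ _ ti tj); rewrite ltnn.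
    have := @ranges_before _ psi j.+1 i.+1 Q' isT ij.
    by rewrite sz' => /(_ ik _ _ tj ti); rewrite ltnn.
  have ic : (i < c)%N by case/orP: ijc => //; rewrite ltnNge cj.
  rewrite rangesE// in ti.
  have := @ranges_before _ phi i.+1 j.+1 Q isT (leq_trans ic cj).
  by rewrite sz => /(_ jk _ _ ti tj); rewrite ltnn.
(* Up to c the members coincide, so the term number j of f meets only the
   vector number j; [a j] is its contribution. *)
pose a j := if (j < c)%N then pairing (restr E (h j)) (alternating j) else 0.
have f_prefix j : (j < c)%N -> pairing f (alternating j) = eps / (m q)%:R * a j.
  move=> jc; have jk : (j < 2 * k)%N by exact: leq_trans ck.
  rewrite fpair (bigD1 (Ordinal jk))//= big1 ?addr0 /a ?jc// => i ij.
  by apply: disj; rewrite ?jc ?orbT.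
have a_le j : (j < 2 * k)%N -> `|a j| <= C.
  by move=> jk; rewrite /a; case: ifP => _; [exact/alternating_le/hball|rewrite normr0].
pose S := pair_ranges phi.
have [|i0 [i1 cuts]] := @interval_cuts S E k Ei.
  by move=> i j; apply: pair_ranges_before.
have pair_le (i : 'I_k) : `|a (2 * i)%N + a (2 * i).+1| <=
    N ^- 2 + (2 * C * (i == i0 :> nat)%:R + 2 * C * (i == i1 :> nat)%:R + C * ((2 * i).+1 == c)%:R).
  have [ik1 ik2] := double_lt (ltn_ord i).
  have n2 : 0 <= N ^- 2 by rewrite invr_ge0 exprn_ge0// ltW.
  have t1 (b : bool) : 0 <= 2 * C * b%:R by rewrite mulr_ge0// mulr_ge0.
  have t2 (b : bool) : 0 <= C * b%:R by rewrite mulr_ge0.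
  have a1 := a_le _ ik1; have a2 := a_le _ ik2.
  have tri : `|a (2 * i)%N + a (2 * i).+1| <= 2 * C.
    by apply: le_trans (ler_normD _ _) _; rewrite mulr_natl mulr2n lerD.
  have [cut|cut] := boolP ((i == i0 :> nat) || (i == i1 :> nat)).
    rewrite addrA; apply: le_trans (_ : N ^- 2 + (2 * C * (i == i0 :> nat)%:R +
        2 * C * (i == i1 :> nat)%:R) <= _); last by rewrite lerDl.
    have := @le_indicators (i == i0 :> nat) (i == i1 :> nat) false _ _ _
      (mulr_ge0 (ler0n R 2) C0) n2 tri.
    by rewrite orbF -[false%:R]/(0 : R) mulr0 addr0; apply.
  move: cut; rewrite negb_or => /andP[ii0 ii1].
  case: (ltngtP (2 * i).+1 c) => ic.
  - have n1 : (2 * i < c)%N by exact: ltnW.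
    apply: le_add_ge0 => //.
    have [hE lamP] := hpair i (ltn_ord i).
    have fpsi : f_ psi (2 * i).+1 = f_ phi (2 * i).+1 by rewrite /f_ /= nthE.
    have xpsi : x_ psi (2 * i).+2 = x_ phi (2 * i).+2 by rewrite /x_ /= nthE.
    have [SE|SE] := cuts i (ltn_ord i) ii0 ii1; last first.
      have az j : (j < c)%N -> ranges phi j.+1 `<=` S i -> a j = 0.
        move=> jc jS; rewrite /a jc restr_disjoint ?pairing0l// => t.
        have jk : (j < 2 * k)%N by exact: leq_trans ck.
        move=> /(hs _ jk) ft; apply: SE; apply: jS; rewrite -rangesE//.
        by right; apply: supp_range.
      by rewrite !az ?addr0 ?normr0//; move=> t; [right|left].
    have az j : (j < c)%N -> ranges phi j.+1 `<=` S i -> a j = pairing (h j) (alternating j).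
      move=> jc jS; rewrite /a jc restr_id// => t.
      have jk : (j < 2 * k)%N by exact: leq_trans ck.
      move=> /(hs _ jk) ft; apply: SE; apply: jS; rewrite -rangesE//.
      by right; apply: supp_range.
    rewrite !az//; [|by move=> t; right|by move=> t; left].
    have w0 : (0 < weight p0 phi (2 * i))%N.
      by have /andP[/ltnW] := weight_even Hs (2 * i) sp p0P.
    have mw : (m (weight p0 phi (2 * i)))%:R != 0 :> R by rewrite pnatr_eq0 -lt0n (m_gt0 Hp).
    have -> : pairing (h (2 * i)%N) (alternating (2 * i)) = lam i.
      rewrite hE /alternating exprM sqrrN !expr1n scale1r fpsi pairingZl pairingZr.
      by rewrite (average_pairing w0 (av (ltn_ord i))) mulfV// mulr1.
    have -> : pairing (h (2 * i).+1) (alternating (2 * i).+1) = - pairing (h (2 * i).+1)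
        ((m (weight p0 phi (2 * i).+1))%:R *: x_ psi (2 * i).+2).
      by rewrite /alternating exprS exprM sqrrN !expr1n mulr1 scaleN1r pairingNr xpsi.
    have wE : weight p0' psi (2 * i).+1 = weight p0 phi (2 * i).+1.
      by apply: weightE; rewrite (ltnW ic).
    case: lamP => [->|[x0 lam2]]; first by rewrite wE subrr normr0.
    by rewrite pairingZr x0 mulr0 subr0 /N -nE.
  - have c1 : (c <= 2 * i)%N by [].
    by apply: le_add_ge0 => //; rewrite /a ltnNge c1 ltnNge (leqW c1) addr0 normr0.
  - have -> : a (2 * i).+1 = 0 by rewrite /a ic ltnn.
    rewrite addr0 addrA; apply: le_trans (_ : 0 + C * 1 <= _); first by rewrite add0r mulr1.
    by rewrite lerD2r !addr_ge0.
have uniq_eq (b : nat) M : \sum_(i < M) (i == b :> nat)%:R <= 1 :> R.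
  by apply: (@sum_indicator_le1 (fun i => i == b)) => i j _ _ /eqP-> /eqP->.
have prefix_le : `|\sum_(j < 2 * k) a j| <= 6 * C.
  rewrite sum_pairs; apply: le_trans (ler_norm_sum _ _ _) _.
  apply: le_trans (ler_sum _ (fun i _ => pair_le i)) _.
  rewrite !big_split /= -!mulr_sumr sumr_const card_ord.
  have := ler_wpM2l C0 (uniq_eq i0 k); have := ler_wpM2l C0 (uniq_eq i1 k).
  have h3 : \sum_(i < k) ((2 * i).+1 == c)%:R <= 1 :> R.
    apply: (@sum_indicator_le1 (fun i => (2 * i).+1 == c)) => i j _ _ /eqP h1 /eqP h2.
    exact: succ_double_inj h1 h2.
  have := ler_wpM2l C0 h3.
  have : N ^- 2 *+ k <= 1.
    rewrite -mulr_natr ler_pdivrMl ?exprn_gt0// mulr1.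
    by rewrite /N -natrX ler_nat le_double_sqr.
  by rewrite !mulr1 -!mulrA; lra.
(* After c, an equality of weights would be an equality of values of sigma at
   initial segments of different sequences. The exceptions are the first
   weights, which are not coded, and the weight number c, which is determined
   by the common segment. *)
pose bad j := [|| j == 0%N, j == c | weight p0 phi j == p0'].
have av0 : average_pair m n p0 (x_ phi 1) (f_ phi 1) by exact: (av k0).
have av0' : average_pair m n p0' (x_ psi 1) (f_ psi 1) by exact: (av' _ k0).
have good_ne i j : (j < 2 * k)%N -> (i < 2 * k)%N -> ~~ bad j -> (c <= j)%N ->
    weight p0' psi i != weight p0 phi j.
  move=> jk ik; rewrite !negb_or => /and3P[j0 jc jw] cj; apply/eqP => wE.
  case: i ik wE => [|i] ik wE; first by rewrite -wE eqxx in jw.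
  have j0' : (0 < j)%N by rewrite lt0n.
  move: wE; rewrite /weight (negPf j0) /=.
  have [_ inj _ _] := Hs => /inj wE.
  have tE : take i.+1 psi = take j phi by apply: wE; apply: in_Qs_take.
  have ij : i.+1 = j.
    have := congr1 size tE; rewrite !size_takel// ?sz ?sz' //; exact: ltnW.
  have : (j <= c)%N by apply: cmax; rewrite (ltnW jk) -ij tE -ij eqxx.
  by rewrite leq_eqVlt (negPf jc) ltnNge cj.
have tail_le (j : 'I_(2 * k)) : (c <= j)%N -> `|pairing f (alternating j)| <=
    C / N + (C * (j == 0%N :> nat)%:R + C * (j == c :> nat)%:R + C * (weight p0 phi j == p0')%:R).
  move=> cj.
  have CN : 0 <= C / N by rewrite divr_ge0// ltW.
  have t2 (b : bool) : 0 <= C * b%:R by rewrite mulr_ge0.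
  have [bj|bj] := boolP (bad j).
    by apply: le_indicators => //; exact: alternating_le (ltn_ord j) (K_Kball Kf).
  apply: le_add_ge0 => //.
  have term (i : 'I_(2 * k)) : `|pairing (restr E (h i)) (alternating j)| <= C * N ^- 2.
    have CN2 : 0 <= C * N ^- 2 by rewrite mulr_ge0// invr_ge0 exprn_ge0// ltW.
    have [d [g [d1 -> gP]]] := hP i (ltn_ord i).
    rewrite restrZ pairingZl normrM.
    apply: le_trans (_ : `|pairing (restr E g) (alternating j)| <= _).
      by rewrite ler_piMl.
    have /andP[w1 wev] := weight_even Hs i sp' p0P'.
    have : Kw (weight p0' psi i) (restr E g) \/ restr E g = 0.
      case: gP => [gl|/(flat_restr E)/(flat_Kl sigma w1 wev)[gl|]]; last by right.
        by apply: Kw_restr => //; exists l.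
      by left; exists 1%N.
    case=> [gw|->]; last by rewrite pairing0l normr0.
    have [_ lt gt] := members_tame (ltn_ord j).
    rewrite pairing_alternating.
    have N2 : 0 < N ^+ 2 by rewrite exprn_gt0.
    have := good_ne i j (ltn_ord j) (ltn_ord i) bj cj; rewrite neq_ltn => /orP[wlt|wgt].
      apply: le_trans (lt _ _ _ gw) _; first by rewrite w1 wlt.
      have mN := m_weight_ge sp' p0P' av0' p0k' (ltn_ord i).
      by rewrite ler_wpM2l// lef_pV2 ?posrE//; exact: lt_le_trans mN.
    apply: le_trans (gt _ _ wgt gw) _.
    have mN := m_weight_ge sp p0P av0 p0k (ltn_ord j).
    have m0 : 0 < (m (weight p0 phi j))%:R :> R by exact: lt_le_trans mN.
    rewrite ler_wpM2l// lef_pV2 ?posrE ?exprn_gt0//; apply: le_trans mN _.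
    by rewrite expr2 ler_peMr ?(ltW m0)// ler1n -(ltr0n R).
  rewrite fpair normrM.
  apply: le_trans (_ : `|\sum_(i < 2 * k) pairing (restr E (h i)) (alternating j)| <= _).
    by rewrite ler_piMl.
  apply: le_trans (ler_norm_sum _ _ _) _; apply: le_trans (ler_sum _ (fun i _ => term i)) _.
  rewrite sumr_const card_ord -mulr_natr -/N -mulrA ler_wpM2l//.
  by rewrite expr2 invfM -mulrA mulVf ?mulr1// gt_eqF.
rewrite /blocks_sum pairing_sumr.
have split_le (j : 'I_(2 * k)) : true -> `|pairing f (alternating j) - eps / (m q)%:R * a j| <=
    C / N + (C * (j == 0%N :> nat)%:R + C * (j == c :> nat)%:R + C * (weight p0 phi j == p0')%:R).
  move=> _; have [jc|cj] := ltnP j c.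
    rewrite f_prefix// subrr normr0 addr_ge0 ?divr_ge0// ?(ltW N0)//.
    by rewrite !addr_ge0// mulr_ge0.
  by rewrite {1}/a ltnNge cj mulr0 subr0; apply: tail_le.
have tail_sum : `|\sum_(j < 2 * k) (pairing f (alternating j) - eps / (m q)%:R * a j)| <= 4 * C.
  apply: le_trans (ler_norm_sum _ _ _) _; apply: le_trans (ler_sum _ split_le) _.
  rewrite !big_split /= -!mulr_sumr sumr_const card_ord.
  have h3 : \sum_(j < 2 * k) (weight p0 phi j == p0')%:R <= 1 :> R.
    apply: (@sum_indicator_le1 (fun j => weight p0 phi j == p0')) => i j ik jk /eqP h1 /eqP h2.
    by apply: (weight_inj sp p0P av0) => //; rewrite h1 h2.
  have := ler_wpM2l C0 h3; have := ler_wpM2l C0 (uniq_eq 0%N (2 * k)%N).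
  have := ler_wpM2l C0 (uniq_eq c (2 * k)%N).
  have -> : N^-1 *+ (2 * k) = 1 by rewrite -mulr_natr -/N mulVf// gt_eqF.
  by rewrite !mulr1; lra.
have -> : \sum_(j < 2 * k) pairing f (alternating j) =
    \sum_(j < 2 * k) (pairing f (alternating j) - eps / (m q)%:R * a j) +
    eps / (m q)%:R * \sum_(j < 2 * k) a j.
  by rewrite mulr_sumr -big_split /=; apply: eq_bigr => j _; rewrite subrK.
apply: le_trans (ler_normD _ _) _; rewrite [`|_ * _|]normrM.
have : `|eps / (m q)%:R| * `|\sum_(j < 2 * k) a j| <= 6 * C.
  by apply: le_trans prefix_le; rewrite ler_piMl.
lra.
Qed.

End Alternating.

(** * Dependent sequences *)

Section Dependent.
Variables (R : realType) (m n s : nat -> nat) (sigma : seq (c00 R * c00 R) -> nat).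
Hypothesis Hp : ius_params m n s.
Hypothesis Hs : coding m sigma.
Local Notation K := (K_ius m n sigma).
Local Notation Kl := (K_level m n sigma).
Local Notation Kw := (Kw m n sigma).
Local Notation nu := (norm_ius m n sigma).
Local Notation tame := (tame m n sigma).
Local Notation weight := (weight sigma).
Implicit Types (x z f g : c00 R) (phi psi L : seq (c00 R * c00 R)).

Lemma tame_le p (B B' : R) z : B <= B' -> tame p B z -> tame p B' z.
Proof.
move=> BB [h1 h2 h3]; split.
- by move=> f Kf; apply: le_trans BB; apply: h1.
- move=> q f qp fq; apply: le_trans (h2 q f qp fq) _.
  by rewrite ler_wpM2r// invr_ge0.
- move=> q f pq fq; apply: le_trans (h3 q f pq fq) _.
  by rewrite ler_wpM2r// invr_ge0 exprn_ge0.
Qed.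

Lemma in_Qs_rcons L (a : c00 R * c00 R) N : L = [::] \/ in_Qs L ->
  in_Q a.1 -> in_Q a.2 ->
  (forall i, (1 <= i <= size L)%N -> forall t, ranges L i t -> (t <= N)%N) ->
  (forall t, supp a.1 t \/ supp a.2 t -> (N < t)%N) -> in_Qs (rcons L a).
Proof.
move=> QL a1 a2 LN aN.
have old i : (0 < i <= size L)%N -> nth (0, 0) (rcons L a) i.-1 = nth (0, 0) L i.-1.
  by move=> /andP[i0 iL]; rewrite nth_rcons prednK// iL.
have new : nth (0, 0) (rcons L a) (size L) = a by rewrite nth_rcons ltnn eqxx.
split.
- by rewrite size_rcons.
- move=> i /andP[i0]; rewrite size_rcons leq_eqVlt => /predU1P[->|iL].
    by rewrite /x_ /f_ /= new.
  rewrite ltnS in iL; rewrite /x_ /f_ old ?i0//.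
  case: QL => [L0|[_ h _]]; first by move: i0 iL; rewrite L0; case: i.
  by apply: h; rewrite i0.
- move=> i /andP[i0]; rewrite size_rcons ltnS => iL t u.
  have ti : ranges (rcons L a) i t = ranges L i t by rewrite /ranges /x_ /f_ old ?i0.
  rewrite ti => tL; move: iL; rewrite leq_eqVlt => /predU1P[iL|iL].
    have -> : ranges (rcons L a) i.+1 u = (range_of a.1 `|` range_of a.2) u.
      by rewrite /ranges /x_ /f_ /= iL new.
    have tN : (t <= N)%N by apply: LN tL; rewrite i0 iL /=.
    case=> -[b [_ [xb _ /andP[bu _]]]]; apply: leq_ltn_trans tN (leq_trans _ bu); apply: aN.
      by left.
    by right.
  have ui : ranges (rcons L a) i.+1 u = ranges L i.+1 u by rewrite /ranges /x_ /f_ old.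
  rewrite ui; case: QL => [L0|[_ _ h]]; first by rewrite L0 in iL.
  by apply: h => //; rewrite i0.
Qed.

Lemma ranges_bound L : exists N, forall i, (1 <= i <= size L)%N ->
  forall t, ranges L i t -> (t <= N)%N.
Proof.
have [F FP] : exists F : c00 R -> nat, forall x i, supp x i -> (i < F x)%N.
  have /choice[F FP] : forall x : c00 R, exists N, forall i, supp x i -> (i < N)%N.
    by move=> x; apply: supp_bound.
  by exists F.
have [N NP] := seq_bound (fun a : c00 R * c00 R => maxn (F a.1) (F a.2)) L.
exists N => i /andP[i0 iL] t.
have iL' : nth (0, 0) L i.-1 \in L by apply: mem_nth; rewrite prednK.
have := NP _ iL'; rewrite geq_max => /andP[h1 h2].
by case=> -[_ [b [_ xb /andP[_ tb]]]]; apply: leq_trans tb (leq_trans (ltnW (FP _ _ xb)) _).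
Qed.

Lemma flat_in_Q (ls : seq nat) c : uniq ls -> all (fun l => 0 < l)%N ls ->
  (0 < size ls)%N -> (0 < c)%N -> in_Q ((c%:R^-1 : R) *: \sum_(l <- ls) e R l).
Proof.
move=> u ps l0 c0; have cE i := sum_e_coord R i u ps.
split.
  case: ls l0 u ps cE => // l ls _ _ _ cE; exists l.
  by rewrite suppE coordZ cE mem_head mulr1 invr_eq0 pnatr_eq0 -lt0n.
move=> i; rewrite coordZ cE; split.
  apply: ratlM; first exact/ratlV/ratl_nat.
  exact: ratl_nat.
have c1 : `|c%:R^-1 : R| <= 1 by rewrite ger0_norm ?invr_ge0// invf_le1 ?ler1n ?ltr0n.
by case: (i \in ls); rewrite ?mulr1// mulr0 normr0.
Qed.

Variable y : nat -> c00 R.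
Hypothesis yb : block_sequence y.
Hypothesis y1 : forall k, nu (y k) = 1.
Variable M : set nat.
Hypothesis Minf : infinite_set M.

Definition next_weight (p0 : nat) L := if L is [::] then p0 else sigma L.

(** What is required of a new member of weight p: after an even number of
    members it is built on M, after an odd number of members it is a rational
    copy of a vector of the block subspace. *)
Definition over_basis (p : nat) (a : c00 R * c00 R) :=
  [/\ average_pair m n p a.1 a.2, tame p 3 ((m p)%:R *: a.1) &
      exists ls : seq nat, (forall l, l \in ls -> M l) /\
        a.1 = (n p)%:R^-1 *: \sum_(l <- ls) e R l].

Definition over_blocks (p : nat) (a : c00 R * c00 R) :=
  [/\ Kw p a.2, nu ((m p)%:R *: a.1) <= 1, tame p 3 ((m p)%:R *: a.1),
      1 / 32 <= pairing a.2 ((m p)%:R *: a.1) &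
      exists v, tail y 0 v /\ nu ((m p)%:R *: a.1 - v) <= (m p)%:R ^- 2].

Lemma dependent_sequence p0 : (1 < p0)%N -> ~~ odd p0 ->
  exists xi : nat -> c00 R * c00 R, forall i,
    (i = 0%N \/ in_Qs (mkseq xi i)) /\
    if odd i then over_blocks (next_weight p0 (mkseq xi i)) (xi i)
    else over_basis (next_weight p0 (mkseq xi i)) (xi i).
Proof.
move=> p1 op.
pose I L := L = [::] \/ in_Qs L.
pose Q L a := if odd (size L) then over_blocks (next_weight p0 L) a
  else over_basis (next_weight p0 L) a.
have [|L IL|xi xiP] := @history_choice _ I Q.
- by left.
- have [w1 ow] : (1 < next_weight p0 L)%N /\ ~~ odd (next_weight p0 L).
    case: L IL => [|a L] //= [//|QL].
    by have /andP[] := sigma_even Hs QL.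
  set p := next_weight p0 L in w1 ow.
  have w0 : (0 < m p)%N by rewrite (m_gt0 Hp)// ltnW.
  have mp : (m p)%:R != 0 :> R by rewrite pnatr_eq0 -lt0n.
  have np : (0 < n p)%N by rewrite (n_gt0 Hp)// ltnW.
  have [N NP] := ranges_bound L.
  have [oL|oL] := boolP (odd (size L)).
    have [z [f [v [[zr z1 zt zN] [fp fN fz] [vt zv]]]]] := even_member Hp Hs yb y1 N w1 ow.
    have zE : (m p)%:R *: ((m p)%:R^-1 *: z) = z by rewrite scalerA mulfV// scale1r.
    have [i [fi zi]] : exists i, supp f i /\ supp z i.
      apply: contrapT => h; move: fz; rewrite pairing_disjoint; first by lra.
      by move=> i fi zi; apply: h; exists i.
    exists ((m p)%:R^-1 *: z, f); split.
      rewrite /Q oL /over_blocks /= -/p zE; split=> //; last by exists v.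
      by apply: tame_le zt; lra.
    right; apply: (in_Qs_rcons IL (N := N)) => //=.
    + split; first by exists i; rewrite suppE coordZ mulf_neq0// invr_neq0.
      move=> j; rewrite coordZ; split; first by apply: ratlM => //; exact/ratlV/ratl_nat.
      rewrite normrM mulr_ile1//; last exact: le_trans (nu_coord Hp Hs z j) z1.
      by rewrite ger0_norm ?invr_ge0// invf_le1 ?ler1n ?ltr0n.
    + split; first by exists i.
      by move=> j; split; [exact: (K_rational j (Kw_K fp))|exact: (K_coord Hp Hs j (Kw_K fp))].
    + by move=> t [/suppZ/zN|/fN].
  have [ls [u sz lsM zt]] := odd_member Hp Hs N Minf w1.
  have ps : all (fun l => 0 < l)%N ls.
    by apply/allP => l /lsM[_]; apply: leq_ltn_trans.
  have ls0 : (0 < size ls)%N by rewrite sz.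
  exists ((n p)%:R^-1 *: \sum_(l <- ls) e R l, (m p)%:R^-1 *: \sum_(l <- ls) e R l); split.
    rewrite /Q (negPf oL) /over_basis /= -/p; split.
    + by exists ls.
    + by rewrite scalerA.
    + by exists ls; split=> // l /lsM[].
  right; apply: (in_Qs_rcons IL (N := N)) => //=.
  + exact: flat_in_Q.
  + exact: flat_in_Q.
  + have sN t : supp (\sum_(l <- ls) e R l) t -> (N < t)%N.
      by rewrite big_seq => /supp_sum[l /lsM[_ Nl] /supp_e->].
    by move=> t [/suppZ/sN|/suppZ/sN].
- exists xi => i; have [h1 h2] := xiP i; split.
    by case: h1 => [/(congr1 size)|]; [rewrite size_mkseq; left|right].
  by move: h2; rewrite /Q size_mkseq.
Qed.

(** ** The two nearby vectors *)

Section Pair.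
Variables (q k p0 : nat) (xi : nat -> c00 R * c00 R).
Hypothesis q2 : (2 < q)%N.
Hypothesis oq : odd q.
Hypothesis kE : k = (n q)./2.
Hypothesis p0P : (1 < p0)%N && ~~ odd p0.
Hypothesis p0k : (2 * k)%:R < Num.sqrt (m p0)%:R :> R.
Hypothesis xiP : forall i, (i = 0%N \/ in_Qs (mkseq xi i)) /\
    if odd i then over_blocks (next_weight p0 (mkseq xi i)) (xi i)
    else over_basis (next_weight p0 (mkseq xi i)) (xi i).

Let phi := mkseq xi (2 * k).
Local Notation mem := (member m sigma phi p0).

Lemma nq_double : n q = (2 * k)%N.
Proof.
have /dvdnP[a nE] : (4 %| n q)%N by apply: (n_dvd4 Hp); exact: leq_trans q2.
by rewrite kE nE; lia.
Qed.

Lemma k_gt0 : (0 < k)%N.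
Proof.
by have := n_gt0 Hp (leq_trans (ltn0Sn 1) (ltnW q2)); rewrite nq_double muln_gt0.
Qed.

Lemma phi_nth j : (j < 2 * k)%N -> nth (0, 0) phi j = xi j.
Proof. by move=> jk; rewrite nth_mkseq. Qed.

Lemma phi_take j : (j <= 2 * k)%N -> take j phi = mkseq xi j.
Proof. by move=> jk; rewrite /phi /mkseq -map_take take_iota (minn_idPl jk). Qed.

Lemma phi_weight j : (j < 2 * k)%N -> weight p0 phi j = next_weight p0 (mkseq xi j).
Proof. by case: j => [|j] jk //; rewrite /weight /= phi_take ?(ltnW jk). Qed.

Lemma phi_basis i : (i < k)%N -> over_basis (weight p0 phi (2 * i)) (xi (2 * i)).
Proof.
by move=> /double_lt[ik _]; have [_] := xiP (2 * i); rewrite mul2n odd_double phi_weight -?mul2n.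
Qed.

Lemma phi_blocks i : (i < k)%N -> over_blocks (weight p0 phi (2 * i).+1) (xi (2 * i).+1).
Proof.
move=> /double_lt[_ ik]; have [_] := xiP (2 * i).+1.
by rewrite mul2n /= odd_double phi_weight -?mul2n.
Qed.

Lemma phi_average i : (i < k)%N -> average_pair m n (weight p0 phi (2 * i))
        (x_ phi (2 * i).+1) (f_ phi (2 * i).+1).
Proof.
move=> ik; have [ik1 _] := double_lt ik.
by rewrite /x_ /f_ /= phi_nth//; have [] := phi_basis ik.
Qed.

Lemma phi_Qs : in_Qs phi.
Proof. by have [[/eqP|]] := xiP (2 * k); rewrite // muln_eq0 /= eqn0Ngt k_gt0. Qed.

Lemma phi_special : special m n sigma k phi.
Proof.
have [p01 op0] := andP p0P.
split.
- by split; [exact: phi_Qs|rewrite size_mkseq].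
- exists p0./2; have pE : (2 * p0./2)%N = p0 by rewrite mul2n even_halfK.
  rewrite pE; split=> //; first by case: p0 p01 => [|[]].
  by have := phi_average k_gt0; rewrite muln0.
- case=> // i ik w.
  have iE : (2 * i.+1)%N = (2 * i).+2 by rewrite mulnS.
  have [_ ik1] := double_lt ik.
  have wE : w = m (weight p0 phi (2 * i).+1) by rewrite /w iE.
  have [fp z1 _ _ _] := phi_blocks ik.
  set p := weight _ _ _ in wE fp z1.
  have [p1 _] : (1 < p)%N /\ ~~ odd p.
    by have := sigma_even Hs (in_Qs_take phi_Qs (ltn0Sn (2 * i))) => /andP.
  have w0 : 0 < (m p)%:R :> R by rewrite ltr0n (m_gt0 Hp)// ltnW.
  rewrite iE /x_ /f_ /= phi_nth// wE; split.
    apply: ge_sup; first by exists (`|(xi (2 * i).+1).2 0%N|), 0%N.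
    by move=> _ [j _ <-]; apply: (Kw_coord Hp Hs).
  have := K_abs_le_nu Hp Hs ((m p)%:R *: (xi (2 * i).+1).1) (Kw_K fp).
  rewrite pairingZr normrM normr_nat => /le_trans/(_ z1).
  by rewrite mulrC -ler_pdivlMr// div1r.
- move=> i /andP[i0 ik].
  have := phi_average ik; rewrite /weight ifN//.
  by rewrite -lt0n muln_gt0.
Qed.

Lemma members_tame j : (j < 2 * k)%N -> tame (weight p0 phi j) 3 (mem j).
Proof.
move=> jk; rewrite /member /x_ /= phi_nth//.
have [oj|oj] := boolP (odd j).
  have jE : j = (2 * j./2).+1 by rewrite mul2n -[LHS]odd_double_half oj.
  have jk2 : (j./2 < k)%N by rewrite -(ltn_pmul2l (ltn0Sn 1)) (leq_trans _ jk)// {2}jE.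
  by rewrite jE; have [] := phi_blocks jk2.
have jE : j = (2 * j./2)%N by rewrite mul2n -[LHS]odd_double_half (negPf oj).
have jk2 : (j./2 < k)%N by rewrite -(ltn_pmul2l (ltn0Sn 1)) -jE.
by rewrite jE; have [] := phi_basis jk2.
Qed.

Lemma phi_average0 : average_pair m n p0 (x_ phi 1) (f_ phi 1).
Proof. by have := phi_average k_gt0; rewrite muln0. Qed.

Lemma m_weight_large j : (j < 2 * k)%N ->
  ((m q)%:R ^+ 6 <= (m (weight p0 phi j))%:R :> R) /\ (1 < weight p0 phi j)%N.
Proof.
move=> jk; split; last by have /andP[] := weight_even Hs j phi_special p0P.
apply: le_trans (m_weight_ge Hp Hs phi_special p0P phi_average0 p0k jk).
apply: le_trans (_ : (2 * k)%:R <= _).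
  by rewrite -natrX ler_nat -nq_double (m_exp6_le_n Hp)// ltnW.
by rewrite -natrX ler_nat -{1}[(2 * k)%N]expn1 leq_pexp2l// muln_gt0 k_gt0.
Qed.

Lemma ranges_disjoint i j t : (i < j)%N -> (j < 2 * k)%N ->
  ranges phi i.+1 t -> ranges phi j.+1 t -> False.
Proof.
move=> ij jk ti tj; have := @ranges_before _ phi i.+1 j.+1 phi_Qs isT ij.
by rewrite size_mkseq => /(_ jk _ _ ti tj); rewrite ltnn.
Qed.

Definition basis_part : c00 R := \sum_(i < k) mem (2 * i)%N.
Definition block_part : c00 R := \sum_(i < k) mem (2 * i).+1.

Lemma blocks_sum_alternating :
  blocks_sum (2 * k) (alternating m sigma phi p0) = basis_part - block_part.
Proof.
rewrite /blocks_sum sum_pairs -sumrB; apply: eq_bigr => i _.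
by rewrite /alternating exprS exprM sqrrN !expr1n mulr1 scale1r scaleN1r.
Qed.

(** The functional of weight m_q given by [phi] itself, with f' = f, acts on
    the even members by the functionals f_(2i) only, each of which has a value
    of at least 1/32. *)
Lemma block_part_large : k%:R / (32 * (m q)%:R) <= nu block_part.
Proof.
have [Qp sz] : in_Qs phi /\ size phi = (2 * k)%N by split; [exact: phi_Qs|rewrite size_mkseq].
pose tau i := sigma (take (2 * i).-1 phi).
have tauE i : tau i.+1 = weight p0 phi (2 * i).+1 by rewrite /tau mulnS.
have fE i : (i < k)%N -> f_ phi (2 * i.+1) = (xi (2 * i).+1).2.
  by move=> /double_lt[_ ik]; rewrite mulnS /f_ /= phi_nth.
have xE i : (i < k)%N -> x_ phi (2 * i.+1) = (xi (2 * i).+1).1.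
  by move=> /double_lt[_ ik]; rewrite mulnS /x_ /= phi_nth.
have memE i : (i < k)%N -> mem (2 * i).+1 = (m (tau i.+1))%:R *: x_ phi (2 * i.+1).
  by move=> ik; rewrite tauE mulnS.
(* K_(n,phi) is formed from functionals of one fixed level of the construction *)
have /choice[lv lvP] : forall i, exists l, (i < k)%N -> Kl l (tau i.+1) (f_ phi (2 * i.+1)).
  move=> i; have [ik|_] := ltnP i k; last by exists 0%N.
  by have [[l fl] _ _ _ _] := phi_blocks ik; exists l; rewrite tauE fE.
pose l := \max_(i < k) lv i.
have lP i : (i < k)%N -> Kl l (tau i.+1) (f_ phi (2 * i.+1)).
  move=> ik; apply: Kl_le (lvP i ik).
  exact: (@leq_bigmax _ (fun i : 'I_k => lv i) (Ordinal ik)).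
pose lam i : R := pairing (f_ phi (2 * i)) ((m (tau i))%:R *: x_ phi (2 * i)).
have lam_ge i : (i < k)%N -> 1 / 32 <= lam i.+1.
  by move=> ik; rewrite /lam fE// xE// tauE; have [] := phi_blocks ik.
have tau0 i : (i < k)%N -> 0 < (m (tau i.+1))%:R :> R.
  move=> ik; rewrite ltr0n (m_gt0 Hp)// tauE.
  by have /andP[/ltnW] := weight_even Hs (2 * i).+1 phi_special p0P.
pose F := (1 / (m q)%:R) *: restr [set: nat] (\sum_(1 <= i < k.+1)
            (lam i *: f_ phi (2 * i).-1 + f_ phi (2 * i))) : c00 R.
have FK : K F.
  exists l.+1 => //; exists q => //; apply: (Kl_odd (phi := phi)) => //; first exact: ltnW.
  split; rewrite -?kE; first exact: phi_special.
    by case=> // i ik; apply: lP.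
  exists 1, [set: nat], (fun i => f_ phi (2 * i)), lam; split=> //.
  - by left.
  - case=> // i ik; split=> //; first exact: lP.
    move=> g gl.
    have [_ z1 _ _ _] := phi_blocks ik.
    have Kg : K g by exists l => //; exists (tau i.+1).
    have := le_trans (K_abs_le_nu Hp Hs _ Kg) z1.
    rewrite pairingZr normrM normr_nat -tauE -xE// mulrC -ler_pdivlMr ?tau0// div1r.
    by [].
  - case=> // i ik; case: ifPn => //; rewrite negbK => /eqP h.
    by have := lam_ge i ik; rewrite /lam pairingZr h mulr0; lra.
have mq0 : 0 < (m q)%:R :> R by rewrite ltr0n (m_gt0 Hp)// (leq_trans _ q2).
have mem_supp j : supp (mem j) `<=` ranges phi j.+1.
  by move=> t /suppZ xt; left; apply: supp_range.
have cross i j : (i < 2 * k)%N -> (j < 2 * k)%N -> i != j -> pairing (f_ phi i.+1) (mem j) = 0.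
  move=> ik jk; rewrite neq_ltn => ij; apply: pairing_disjoint => t ft /mem_supp tj.
  have ti : ranges phi i.+1 t by right; apply: supp_range.
  by case/orP: ij => ij; [apply: ranges_disjoint ij jk ti tj|apply: ranges_disjoint ij ik tj ti].
apply: le_trans (K_le_nu Hp Hs block_part FK).
rewrite /F pairingZl restr_id// div1r invfM mulrA mulrC ler_wpM2l ?invr_ge0 ?(ltW mq0)//.
rewrite big_add1 -[k.+1.-1]/k big_mkord pairing_suml.
have -> : k%:R / 32 = \sum_(i < k) (1 / 32) :> R.
  by rewrite sumr_const card_ord -[RHS]mulr_natl div1r.
apply: ler_sum => i _; have [ik1 ik2] := double_lt (ltn_ord i).
rewrite pairingDl pairingZl.
have -> : (2 * i.+1)%N = (2 * i).+2 by rewrite mulnS.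
rewrite -[(2 * i).+2.-1]/(2 * i).+1 /block_part !pairing_sumr big1 => [|j _]; last first.
  have [_ jk] := double_lt (ltn_ord j).
  by apply: (cross (2 * i)%N (2 * j).+1) => //; apply: double_neq_succ.
rewrite mulr0 add0r (bigD1 i)//= big1 ?addr0 => [|j ji]; last first.
  have [_ jk] := double_lt (ltn_ord j).
  apply: (cross (2 * i).+1 (2 * j).+1) => //.
  by rewrite eqSS eqn_pmul2l// eq_sym.
have := lam_ge i (ltn_ord i); rewrite /lam -memE//.
by rewrite mulnS.
Qed.

(** The three cases of [controlled_iter] at p = q: the growth of n_q and m_q for
    the smaller weights, [odd_weight_alternating] for the weight m_q, and the
    tameness of the members for the larger weights. *)
Lemma alternating_small : nu (basis_part - block_part) <= 240 * k%:R * (m q)%:R ^- 3.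
Proof.
have [q1 q0] : (1 < q)%N /\ (0 < q)%N by split; [exact: ltnW|exact: leq_trans q2].
set W : R := (m q)%:R; have W32 : 32 <= W by rewrite ler_nat (m_ge32 Hp).
have [j qE j0] : exists2 j, q = j.+1 & (0 < j)%N by case: (q) q1 => [|[|j]] // _; exists j.+1.
set w := W ^- 3.
have W3 : 0 < W ^+ 3 by rewrite exprn_gt0//; lra.
have w0 : 0 < w by rewrite invr_gt0.
have w1 : w <= 1 by rewrite invf_le1// exprn_ege1//; lra.
(* 30 = 10 * 3, where 3 is the constant of [members_tame] *)
have C0 : 0 <= 30 :> R by [].
have ab i l : (i < l < 2 * k)%N ->
    before (alternating m sigma phi p0 i) (alternating m sigma phi p0 l).
  move=> /andP[il lk] a b /alternating_supp ai /alternating_supp bl.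
  by apply: (ranges_before phi_Qs _ _ _ ai bl); rewrite ?size_mkseq.
have aC i f : (i < 2 * k)%N -> K f -> `|pairing f (alternating m sigma phi p0 i)| <= 30.
  move=> ik Kf; rewrite pairing_alternating; have [h _ _] := members_tame ik.
  by apply: le_trans (h f Kf) _; rewrite ler_nat.
have large r f : (q < r)%N -> Kw r f -> exists k0, forall i, (i < 2 * k)%N -> i != k0 ->
    `|pairing f (alternating m sigma phi p0 i)| <= 30 * w.
  move=> qr fr.
  have [k0 k0P] : exists k0, forall i, (i < 2 * k)%N -> i != k0 -> weight p0 phi i != r.
    have [[i [ik iw]]|h] := pselect (exists i, (i < 2 * k)%N /\ weight p0 phi i = r); last first.
      by exists 0%N => i ik _; apply/eqP => iw; apply: h; exists i.
    exists i => l lk; apply: contra => /eqP lw; apply/eqP.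
    by apply: (weight_inj Hp Hs phi_special p0P phi_average0 lk ik); rewrite lw.
  exists k0 => i ik ik0; rewrite pairing_alternating.
  have [h1 h2 h3] := members_tame ik.
  have [mw ww] := m_weight_large ik.
  have mr : W ^+ 5 <= (m r)%:R by rewrite /W -natrX ler_nat (m_exp5 Hp).
  have W35 : W ^+ 3 <= W ^+ 5 by rewrite ler_weXn2l//; lra.
  have W36 : W ^+ 3 <= W ^+ 6 by rewrite ler_weXn2l//; lra.
  have r0 : 0 < (m r)%:R :> R by exact: lt_le_trans W3 (le_trans W35 mr).
  have := k0P i ik ik0; rewrite neq_ltn => /orP[wr|rw].
    apply: le_trans (h3 _ _ wr fr) _.
    set V : R := (m (weight p0 phi i))%:R in mw *.
    have V0 : 0 < V by exact: lt_le_trans W3 (le_trans W36 mw).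
    have V1 : 1 <= V by rewrite ler1n -(ltr0n R).
    apply: ler_pM => //; first by rewrite invr_ge0 exprn_ge0// ltW.
      by rewrite ler_nat.
    have V2 : 0 < V ^+ 2 by rewrite exprn_gt0.
    rewrite lef_pV2 ?posrE//; apply: le_trans (le_trans W36 mw) _.
    by rewrite expr2 ler_peMr// ltW.
  apply: le_trans (h2 r f _ fr) _; first by rewrite rw (leq_trans _ (ltnW qr)).
  apply: ler_pM => //; first by rewrite ler_nat.
  by rewrite lef_pV2 ?posrE//; apply: le_trans W35 mr.
have atp f : Kw q f -> controlled (2 * k) (alternating m sigma phi p0) 30 2 w f.
  move=> fq u v uv _.
  have C3 : 1 <= 3 :> R by rewrite ler1n.
  have := odd_weight_alternating Hp Hs q2 oq kE phi_special p0P p0k phi_average C3 members_tame fq.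
  have := touched_sub_ge0 (2 * k) (alternating m sigma phi p0) uv => t0.
  have : 0 <= ((touched (2 * k) (alternating m sigma phi p0) v)%:R -
    (touched (2 * k) (alternating m sigma phi p0) u)%:R) * w by rewrite mulr_ge0// ltW.
  by lra.
have w01 : 0 <= w <= 1 by rewrite (ltW w0).
rewrite -blocks_sum_alternating; apply: nu_le => f Kf; apply: le_trans (ler_norm _) _.
have := controlled_iter Hp Hs C0 ab aC q1 w01 large atp (s j) Kf.
have k0 : 0 <= 2 ^- s j + w by rewrite addr_ge0 ?invr_ge0 ?exprn_ge0// ltW.
move=> /(controlled_total C0 k0) h; apply: le_trans h _.
rewrite qE /= -/(W).
have b_le : 2 ^- s j <= w.
  have p2 : 0 < 2 ^+ s j :> R by rewrite exprn_gt0.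
  rewrite lef_pV2 ?posrE//.
  by rewrite /W -!natrX ler_nat qE (s_large Hp).
have a_le : (n j)%:R ^+ s j <= (2 * k)%:R * w.
  rewrite ler_pdivlMr// -nq_double.
  apply: le_trans (_ : (n j)%:R ^+ s j * W ^+ 6 <= _).
    by rewrite ler_wpM2l ?exprn_ge0// ler_weXn2l//; lra.
  rewrite /W -!natrX -natrM ler_nat qE (n_split Hp)// leq_mul2l.
  by rewrite (m_exp6_le_exp4 Hp)// orbT.
have K0 : 0 <= (2 * k)%:R :> R by [].
have : (2 * k)%:R * (2 ^- s j + w) <= (2 * k)%:R * (2 * w) by rewrite ler_wpM2l//; lra.
rewrite natrM in a_le *; lra.
Qed.

(** The quotient of the two bounds is of order 1 / m_q^2; one factor 1 / m_q
    absorbs the constants. *)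
Lemma near_pair : exists v, [/\ tail y 0 v, 0 < nu v & nu (basis_part - v) <= nu v / (m q)%:R].
Proof.
have /choice[v vP] : forall i, exists v, (i < k)%N ->
    tail y 0 v /\ nu (mem (2 * i).+1 - v) <= (m q)%:R ^- 3.
  move=> i; have [ik|_] := ltnP i k; last by exists 0.
  have [_ ik2] := double_lt ik.
  have [_ _ _ _ [v [vt vn]]] := phi_blocks ik.
  exists v => _; split=> //; rewrite /member /x_ /= phi_nth//; apply: le_trans vn _.
  have [mw _] := m_weight_large ik2.
  have W0 : 1 <= (m q)%:R :> R by rewrite ler1n (m_gt0 Hp)// (leq_trans _ q2).
  set W : R := (m q)%:R in W0 mw *; set V : R := (m _)%:R in mw *.
  have W1 : 0 < W ^+ 3 by rewrite exprn_gt0//; lra.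
  have V1 : W ^+ 3 <= V by apply: le_trans mw; rewrite ler_weXn2l.
  have V0 : 0 < V by exact: lt_le_trans W1 V1.
  have V2 : 0 < V ^+ 2 by rewrite exprn_gt0.
  rewrite lef_pV2 ?posrE//; apply: le_trans V1 _.
  by rewrite expr2 ler_peMr ?(ltW V0)// ler1n -(ltr0n R).
pose V := \sum_(i < k) v i : c00 R.
have Vt : tail y 0 V by apply: tail_sum => i _; have [] := vP i (ltn_ord i).
set W : R := (m q)%:R in vP *.
have W32 : 32 * 32 * 32 <= W.
  have W5 : 32 ^+ 5 <= W.
    rewrite -natrX ler_nat; apply: leq_trans (m_exp5 Hp (ltn0Sn 1) q2).
    by rewrite leq_exp2r// (m_ge32 Hp).
  apply: le_trans W5; rewrite -[_ * _ * _]/(32 ^+ 2 * 32) -exprSr.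
  by rewrite ler_weXn2l// ler1n.
set w := W^-1.
have w0 : 0 < w by rewrite invr_gt0; lra.
have Ww : W * w = 1 by rewrite mulfV//; apply: lt0r_neq0; lra.
have wE : W ^- 3 = w * w * w by rewrite /w -exprVn exprSr expr2.
have ws : 32 * 32 * 32 * w <= 1 by have := ler_wpM2r (ltW w0) W32; rewrite Ww.
have kR : 0 < k%:R :> R by rewrite ltr0n k_gt0.
have diff : nu (block_part - V) <= k%:R * (w * w * w).
  rewrite /block_part /V -sumrB; apply: nu_le => f Kf; rewrite pairing_sumr.
  rewrite mulr_natl -[k in _ *+ k]card_ord -sumr_const; apply: ler_sum => i _.
  rewrite -wE; have [_ h] := vP i (ltn_ord i); apply: le_trans h.
  exact: (K_le_nu Hp Hs).
have alt := alternating_small; rewrite -/W wE in alt.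
have low := block_part_large; rewrite -/W in low.
have lowE : k%:R / (32 * W) = k%:R * w / 32 by rewrite invfM mulrA mulrAC.
rewrite lowE in low.
have tri1 : nu block_part <= nu V + nu (block_part - V).
  by apply: le_trans (nuD Hp Hs _ _); rewrite addrC subrK.
have tri2 : nu (basis_part - V) <= nu (basis_part - block_part) + nu (block_part - V).
  by apply: le_trans (nuD Hp Hs _ _); rewrite addrA subrK.
set X := k%:R * w in low.
have X0 : 0 < X by rewrite mulr_gt0.
have XE : k%:R * (w * w * w) = X * w * w by rewrite /X !mulrA.
have ww : 32 * 32 * 32 * (X * w) <= X by rewrite mulrCA ler_piMr// ltW.
have ww2 : X * w * w <= X * w / 32.
  rewrite ler_wpM2l//; first by rewrite ltW// mulr_gt0.
  by lra.
have Xw0 : 0 < X * w by rewrite mulr_gt0.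
rewrite XE in diff; rewrite -[240 * k%:R * _]mulrA XE in alt.
have big : X / 64 <= nu V by lra.
exists V; split=> //; first by lra.
rewrite -/w; apply: le_trans (_ : X / 64 * w <= _); last by rewrite ler_wpM2r// ltW.
have ww3 : 32 * 32 * 32 * (X * w * w) <= X * w.
  rewrite -[X * w * w]mulrC mulrA; rewrite -[leRHS]mul1r ler_wpM2r// ltW//.
rewrite mulrAC; lra.
Qed.

End Pair.
End Dependent.

(** * The distance between the spheres *)

Section LinearSpan.
Variables (R : realType) (V : lmodType R) (A : set V).

Lemma lin_span_mem a : A a -> lin_span A a.
Proof.
move=> Aa; exists 1%N, (fun=> 1), (fun=> a); split=> //.
by rewrite big_ord_recl big_ord0 addr0 scale1r.
Qed.

Lemma lin_span0 : lin_span A 0.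
Proof. by exists 0%N, (fun=> 0), (fun=> 0); split; [case|rewrite big_ord0]. Qed.

Lemma lin_spanZ c x : lin_span A x -> lin_span A (c *: x).
Proof.
case=> d [b [v [Av ->]]]; exists d, (fun i => c * b i), v; split=> //.
by rewrite scaler_sumr; apply: eq_bigr => i _; rewrite scalerA.
Qed.

Lemma lin_spanD x z : lin_span A x -> lin_span A z -> lin_span A (x + z).
Proof.
case=> d [b [v [Av ->]]] [d' [b' [v' [Av' ->]]]]; exists (d + d')%N.
exists (fun i => match fintype.split i with inl j => b j | inr j => b' j end).
exists (fun i => match fintype.split i with inl j => v j | inr j => v' j end); split.
  by move=> i; case: (fintype.split i).
rewrite big_split_ord /=; congr (_ + _); apply: eq_bigr => i _.
  by rewrite (unsplitK (inl i)).
by rewrite (unsplitK (inr i)).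
Qed.

Lemma lin_span_sum I (t : seq I) (P : pred I) (F : I -> V) :
  (forall i, P i -> lin_span A (F i)) -> lin_span A (\sum_(i <- t | P i) F i).
Proof. by move=> h; elim/big_ind: _ => //; [exact: lin_span0|exact: lin_spanD]. Qed.

End LinearSpan.

(** Normalizing two vectors at most doubles their distance relative to the norm
    of one of them. *)
Lemma normalized_dist (R : realType) (X : normedModType R) (u v : X) (eps : R) :
  0 <= eps < 1 -> 0 < `|v| -> `|u - v| <= eps * `|v| ->
  0 < `|u| /\ `| `|u|^-1 *: u - `|v|^-1 *: v| <= 2 * eps.
Proof.
move=> /andP[e0 e1] v0 uv.
have u0 : 0 < `|u|.
  have : `|v| <= `|u| + `|u - v| by rewrite -{1}(subKr u v) (le_trans (ler_normB _ _)).
  by nra.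
split=> //.
have -> : `|u|^-1 *: u - `|v|^-1 *: v = `|v|^-1 *: (u - v) + (`|u|^-1 - `|v|^-1) *: u.
  by rewrite scalerBr scalerBl [RHS]addrC addrA subrK.
apply: le_trans (ler_normD _ _) _; rewrite !normrZ.
rewrite [`| `|v|^-1 |]ger0_norm ?invr_ge0//.
have -> : `|(`|u|^-1 - `|v|^-1)| * `|u| = `| `|v| - `|u| | / `|v|.
  rewrite -[X in _ * X]ger0_norm// -normrM mulrBl mulVf ?gt_eqF//.
  rewrite -[X in _ / X]ger0_norm// -normfV -normrM mulrBl mulfV ?gt_eqF//.
  by rewrite [_^-1 * _]mulrC.
have h1 : `|v|^-1 * `|u - v| <= eps by rewrite mulrC ler_pdivrMr.
have h2 : `| `|v| - `|u| | / `|v| <= eps.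
  rewrite ler_pdivrMr//; apply: le_trans uv; rewrite distrC.
  exact: ler_dist_dist.
by rewrite mulr_natl mulr2n lerD.
Qed.

Theorem proposition4p16 (R : realType) (m n s : nat -> nat)
    (sigma : seq (c00 R * c00 R) -> nat)
    (Hparams : ius_params m n s) (Hsigma : coding m sigma)
    (Xius : completeNormedModType R) (J : {linear c00 R -> Xius})
    (HX : is_completion (norm_ius m n sigma) J)
    (M : set nat) (Minf : infinite_set M) (Mpos : forall i, M i -> (0 < i)%N)
    (y : nat -> c00 R) (Hblock : block_sequence y)
    (Hnorm : forall k, `|J (y k)| = 1) :
  dist (unit_sphere (lin_span [set J (e R i) | i in M]))
       (unit_sphere (lin_span [set J (y k) | k in [set: nat]])) = 0%E.
Proof.
have [isoJ _] := HX.
have y1 k : norm_ius m n sigma (y k) = 1 by rewrite -isoJ.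
apply/eqP; rewrite eq_le; apply/andP; split; last first.
  by apply: le_ereal_inf_tmp => _ [a _ [b _ <-]]; rewrite lee_fin.
apply/lee_addgt0Pr => eps eps0; rewrite add0e.
have [t [t0 tP]] := m_unbounded Hparams (2 / eps + 2).
pose q := (2 * t).+1; pose k := (n q)./2.
have q2 : (2 < q)%N by rewrite ltnS -{1}[2%N]muln1 leq_pmul2l.
have oq : odd q by rewrite /q mul2n /= odd_double.
(* 2 p is the index of the first weight, whose square root has to exceed the
   length of the special sequence *)
have [p [p_gt0 pP]] := m_unbounded Hparams (((2 * k).+1%:R : R) ^+ 2).
have pk : (2 * k)%:R < Num.sqrt (m (2 * p)%N)%:R :> R.
  apply: lt_le_trans (_ : (2 * k).+1%:R <= _); first by rewrite ltr_nat.
  by rewrite -[leLHS]ger0_norm// -sqrtr_sqr ler_wsqrtr.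
have p1 : (1 < 2 * p)%N by rewrite -{1}[2%N]muln1 leq_pmul2l.
have op : ~~ odd (2 * p) by rewrite mul2n odd_double.
have [xi xiP] := dependent_sequence Hparams Hsigma Hblock y1 Minf p1 op.
have p0P : (1 < 2 * p)%N && ~~ odd (2 * p) by rewrite p1.
have [v [vt v0 uv]] := near_pair Hparams Hsigma q2 oq (erefl k) p0P pk xiP.
set u := basis_part _ _ _ _ _ in uv.
have W0 : 0 < (m q)%:R :> R by rewrite ltr0n (m_gt0 Hparams).
have Wbig : 2 / eps + 2 <= (m q)%:R :> R.
  by apply: le_trans tP _; rewrite ler_nat (m_le Hparams)// muln_gt0.
have W2 : 2 <= (m q)%:R :> R.
  by apply: le_trans Wbig; rewrite lerDr divr_ge0// ltW.
have e1 : 0 <= (m q)%:R^-1 :> R /\ (m q)%:R^-1 < 1 :> R.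
  by rewrite invr_ge0 ltW// invf_lt1//; split=> //; lra.
have vJ : 0 < `|J v| by rewrite isoJ.
have uvJ : `|J u - J v| <= (m q)%:R^-1 * `|J v|.
  by rewrite -linearB !isoJ mulrC.
have [uJ close] := normalized_dist (introT andP e1) vJ uvJ.
apply: le_trans (_ : (`| `|J u|^-1 *: J u - `|J v|^-1 *: J v|)%:E <= _)%E; last first.
  rewrite lee_fin; apply: le_trans close _.
  rewrite -ler_pdivlMl// mulrC -[leRHS]invf_div lef_pV2 ?posrE// ?divr_gt0//.
  by apply: le_trans Wbig; rewrite lerDl.
apply: ereal_inf_lbound; exists (`|J u|^-1 *: J u); last first.
  exists (`|J v|^-1 *: J v) => //; split.
    apply: lin_spanZ; case: vt => b [c ->].
    rewrite linear_sum; apply: lin_span_sum => i _; rewrite linearZ.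
    by apply/lin_spanZ/lin_span_mem; exists i.
  by rewrite /= normrZ normfV normr_id mulVf// gt_eqF.
split; last by rewrite /= normrZ normfV normr_id mulVf// gt_eqF.
apply: lin_spanZ; rewrite linear_sum; apply: lin_span_sum => i _.
rewrite linearZ; apply: lin_spanZ.
have [_ _ [ls [lsM xE]]] := phi_basis xiP (ltn_ord i).
have [ik _] := double_lt (ltn_ord i).
rewrite /x_ /= nth_mkseq// xE linearZ; apply: lin_spanZ.
rewrite linear_sum big_seq; apply: lin_span_sum => l /lsM Ml.
by apply: lin_span_mem; exists l.
Qed.
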